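(* Let $(R,\mathfrak m,k)$ be a complete (Noetherian) local ring with associated graded ring $G=\bigoplus_{i\ge 0}\mathfrak m^i/\mathfrak m^{i+1}$. If $R$ has equal characteristic, let $V=k$, identified with a coefficient field of $R$; if $R$ has mixed characteristic, let $V$ be a complete unramified discrete valuation ring with residue field $k$, together with a ring homomorphism $V\to R$ inducing the identity on the residue field $k$. Then there exist an integer $n\ge 0$ and a complete local ring $\hom(R)$, given as a quotient of the power series ring $V[[x_1,\dots,x_n]][[t]]$, such that (the image of) $t$ is a non-zero divisor on $\hom(R)$, $$\hom(R)/(t)\cong \widehat G \quad\text{and}\quad \big(\hom(R)\otimes_{V[[t]]}V((t))\big)^{\wedge}\;\cong\;\big(R\otimes_V V((t))\big)^{\wedge}.$$ Here $\widehat G$ is the completion of $G$ at $G_+=\bigoplus_{i>0}\mathfrak m^i/\mathfrak m^{i+1}$, the completion on the left of the last isomorphism is taken with respect to the extension of the ideal $(x_1,\dots,x_n)$ in equal characteristic and of $(p,x_1,\dots,x_n)$, $p=\operatorname{char}(k)$, in mixed characteristic, and the completion on the right is taken with respect to the extension of $\mathfrak m$.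
   Context: All local rings are Noetherian. A complete local ring has equal characteristic if it contains a field, and mixed characteristic otherwise (so its characteristic is $0$ or $p^m$ with $m>1$, where $p>0$ is the characteristic of the residue field). A complete unramified discrete valuation ring of mixed characteristic $(0,p)$ is a complete discrete valuation ring of characteristic $0$ whose maximal ideal is generated by the prime number $p$. A coefficient field of $R$ is a subfield of $R$ mapping isomorphically onto $R/\mathfrak m$. $V((t))=V[[t]][t^{-1}]$. Isomorphisms are isomorphisms of rings. *)

(* Defs.v *)
From HB Require Import structures.
From mathcomp Require Import all_boot all_algebra generic_quotient.
From mathcomp Require Import boolp classical_sets.
From mathcomp Require Import ring.
Set Implicit Arguments.
Unset Strict Implicit.
Unset Printing Implicit Defensive.
Import GRing.Theory.
Local Open Scope ring_scope.
Local Open Scope quotient_scope.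
#[local] Obligation Tactic := cbv beta.

(* Rings are commutative with unit and may be zero (comPzRingType): a
   completion or a quotient by an arbitrary ideal can be the zero ring.
   MathComp's {ideal_quot I} needs a proper ideal of a non-zero ring, so
   quotients are built here for all ideals. *)

Definition ring_iso (A B : comPzRingType) : Prop :=
  exists f : {rmorphism A -> B}, bijective f.

(* A type with operations satisfying the axioms of commutative rings up to a
   congruence [peq]; [qring] is the ring of congruence classes. *)
Record presring := Presring {
  pcarrier :> choiceType;
  peq : pcarrier -> pcarrier -> Prop;
  pzero : pcarrier;
  popp : pcarrier -> pcarrier;
  padd : pcarrier -> pcarrier -> pcarrier;
  pone : pcarrier;
  pmul : pcarrier -> pcarrier -> pcarrier;
  peq_refl : forall x, peq x x;
  peq_sym : forall x y, peq x y -> peq y x;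
  peq_trans : forall x y z, peq x y -> peq y z -> peq x z;
  popp_cong : forall x x', peq x x' -> peq (popp x) (popp x');
  padd_cong : forall x x' y, peq x x' -> peq (padd x y) (padd x' y);
  pmul_cong : forall x x' y, peq x x' -> peq (pmul x y) (pmul x' y);
  paddA : forall x y z, peq (padd x (padd y z)) (padd (padd x y) z);
  paddC : forall x y, peq (padd x y) (padd y x);
  padd0 : forall x, peq (padd pzero x) x;
  paddN : forall x, peq (padd (popp x) x) pzero;
  pmulA : forall x y z, peq (pmul x (pmul y z)) (pmul (pmul x y) z);
  pmulC : forall x y, peq (pmul x y) (pmul y x);
  pmul1 : forall x, peq (pmul pone x) x;
  pmulD : forall x y z, peq (pmul (padd x y) z) (padd (pmul x z) (pmul y z)) }.

Section QRing.
Variable P : presring.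

Definition peqb (x y : P) : bool := `[< peq x y >].

Lemma peqb_is_equiv : equiv_class_of peqb.
Proof.
split=> [x|x y|y x z]; first exact/asboolP/peq_refl.
  by apply/asboolP/asboolP; apply: peq_sym.
by move=> /asboolP xy /asboolP yz; apply/asboolP/(peq_trans xy yz).
Qed.
Canonical peqb_equiv := EquivRelPack peqb_is_equiv.

Definition qring : Type := {eq_quot peqb}.
HB.instance Definition _ := Choice.on qring.
HB.instance Definition _ : EqQuotient P peqb qring := EqQuotient.on qring.

Definition qcls (x : P) : qring := \pi_qring x.

Lemma qclsP x y : qcls x = qcls y <-> peq x y.
Proof.
rewrite /qcls; split=> [/eqP|xy]; first by rewrite piE => /asboolP.
by apply/eqP; rewrite piE; apply/asboolP.
Qed.

Lemma qcls_repr (a : qring) : qcls (repr a) = a.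
Proof. by rewrite /qcls reprK. Qed.

Lemma qcls_ind (K : qring -> Prop) : (forall x, K (qcls x)) -> forall a, K a.
Proof. by move=> Kc a; rewrite -(qcls_repr a). Qed.

Definition qopp (a : qring) := qcls (popp (repr a)).
Definition qadd (a b : qring) := qcls (padd (repr a) (repr b)).
Definition qmul (a b : qring) := qcls (pmul (repr a) (repr b)).

Lemma qcls_opp x : qcls (popp x) = qopp (qcls x).
Proof. by apply/qclsP/popp_cong/qclsP; rewrite qcls_repr. Qed.

Lemma qcls_add x y : qcls (padd x y) = qadd (qcls x) (qcls y).
Proof.
apply/qclsP/(@peq_trans _ _ (padd (repr (qcls x)) y)).
  by apply/padd_cong/qclsP; rewrite qcls_repr.
apply: (peq_trans (paddC _ _)); apply: peq_trans (paddC _ _).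
by apply/padd_cong/qclsP; rewrite qcls_repr.
Qed.

Lemma qcls_mul x y : qcls (pmul x y) = qmul (qcls x) (qcls y).
Proof.
apply/qclsP/(@peq_trans _ _ (pmul (repr (qcls x)) y)).
  by apply/pmul_cong/qclsP; rewrite qcls_repr.
apply: (peq_trans (pmulC _ _)); apply: peq_trans (pmulC _ _).
by apply/pmul_cong/qclsP; rewrite qcls_repr.
Qed.

Lemma qaddA : associative qadd.
Proof.
elim/qcls_ind=> x; elim/qcls_ind=> y; elim/qcls_ind=> z.
by rewrite -!qcls_add; apply/qclsP/paddA.
Qed.
Lemma qaddC : commutative qadd.
Proof.
by elim/qcls_ind=> x; elim/qcls_ind=> y; rewrite -!qcls_add; apply/qclsP/paddC.
Qed.
Lemma qadd0 : left_id (qcls (pzero P)) qadd.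
Proof. by elim/qcls_ind=> x; rewrite -qcls_add; apply/qclsP/padd0. Qed.
Lemma qaddN : left_inverse (qcls (pzero P)) qopp qadd.
Proof.
by elim/qcls_ind=> x; rewrite -qcls_opp -qcls_add; apply/qclsP/paddN.
Qed.
HB.instance Definition _ := GRing.isZmodule.Build qring qaddA qaddC qadd0 qaddN.

Lemma qmulA : associative qmul.
Proof.
elim/qcls_ind=> x; elim/qcls_ind=> y; elim/qcls_ind=> z.
by rewrite -!qcls_mul; apply/qclsP/pmulA.
Qed.
Lemma qmulC : commutative qmul.
Proof.
by elim/qcls_ind=> x; elim/qcls_ind=> y; rewrite -!qcls_mul; apply/qclsP/pmulC.
Qed.
Lemma qmul1 : left_id (qcls (pone P)) qmul.
Proof. by elim/qcls_ind=> x; rewrite -qcls_mul; apply/qclsP/pmul1. Qed.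
Lemma qmulD : left_distributive qmul qadd.
Proof.
elim/qcls_ind=> x; elim/qcls_ind=> y; elim/qcls_ind=> z.
by rewrite -!(qcls_mul, qcls_add); apply/qclsP/pmulD.
Qed.
HB.instance Definition _ :=
  GRing.Zmodule_isComPzRing.Build qring qmulA qmulC qmul1 qmulD.

Lemma qclsD x y : qcls (padd x y) = qcls x + qcls y.
Proof. exact: qcls_add. Qed.
Lemma qclsN x : qcls (popp x) = - qcls x.
Proof. exact: qcls_opp. Qed.
Lemma qclsM x y : qcls (pmul x y) = qcls x * qcls y.
Proof. exact: qcls_mul. Qed.
Lemma qcls0 : qcls (pzero P) = 0. Proof. by []. Qed.
Lemma qcls1 : qcls (pone P) = 1. Proof. by []. Qed.

End QRing.

Record ideal (A : comPzRingType) := Ideal {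
  ideal_mem :> A -> Prop;
  ideal0 : ideal_mem 0;
  idealD : forall x y, ideal_mem x -> ideal_mem y -> ideal_mem (x + y);
  idealMl : forall a x, ideal_mem x -> ideal_mem (a * x) }.

Section Ideals.
Variable A : comPzRingType.
Implicit Types (I J : ideal A) (X : set A).

Lemma idealN I x : I x -> I (- x).
Proof. by rewrite -mulN1r; apply: idealMl. Qed.

Lemma idealB I x y : I x -> I y -> I (x - y).
Proof. by move=> Ix Iy; apply: idealD => //; apply: idealN. Qed.

Definition gen_set X : set A := [set a | exists s : seq (A * A),
  (forall u, u \in s -> X u.2) /\ a = \sum_(u <- s) u.1 * u.2].

Lemma gen_set0 X : gen_set X 0.
Proof. by exists [::]; rewrite big_nil. Qed.
Lemma gen_setD X x y : gen_set X x -> gen_set X y -> gen_set X (x + y).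
Proof.
move=> [s [sX ->]] [r [rX ->]]; exists (s ++ r); rewrite big_cat; split=> // u.
by rewrite mem_cat => /orP[/sX|/rX].
Qed.
Lemma gen_setM X a x : gen_set X x -> gen_set X (a * x).
Proof.
move=> [s [sX ->]]; exists [seq (a * u.1, u.2) | u <- s]; split.
  by move=> _ /mapP[u /sX Xu ->].
by rewrite big_map big_distrr /=; apply: eq_bigr => u _; rewrite mulrA.
Qed.
Definition ideal_gen X := Ideal (gen_set0 X) (@gen_setD X) (@gen_setM X).

Definition ideal_mul I J : ideal A :=
  ideal_gen [set a | exists x y, [/\ I x, J y & a = x * y]].

Definition ideal_one : ideal A := @Ideal A setT Logic.I
  (fun _ _ _ _ => Logic.I) (fun _ _ _ => Logic.I).

Fixpoint ideal_pow I n : ideal A :=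
  if n is n'.+1 then ideal_mul I (ideal_pow I n') else ideal_one.

Lemma ideal_powS I n x : ideal_pow I n.+1 x -> ideal_pow I n x.
Proof.
case=> s [sI ->]; elim: s sI => [|u s IHs] sI; first by rewrite big_nil; apply: ideal0.
rewrite big_cons; apply: idealD; last by apply: IHs => v vs; apply: sI; rewrite inE vs orbT.
apply: idealMl; have [x1 [y1 [_ Jy ->]]] := sI u (mem_head _ _).
exact: idealMl.
Qed.

Lemma ideal_pow_leq I m n x : (m <= n)%N -> ideal_pow I n x -> ideal_pow I m x.
Proof.
move=> /subnK <-; elim: (n - m)%N => [//|k IHk] /ideal_powS; exact: IHk.
Qed.

Lemma ideal_powM I m n x y :
  ideal_pow I m x -> ideal_pow I n y -> ideal_pow I (m + n) (x * y).
Proof.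
elim: m x => [|m IHm] x; first by move=> _ Iy; apply: idealMl.
move=> [s [sI ->]] Iy; rewrite addSn big_distrl /=.
elim: s sI => [|u s IHs] sI; first by rewrite big_nil; apply: gen_set0.
rewrite big_cons; apply: gen_setD; last by apply: IHs => v vs; apply: sI; rewrite inE vs orbT.
have [a [b [Ia Ib ->]]] := sI u (mem_head _ _).
exists [:: (u.1, a * (b * y))]; rewrite big_seq1 /= -!mulrA; split=> // v.
by rewrite inE => /eqP -> /=; exists a, (b * y); split=> //; apply: IHm.
Qed.

Lemma presquot_cong I x x' y : I (x - x') -> I (x + y - (x' + y)).
Proof. by rewrite opprD addrACA subrr addr0. Qed.

Program Definition quot_pres I := @Presring A (fun x y => I (x - y))
  0 -%R +%R 1 *%R _ _ _ _ _ _ _ _ _ _ _ _ _ _.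
Next Obligation. by move=> I x; rewrite subrr; apply: ideal0. Qed.
Next Obligation. by move=> I x y /idealN; rewrite opprB. Qed.
Next Obligation.
by move=> I x y z xy yz; rewrite -(subrK y x) -addrA; apply: idealD.
Qed.
Next Obligation. by move=> I x x' xx; rewrite opprK addrC -opprB; apply: idealN. Qed.
Next Obligation. by move=> I x x' y; apply: presquot_cong. Qed.
Next Obligation. by move=> I x x' y xx; rewrite -mulrBl mulrC; apply: idealMl. Qed.
Next Obligation. by move=> I x y z; rewrite addrA subrr; apply: ideal0. Qed.
Next Obligation. by move=> I x y; rewrite (addrC x) subrr; apply: ideal0. Qed.
Next Obligation. by move=> I x; rewrite add0r subrr; apply: ideal0. Qed.
Next Obligation. by move=> I x; rewrite addNr subrr; apply: ideal0. Qed.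
Next Obligation. by move=> I x y z; rewrite mulrA subrr; apply: ideal0. Qed.
Next Obligation. by move=> I x y; rewrite mulrC subrr; apply: ideal0. Qed.
Next Obligation. by move=> I x; rewrite mul1r subrr; apply: ideal0. Qed.
Next Obligation. by move=> I x y z; rewrite mulrDl subrr; apply: ideal0. Qed.

Definition quot I : comPzRingType := qring (quot_pres I).
Definition quot_proj I (a : A) : quot I := @qcls (quot_pres I) a.

Lemma quot_projP I a b : quot_proj I a = quot_proj I b <-> I (a - b).
Proof. exact: qclsP. Qed.

Lemma quot_proj_zmod I : zmod_morphism (quot_proj I).
Proof.
move=> x y; apply: (etrans (@qclsD (quot_pres I) x (- y))).
by congr (_ + _); apply: (@qclsN (quot_pres I)).
Qed.
Lemma quot_proj_monoid I : monoid_morphism (quot_proj I).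
Proof. by split=> [//|x y]; apply: (@qclsM (quot_pres I)). Qed.
HB.instance Definition _ I :=
  GRing.isZmodMorphism.Build A (quot I) (quot_proj I) (@quot_proj_zmod I).
HB.instance Definition _ I :=
  GRing.isMonoidMorphism.Build A (quot I) (quot_proj I) (@quot_proj_monoid I).

Lemma quot_proj_surj I (a : quot I) : exists x, a = quot_proj I x.
Proof. by exists (repr a); rewrite /quot_proj qcls_repr. Qed.

Lemma quot_proj0P I a : quot_proj I a = 0 <-> I a.
Proof. by rewrite -[a in I a]subr0 -quot_projP rmorph0. Qed.

End Ideals.

Definition ideal_ext (A B : comPzRingType) (f : A -> B) (I : ideal A) : ideal B :=
  ideal_gen [set f x | x in [set x | I x]]%classic.

Section Completion.
Variables (A : comPzRingType) (I : ideal A).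

(* [u] and [v] are the images of one element of A, i.e. the class [v] modulo
   I^(n+1) reduces to the class [u] modulo I^n. *)
Definition reduces n (u : quot (ideal_pow I n)) (v : quot (ideal_pow I n.+1)) :=
  exists a, u = quot_proj _ a /\ v = quot_proj _ a.

(* the inverse limit of the A / I^n *)
Record completion : Type := Completion {
  cmp :> forall n, quot (ideal_pow I n);
  cmpP : forall n, reduces (cmp n) (cmp n.+1) }.

HB.instance Definition _ := gen_eqMixin completion.
HB.instance Definition _ := gen_choiceMixin completion.

Lemma cmp_inj (x y : completion) : (forall n, x n = y n) -> x = y.
Proof.
case: x y => x Px [y Py] /= xy.
have {}xy : x = y by apply: functional_extensionality_dep.
case: _ / xy Py => Py.
by congr Completion; apply: Prop_irrelevance.
Qed.

Program Definition cmp0 := @Completion (fun=> 0) _.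
Next Obligation. by move=> n; exists 0; rewrite !rmorph0. Qed.
Program Definition cmp1 := @Completion (fun=> 1) _.
Next Obligation. by move=> n; exists 1; rewrite !rmorph1. Qed.
Program Definition cmp_opp (x : completion) := @Completion (fun n => - x n) _.
Next Obligation.
by move=> x n; have [a [-> ->]] := cmpP x n; exists (- a); rewrite !rmorphN.
Qed.
Program Definition cmp_add (x y : completion) :=
  @Completion (fun n => x n + y n) _.
Next Obligation.
move=> x y n; have [a [-> ->]] := cmpP x n; have [b [-> ->]] := cmpP y n.
by exists (a + b); rewrite !rmorphD.
Qed.
Program Definition cmp_mul (x y : completion) :=
  @Completion (fun n => x n * y n) _.
Next Obligation.
move=> x y n; have [a [-> ->]] := cmpP x n; have [b [-> ->]] := cmpP y n.
by exists (a * b); rewrite !rmorphM.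
Qed.

Lemma cmp_addA : associative cmp_add.
Proof. by move=> x y z; apply: cmp_inj => n /=; rewrite addrA. Qed.
Lemma cmp_addC : commutative cmp_add.
Proof. by move=> x y; apply: cmp_inj => n /=; rewrite addrC. Qed.
Lemma cmp_add0 : left_id cmp0 cmp_add.
Proof. by move=> x; apply: cmp_inj => n /=; rewrite add0r. Qed.
Lemma cmp_addN : left_inverse cmp0 cmp_opp cmp_add.
Proof. by move=> x; apply: cmp_inj => n /=; rewrite addNr. Qed.
HB.instance Definition _ :=
  GRing.isZmodule.Build completion cmp_addA cmp_addC cmp_add0 cmp_addN.

Lemma cmp_mulA : associative cmp_mul.
Proof. by move=> x y z; apply: cmp_inj => n /=; rewrite mulrA. Qed.
Lemma cmp_mulC : commutative cmp_mul.
Proof. by move=> x y; apply: cmp_inj => n /=; rewrite mulrC. Qed.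
Lemma cmp_mul1 : left_id cmp1 cmp_mul.
Proof. by move=> x; apply: cmp_inj => n /=; rewrite mul1r. Qed.
Lemma cmp_mulD : left_distributive cmp_mul cmp_add.
Proof. by move=> x y z; apply: cmp_inj => n /=; rewrite mulrDl. Qed.
HB.instance Definition _ := GRing.Zmodule_isComPzRing.Build completion
  cmp_mulA cmp_mulC cmp_mul1 cmp_mulD.

Program Definition to_completion (a : A) :=
  @Completion (fun n => quot_proj _ a) _.
Next Obligation. by move=> a n; exists a. Qed.

Lemma to_completion_zmod : zmod_morphism to_completion.
Proof. by move=> x y; apply: cmp_inj => n /=; rewrite rmorphB. Qed.
Lemma to_completion_monoid : monoid_morphism to_completion.
Proof.
by split=> [|x y]; apply: cmp_inj => n /=; rewrite ?rmorph1 ?rmorphM.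
Qed.
HB.instance Definition _ := GRing.isZmodMorphism.Build A completion
  to_completion to_completion_zmod.
HB.instance Definition _ := GRing.isMonoidMorphism.Build A completion
  to_completion to_completion_monoid.

(* complete includes separated *)
Definition adic_complete : Prop := bijective to_completion.

End Completion.

Definition fps (A : Type) : Type := nat -> A.

Section Fps.
Variable A : comPzRingType.
Implicit Types f g h : fps A.

HB.instance Definition _ := gen_eqMixin (fps A).
HB.instance Definition _ := gen_choiceMixin (fps A).

Definition fps0 : fps A := fun=> 0.
Definition fps1 : fps A := fun n => (n == 0%N)%:R.
Definition fps_opp f : fps A := fun n => - f n.
Definition fps_add f g : fps A := fun n => f n + g n.
Definition fps_mul f g : fps A := fun n => \sum_(i < n.+1) f i * g (n - i)%N.

Lemma fps_addA : associative fps_add.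
Proof. by move=> f g h; apply: funext => n; apply: addrA. Qed.
Lemma fps_addC : commutative fps_add.
Proof. by move=> f g; apply: funext => n; apply: addrC. Qed.
Lemma fps_add0 : left_id fps0 fps_add.
Proof. by move=> f; apply: funext => n; apply: add0r. Qed.
Lemma fps_addN : left_inverse fps0 fps_opp fps_add.
Proof. by move=> f; apply: funext => n; apply: addNr. Qed.
HB.instance Definition _ :=
  GRing.isZmodule.Build (fps A) fps_addA fps_addC fps_add0 fps_addN.

Lemma fps_mul_rev f g n : fps_mul f g n = \sum_(i < n.+1) f (n - i)%N * g i.
Proof.
rewrite /fps_mul (reindex_inj rev_ord_inj) /=.
by apply: eq_bigr => i _; rewrite (sub_ordK i).
Qed.

Lemma fps_mulA : associative fps_mul.
Proof.
move=> f g h; apply: funext => i; rewrite [RHS]fps_mul_rev.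
rewrite -[LHS]/(\sum_(j < i.+1) f j * fps_mul g h (i - j)%N).
pose coef3 j k := f j * (g (i - j - k)%N * h k).
transitivity (\sum_(j < i.+1) \sum_(k < i.+1 | (k <= i - j)%N) coef3 j k).
  apply: eq_bigr => /= j _.
  rewrite fps_mul_rev big_distrr /=.
  by rewrite (big_ord_narrow_leq (leq_subr _ _)).
rewrite (exchange_big_dep predT) //=; apply: eq_bigr => k _.
transitivity (\sum_(j < i.+1 | (j <= i - k)%N) coef3 j k).
  apply: eq_bigl => j; rewrite -ltnS -(ltnS j) -!subSn ?leq_ord //.
  by rewrite -subn_gt0 -(subn_gt0 j) -!subnDA addnC.
rewrite (big_ord_narrow_leq (leq_subr _ _)) big_distrl /=.
by apply: eq_bigr => j _; rewrite /coef3 -!subnDA addnC mulrA.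
Qed.
Lemma fps_mulC : commutative fps_mul.
Proof.
move=> f g; apply: funext => n; rewrite fps_mul_rev.
by apply: eq_bigr => i _; rewrite mulrC.
Qed.
Lemma fps_mul1 : left_id fps1 fps_mul.
Proof.
move=> f; apply: funext => n; rewrite /fps_mul big_ord_recl /= mul1r subn0.
by rewrite big1 ?addr0 // => i _; rewrite /fps1 /= mul0r.
Qed.
Lemma fps_mulD : left_distributive fps_mul fps_add.
Proof.
move=> f g h; apply: funext => n; rewrite /fps_mul /fps_add -big_split /=.
by apply: eq_bigr => i _; rewrite mulrDl.
Qed.
HB.instance Definition _ := GRing.Zmodule_isComPzRing.Build (fps A)
  fps_mulA fps_mulC fps_mul1 fps_mulD.

Definition fpsX : fps A := fun n => (n == 1%N)%:R.
Definition fpsC (a : A) : fps A := fun n => if n == 0%N then a else 0.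

Lemma fpsC_zmod : zmod_morphism fpsC.
Proof.
move=> a b; apply: funext => -[|n] //.
by rewrite -[RHS]/(0 - 0) subr0.
Qed.
Lemma fpsC_monoid : monoid_morphism fpsC.
Proof.
split=> [|a b]; apply: funext => -[|n] //.
  by rewrite -[RHS]/(\sum_(i < 1) _) big_ord1.
rewrite -[RHS]/(\sum_(i < n.+2) _) big_ord_recl /= [fpsC b _]/= mulr0 add0r.
by rewrite big1 // => i _; rewrite [fpsC a _]/= mul0r.
Qed.
HB.instance Definition _ :=
  GRing.isZmodMorphism.Build A (fps A) fpsC fpsC_zmod.
HB.instance Definition _ :=
  GRing.isMonoidMorphism.Build A (fps A) fpsC fpsC_monoid.

End Fps.
Arguments fpsX A : clear implicits.

Section FpsMap.
Variables (A B : comPzRingType) (phi : {rmorphism A -> B}).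

Definition fps_map (f : fps A) : fps B := fun n => phi (f n).

Lemma fps_map_zmod : zmod_morphism fps_map.
Proof. by move=> f g; apply: funext => n; apply: rmorphB. Qed.
Lemma fps_map_monoid : monoid_morphism fps_map.
Proof.
split=> [|f g]; apply: funext => n.
  by rewrite -[LHS]/(phi (n == 0%N)%:R) rmorph_nat.
rewrite -[LHS]/(phi (\sum_(i < n.+1) f i * g (n - i)%N)) rmorph_sum.
by apply: eq_bigr => i _; rewrite rmorphM.
Qed.
HB.instance Definition _ :=
  GRing.isZmodMorphism.Build (fps A) (fps B) fps_map fps_map_zmod.
HB.instance Definition _ :=
  GRing.isMonoidMorphism.Build (fps A) (fps B) fps_map fps_map_monoid.

End FpsMap.

(* V[[x_1, ..., x_n]], built as V[[x_1]]...[[x_n]] *)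
Fixpoint mps (V : comPzRingType) (n : nat) : comPzRingType :=
  if n is n'.+1 then fps (mps V n') else V.

Fixpoint mpsC (V : comPzRingType) (n : nat) : {rmorphism V -> mps V n} :=
  match n return {rmorphism V -> mps V n} with
  | 0 => idfun
  | n'.+1 => @fpsC (mps V n') \o mpsC V n'
  end.

Fixpoint mpsX (V : comPzRingType) (n : nat) : 'I_n -> mps V n :=
  match n return 'I_n -> mps V n with
  | 0 => fun=> 0
  | n'.+1 => fun i => if unlift ord_max i is Some j
                      then @fpsC (mps V n') (mpsX V j) else fpsX (mps V n')
  end.

Section Localization.
Variables (A : comPzRingType) (s : A).

(* (a, n) stands for a / s^n *)
Definition loc_eq (u v : A * nat) : Prop :=
  exists k, s ^+ k * (s ^+ v.2 * u.1) = s ^+ k * (s ^+ u.2 * v.1).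

Program Definition loc_pres := @Presring (A * nat)%type loc_eq
  (0, 0%N) (fun u => (- u.1, u.2))
  (fun u v => (s ^+ v.2 * u.1 + s ^+ u.2 * v.1, (u.2 + v.2)%N))
  (1, 0%N) (fun u v => (u.1 * v.1, (u.2 + v.2)%N)) _ _ _ _ _ _ _ _ _ _ _ _ _ _.
Next Obligation. by move=> u; exists 0%N. Qed.
Next Obligation. by move=> u v [k e]; exists k. Qed.
Next Obligation.
move=> [a i] [b j] [c l] [k /= e1] [k' /= e2]; exists (k + k' + j)%N => /=.
rewrite !exprD.
transitivity (s ^+ k' * s ^+ l * (s ^+ k * (s ^+ j * a))); first by ring.
rewrite e1; transitivity (s ^+ k * s ^+ i * (s ^+ k' * (s ^+ l * b))); first by ring.
by rewrite e2; ring.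
Qed.
Next Obligation. by move=> [a i] [b j] [k /= e]; exists k => /=; rewrite !mulrN e. Qed.
Next Obligation.
move=> [a i] [b j] [c l] [k /= e]; exists k => /=; rewrite !exprD.
transitivity (s ^+ l * s ^+ l * (s ^+ k * (s ^+ j * a)) +
  s ^+ k * s ^+ j * s ^+ l * s ^+ i * c); first by ring.
by rewrite e; ring.
Qed.
Next Obligation.
move=> [a i] [b j] [c l] [k /= e]; exists k => /=; rewrite !exprD.
transitivity (s ^+ l * c * (s ^+ k * (s ^+ j * a))); first by ring.
by rewrite e; ring.
Qed.
Next Obligation. by move=> [a i] [b j] [c l]; exists 0%N => /=; rewrite !exprD; ring. Qed.
Next Obligation. by move=> [a i] [b j]; exists 0%N => /=; rewrite !exprD; ring. Qed.
Next Obligation. by move=> [a i]; exists 0%N => /=; rewrite !exprD !expr0; ring. Qed.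
Next Obligation. by move=> [a i]; exists 0%N => /=; rewrite !exprD !expr0; ring. Qed.
Next Obligation. by move=> [a i] [b j] [c l]; exists 0%N => /=; rewrite !exprD; ring. Qed.
Next Obligation. by move=> [a i] [b j]; exists 0%N => /=; rewrite !exprD; ring. Qed.
Next Obligation. by move=> [a i]; exists 0%N => /=; rewrite !exprD !expr0; ring. Qed.
Next Obligation. by move=> [a i] [b j] [c l]; exists 0%N => /=; rewrite !exprD; ring. Qed.

Definition localization : comPzRingType := qring loc_pres.
Definition loc_map (a : A) : localization := @qcls loc_pres (a, 0%N).

Lemma loc_map_zmod : zmod_morphism loc_map.
Proof.
move=> x y; pose u z : loc_pres := (z, 0%N).
transitivity (qcls (padd (u x) (popp (u y)))); last first.
  by apply: (etrans (qclsD _ _)); congr (_ + _); apply: (@qclsN loc_pres).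
by apply/qclsP; exists 0%N => /=; rewrite !expr0; ring.
Qed.
Lemma loc_map_monoid : monoid_morphism loc_map.
Proof. by split=> [//|x y]; apply: (@qclsM loc_pres (x, 0%N) (y, 0%N)). Qed.
HB.instance Definition _ :=
  GRing.isZmodMorphism.Build A localization loc_map loc_map_zmod.
HB.instance Definition _ :=
  GRing.isMonoidMorphism.Build A localization loc_map loc_map_monoid.

End Localization.

Definition laurent (V : comPzRingType) : comPzRingType := localization (fpsX V).

Section Tensor.
Variables (A B C : comPzRingType).
Variables (f : {rmorphism A -> B}) (g : {rmorphism A -> C}).

(* A finite sequence of pairs (b, c) stands for the sum of the b (x) c; the
   relation is the least additive congruence imposing the tensor relations. *)
Inductive tensor_eq : seq (B * C) -> seq (B * C) -> Prop :=
| tensor_perm s s' : perm_eq s s' -> tensor_eq s s'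
| tensor_sym s s' : tensor_eq s s' -> tensor_eq s' s
| tensor_trans s1 s2 s3 : tensor_eq s1 s2 -> tensor_eq s2 s3 -> tensor_eq s1 s3
| tensor_cat s s' u : tensor_eq s s' -> tensor_eq (s ++ u) (s' ++ u)
| tensor_0l c : tensor_eq [:: (0, c)] [::]
| tensor_Dl b b' c : tensor_eq [:: (b + b', c)] [:: (b, c); (b', c)]
| tensor_Dr b c c' : tensor_eq [:: (b, c + c')] [:: (b, c); (b, c')]
| tensor_bal a b c : tensor_eq [:: (f a * b, c)] [:: (b, g a * c)].

Definition tensor_mul (s u : seq (B * C)) : seq (B * C) :=
  [seq (p.1 * q.1, p.2 * q.2) | p <- s, q <- u].
Definition tensor_opp (s : seq (B * C)) : seq (B * C) :=
  [seq (- p.1, p.2) | p <- s].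

Lemma tensor_eq_refl s : tensor_eq s s.
Proof. exact: tensor_perm. Qed.

Lemma tensor_cat2 s s' u u' :
  tensor_eq s s' -> tensor_eq u u' -> tensor_eq (s ++ u) (s' ++ u').
Proof.
move=> ss uu; apply: (tensor_trans (tensor_cat u ss)).
apply: (@tensor_trans _ (u ++ s')); first by apply/tensor_perm; rewrite perm_catC.
apply: (tensor_trans (tensor_cat s' uu)).
by apply/tensor_perm; rewrite perm_catC.
Qed.

Lemma tensor_mul_consl p s u :
  tensor_mul (p :: s) u = tensor_mul [:: p] u ++ tensor_mul s u.
Proof. by rewrite /tensor_mul -cat1s allpairs_cat. Qed.

Lemma tensor_mul_catl s s' u :
  tensor_mul (s ++ s') u = tensor_mul s u ++ tensor_mul s' u.
Proof. exact: allpairs_cat. Qed.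

Lemma tensor_mul1l p u :
  tensor_mul [:: p] u = [seq (p.1 * q.1, p.2 * q.2) | q <- u].
Proof. exact: cats0. Qed.

Lemma tensor_mulA s u v :
  tensor_mul s (tensor_mul u v) = tensor_mul (tensor_mul s u) v.
Proof.
elim: s => // p s IHs; rewrite tensor_mul_consl IHs (tensor_mul_consl p s u).
rewrite tensor_mul_catl; congr (_ ++ _); rewrite !tensor_mul1l.
elim: u {IHs} => // q u IHu; rewrite tensor_mul_consl map_cat IHu /=.
rewrite [RHS]tensor_mul_consl !tensor_mul1l -map_comp; congr (_ ++ _).
by apply: eq_map => r /=; rewrite !mulrA.
Qed.

Lemma tensor_mulC s u : tensor_eq (tensor_mul s u) (tensor_mul u s).
Proof.
apply: tensor_perm; elim: s => [|p s IHs].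
  by rewrite /tensor_mul allpairs0r.
rewrite perm_sym {1}/tensor_mul perm_allpairs_consr perm_sym tensor_mul_consl.
rewrite perm_cat // /tensor_mul /= cats0; set l1 := map _ _; set l2 := map _ _; suff -> : l1 = l2 by [].
by apply: eq_map => q; rewrite mulrC [X in (_, X)]mulrC.
Qed.

Lemma tensor_mul_cong s s' u :
  tensor_eq s s' -> tensor_eq (tensor_mul s u) (tensor_mul s' u).
Proof.
elim=> {s s'}.
- by move=> s s' ss; apply: tensor_perm; apply: perm_allpairs.
- by move=> s s' _; apply: tensor_sym.
- by move=> s1 s2 s3 _ e _; apply: tensor_trans e.
- move=> s s' v _ e; rewrite /tensor_mul !allpairs_cat; exact: tensor_cat e.
- move=> c; elim: u => [|[b' c'] u IHu]; first exact: tensor_eq_refl.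
  rewrite /tensor_mul /= cats0 in IHu *; rewrite mul0r.
  exact: (@tensor_cat2 [:: _] [::] _ [::] (tensor_0l _) IHu).
- move=> b b' c; elim: u => [|[b1 c1] u IHu]; first exact: tensor_eq_refl.
  rewrite /tensor_mul /= cats0 in IHu *; rewrite mulrDl.
  apply: (tensor_trans (@tensor_cat2 [:: _] _ _ _ (tensor_Dl _ _ _) IHu)).
  by apply: tensor_perm; rewrite !cats0 /= perm_cons perm_sym perm_catC /=
    perm_cons perm_catC.
- move=> b c c'; elim: u => [|[b1 c1] u IHu]; first exact: tensor_eq_refl.
  rewrite /tensor_mul /= cats0 in IHu *; rewrite mulrDl.
  apply: (tensor_trans (@tensor_cat2 [:: _] _ _ _ (tensor_Dr _ _ _) IHu)).
  by apply: tensor_perm; rewrite !cats0 /= perm_cons perm_sym perm_catC /=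
    perm_cons perm_catC.
- move=> a b c; elim: u => [|[b1 c1] u IHu]; first exact: tensor_eq_refl.
  rewrite /tensor_mul /= in IHu *; rewrite -!mulrA.
  exact: (@tensor_cat2 [:: _] [:: _] _ _ (tensor_bal _ _ _) IHu).
Qed.

Lemma tensor_addN s : tensor_eq (tensor_opp s ++ s) [::].
Proof.
elim: s => [|[b c] s IHs]; first exact: tensor_eq_refl.
apply: (@tensor_trans _ ([:: (- b, c); (b, c)] ++ (tensor_opp s ++ s))).
  apply: tensor_perm; rewrite /= perm_cons; apply/permPl.
  exact: (perm_catCA (tensor_opp s) [:: _] s).
apply: (@tensor_cat2 _ [::] _ [::]) => //.
apply: (tensor_trans (tensor_sym (tensor_Dl _ _ _))); rewrite addNr.
exact: tensor_0l.
Qed.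

Program Definition tensor_pres := @Presring (seq (B * C)) tensor_eq
  [::] tensor_opp cat [:: (1, 1)] tensor_mul _ _ _ _ _ _ _ _ _ _ _ _ _ _.
Next Obligation. exact: tensor_eq_refl. Qed.
Next Obligation. exact: tensor_sym. Qed.
Next Obligation. exact: tensor_trans. Qed.
Next Obligation.
move=> s s' ss.
have oppE u : tensor_opp u = tensor_mul u [:: (-1, 1)].
  rewrite /tensor_mul; elim: u => //= -[b c] u ->.
  by rewrite mulrN1 mulr1.
by rewrite !oppE; apply: tensor_mul_cong.
Qed.
Next Obligation. by move=> s s' u; apply: tensor_cat. Qed.
Next Obligation. exact: tensor_mul_cong. Qed.
Next Obligation. by move=> s u v; rewrite catA; apply: tensor_eq_refl. Qed.
Next Obligation. by move=> s u; apply: tensor_perm; rewrite perm_catC. Qed.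
Next Obligation. exact: tensor_eq_refl. Qed.
Next Obligation. exact: tensor_addN. Qed.
Next Obligation.
by move=> s u v; rewrite tensor_mulA; apply: tensor_eq_refl.
Qed.
Next Obligation. exact: tensor_mulC. Qed.
Next Obligation.
move=> s; rewrite /tensor_mul /= cats0.
rewrite (eq_map (_ : _ =1 id)) ?map_id; first exact: tensor_eq_refl.
by move=> [b c] /=; rewrite !mul1r.
Qed.
Next Obligation.
by move=> s u v; rewrite /tensor_mul allpairs_cat; apply: tensor_eq_refl.
Qed.

Definition tensor : comPzRingType := qring tensor_pres.

Definition tensor_inl (b : B) : tensor := @qcls tensor_pres [:: (b, 1)].
Definition tensor_inr (c : C) : tensor := @qcls tensor_pres [:: (1, c)].

Lemma tensor_inl_zmod : zmod_morphism tensor_inl.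
Proof.
move=> x y; transitivity (@qcls tensor_pres [:: (x, 1); (- y, 1)]).
  exact/qclsP/tensor_Dl.
apply: (etrans (@qclsD tensor_pres [:: (x, 1)] [:: (- y, 1)])).
congr (_ + _); exact: (@qclsN tensor_pres [:: (y, 1)]).
Qed.
Lemma tensor_inl_monoid : monoid_morphism tensor_inl.
Proof.
split=> // x y; rewrite -[RHS](@qclsM tensor_pres [:: (x, 1)] [:: (y, 1)]).
by rewrite /= /tensor_mul /= mulr1.
Qed.
HB.instance Definition _ :=
  GRing.isZmodMorphism.Build B tensor tensor_inl tensor_inl_zmod.
HB.instance Definition _ :=
  GRing.isMonoidMorphism.Build B tensor tensor_inl tensor_inl_monoid.

End Tensor.

Section Gr.
Variables (A : comPzRingType) (I : ideal A).

(* An element of the direct sum of the I^i / I^(i+1): its component in degree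
   i is an element of A / I^(i+1) having a representative in I^i. *)
Record gr : Type := Gr {
  grc :> forall i, quot (ideal_pow I i.+1);
  gr_deg : forall i, exists2 a, ideal_pow I i a & grc i = quot_proj _ a;
  gr_fin : exists N, forall i, (N <= i)%N -> grc i = 0 }.

HB.instance Definition _ := gen_eqMixin gr.
HB.instance Definition _ := gen_choiceMixin gr.

Lemma gr_inj (x y : gr) : (forall i, x i = y i) -> x = y.
Proof.
case: x y => x Px Qx [y Py Qy] /= xy.
have {}xy : x = y by apply: functional_extensionality_dep.
by case: _ / xy Py Qy => Py Qy; congr Gr; apply: Prop_irrelevance.
Qed.

Definition gr_rep (x : gr) : fps A := fun i => repr (x i).

Lemma gr_repK x i : quot_proj _ (gr_rep x i) = x i.
Proof. by rewrite /quot_proj /gr_rep qcls_repr. Qed.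

Lemma gr_repP x i : ideal_pow I i (gr_rep x i).
Proof.
have [a Ia] := gr_deg x i; rewrite -gr_repK quot_projP => /ideal_powS.
by move=> /idealD/(_ Ia); rewrite subrK.
Qed.

Definition fps_homog (F : fps A) := forall i, ideal_pow I i (F i).
Definition fps_eqgr (F F' : fps A) := forall i, ideal_pow I i.+1 (F i - F' i).

Lemma ideal_sum (J : ideal A) n (F : 'I_n -> A) :
  (forall i, J (F i)) -> J (\sum_(i < n) F i).
Proof.
by move=> JF; elim/big_ind: _ => //; [apply: ideal0|move=> ? ?; apply: idealD].
Qed.

Lemma pow_mul_sub i j a b x y : (j <= i)%N -> ideal_pow I (a + j) x ->
  ideal_pow I (b + (i - j)) y -> ideal_pow I (a + b + i) (x * y).
Proof.
by move=> le Ix Iy; rewrite -[in X in ideal_pow I X](subnKC le) addnACA; apply: ideal_powM.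
Qed.

Lemma fps_mul_homog F H : fps_homog F -> fps_homog H -> fps_homog (F * H).
Proof.
move=> hF hH i; apply: ideal_sum => j.
exact: (@pow_mul_sub i j 0 0 _ _ (leq_ord j)).
Qed.

Lemma fps_mul_eqgr F F' H :
  fps_eqgr F F' -> fps_homog H -> fps_eqgr (F * H) (F' * H).
Proof.
move=> e hH i; rewrite -[_ - _]/((F * H - F' * H : fps A) i) -mulrBl.
apply: ideal_sum => j.
exact: (@pow_mul_sub i j 1 0 _ _ (leq_ord j)).
Qed.

Program Definition gr0 := @Gr (fun=> 0) _ _.
Next Obligation. by move=> i; exists 0; rewrite ?rmorph0 //; apply: ideal0. Qed.
Next Obligation. by exists 0%N. Qed.
Program Definition gr1 := @Gr (fun i => (i == 0%N)%:R) _ _.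
Next Obligation.
move=> i; exists (i == 0%N)%:R; last by rewrite rmorph_nat.
by case: i => [//|i]; apply: ideal0.
Qed.
Next Obligation. by exists 1%N => -[]. Qed.
Program Definition gr_opp (x : gr) := @Gr (fun i => - x i) _ _.
Next Obligation.
move=> x i; have [a Ia ->] := gr_deg x i.
by exists (- a); rewrite ?rmorphN //; apply: idealN.
Qed.
Next Obligation.
by move=> x; have [N xN] := gr_fin x; exists N => i /xN ->; rewrite oppr0.
Qed.
Program Definition gr_add (x y : gr) := @Gr (fun i => x i + y i) _ _.
Next Obligation.
move=> x y i; have [a Ia ->] := gr_deg x i; have [b Ib ->] := gr_deg y i.
by exists (a + b); rewrite ?rmorphD //; apply: idealD.
Qed.
Next Obligation.
move=> x y; have [N xN] := gr_fin x; have [M yM] := gr_fin y.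
exists (maxn N M) => i; rewrite geq_max => /andP[/xN -> /yM ->].
by rewrite addr0.
Qed.
(* [a] in I^i / I^(i+1) times [b] in I^j / I^(j+1) is [a b] in
   I^(i+j) / I^(i+j+1). *)
Program Definition gr_mul (x y : gr) := @Gr (fun i => quot_proj _
  (\sum_(j < i.+1) repr (x j) * repr (y (i - j)%N))) _ _.
Next Obligation.
move=> x y i; exists ((gr_rep x * gr_rep y) i) => //.
by apply: fps_mul_homog; apply: gr_repP.
Qed.
Next Obligation.
move=> x y; have [N xN] := gr_fin x; have [M yM] := gr_fin y.
exists (N + M)%N => i leNM; apply/quot_proj0P; apply: ideal_sum => j.
have lej := leq_ord j; case: (leqP N j) => [leNj|ltjN].
  have Ix : ideal_pow I j.+1 (gr_rep x j) by apply/quot_proj0P; rewrite gr_repK xN.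
  exact: (@pow_mul_sub i j 1 0 _ _ lej Ix (gr_repP _ _)).
have leM : (M <= i - j)%N.
  by rewrite leq_subRL //; apply: leq_trans leNM; rewrite leq_add2r ltnW.
have Iy : ideal_pow I (i - j).+1 (gr_rep y (i - j)%N).
  by apply/quot_proj0P; rewrite gr_repK yM.
exact: (@pow_mul_sub i j 0 1 _ _ lej (gr_repP _ _) Iy).
Qed.

Lemma gr_addA : associative gr_add.
Proof. by move=> x y z; apply: gr_inj => i /=; rewrite addrA. Qed.
Lemma gr_addC : commutative gr_add.
Proof. by move=> x y; apply: gr_inj => i /=; rewrite addrC. Qed.
Lemma gr_add0 : left_id gr0 gr_add.
Proof. by move=> x; apply: gr_inj => i /=; rewrite add0r. Qed.
Lemma gr_addN : left_inverse gr0 gr_opp gr_add.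
Proof. by move=> x; apply: gr_inj => i /=; rewrite addNr. Qed.
HB.instance Definition _ :=
  GRing.isZmodule.Build gr gr_addA gr_addC gr_add0 gr_addN.

Lemma gr_mulE x y i : gr_mul x y i = quot_proj _ ((gr_rep x * gr_rep y) i).
Proof. by []. Qed.

Lemma gr_rep_mul x y : fps_eqgr (gr_rep (gr_mul x y)) (gr_rep x * gr_rep y).
Proof. by move=> i; apply/quot_projP; rewrite gr_repK. Qed.

Lemma gr_mulC : commutative gr_mul.
Proof. by move=> x y; apply: gr_inj => i; rewrite !gr_mulE mulrC. Qed.
Lemma gr_mulA : associative gr_mul.
Proof.
move=> x y z; apply: gr_inj => i; rewrite !gr_mulE.
transitivity (quot_proj (ideal_pow I i.+1)
                (((gr_rep x * gr_rep y) * gr_rep z) i)).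
  rewrite -mulrA ![gr_rep x * _]mulrC; apply/quot_projP.
  by apply: fps_mul_eqgr; [apply: gr_rep_mul|apply: gr_repP].
apply/esym/quot_projP; apply: fps_mul_eqgr; first exact: gr_rep_mul.
exact: gr_repP.
Qed.
Lemma gr_mul1 : left_id gr1 gr_mul.
Proof.
move=> x; apply: gr_inj => i; rewrite gr_mulE -[RHS]gr_repK.
apply/quot_projP; rewrite -[X in _ - X i]mul1r.
apply: fps_mul_eqgr; last exact: gr_repP.
by move=> j; apply/quot_projP; rewrite gr_repK /= rmorph_nat.
Qed.
Lemma gr_mulD : left_distributive gr_mul gr_add.
Proof.
move=> x y z; apply: gr_inj => i; rewrite [RHS]/= -!gr_mulE !gr_mulE -rmorphD.
rewrite -[_ + _]/((gr_rep x * gr_rep z + gr_rep y * gr_rep z : fps A) i).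
rewrite -mulrDl; apply/quot_projP; apply: fps_mul_eqgr; last exact: gr_repP.
move=> j; apply/quot_projP.
transitivity (quot_proj (ideal_pow I j.+1) (gr_rep x j) +
              quot_proj (ideal_pow I j.+1) (gr_rep y j)).
  by rewrite [LHS]gr_repK ![in RHS]gr_repK.
by rewrite -rmorphD.
Qed.
HB.instance Definition _ :=
  GRing.Zmodule_isComPzRing.Build gr gr_mulA gr_mulC gr_mul1 gr_mulD.

Program Definition gr_plus : ideal gr := @Ideal gr (fun x => x 0%N = 0) _ _ _.
Next Obligation. by []. Qed.
Next Obligation. by move=> x y x0 y0 /=; rewrite x0 y0 addr0. Qed.
Next Obligation.
move=> x y; rewrite -gr_repK quot_proj0P => Iy.
rewrite -[x * y]/(gr_mul x y) gr_mulE quot_proj0P.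
have -> : (gr_rep x * gr_rep y : fps A) 0%N = gr_rep x 0%N * gr_rep y 0%N.
  exact: big_ord1.
exact: idealMl.
Qed.

End Gr.

Definition is_maximal (A : comPzRingType) (m : ideal A) : Prop :=
  ~ m 1 /\
  forall J : ideal A, (forall x, m x -> J x) -> ~ J 1 -> forall x, J x -> m x.

Definition is_local (A : comPzRingType) (m : ideal A) : Prop :=
  is_maximal m /\
  forall m' : ideal A, is_maximal m' -> forall x, m' x <-> m x.

Definition is_noetherian (A : comPzRingType) : Prop := forall J : ideal A,
  exists s : seq A, forall x, J x <-> ideal_gen [set` s]%classic x.

Definition complete_local_ring (A : comPzRingType) (m : ideal A) : Prop :=
  [/\ is_noetherian A, is_local m & adic_complete m].

(* [c] is the non-negative generator of the kernel of Z -> A. *)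
Definition has_char (A : comPzRingType) (c : nat) : Prop :=
  forall n, n%:R = 0 :> A <-> (c %| n)%N.

Record is_subfield (A : comPzRingType) (K : set A) : Prop := IsSubfield {
  subfield1 : K 1;
  subfieldB : forall x y, K x -> K y -> K (x - y);
  subfieldM : forall x y, K x -> K y -> K (x * y);
  subfield_neq0 : 1 != 0 :> A;
  subfieldV : forall x, K x -> x != 0 -> exists2 y, K y & x * y = 1 }.

Definition equal_characteristic (A : comPzRingType) : Prop :=
  exists K : set A, is_subfield K.

Definition mixed_characteristic (A : comPzRingType) : Prop :=
  ~ equal_characteristic A.

Definition is_coefficient_field (A : comPzRingType) (m : ideal A) (K : set A) :
  Prop :=
  [/\ is_subfield K,
      forall x y, K x -> K y -> quot_proj m x = quot_proj m y -> x = y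
    & forall r : quot m, exists2 x, K x & quot_proj m x = r].

Record is_dvr (V : comPzRingType) (mV : ideal V) : Prop := IsDvr {
  dvr_neq0 : 1 != 0 :> V;
  dvr_domain : forall x y : V, x * y = 0 -> x = 0 \/ y = 0;
  dvr_principal : forall J : ideal V, exists a,
    forall x, J x <-> ideal_gen [set a]%classic x;
  dvr_local : is_local mV;
  dvr_nonfield : exists2 x, mV x & x != 0 }.

Record is_complete_unramified_dvr (V : comPzRingType) (mV : ideal V) (p : nat) :
  Prop := IsCompleteUnramifiedDvr {
  cudvr_dvr : is_dvr mV;
  cudvr_complete : adic_complete mV;
  cudvr_prime : prime p;
  cudvr_char : has_char V 0;
  cudvr_max : forall x, mV x <-> ideal_gen [set p%:R]%classic x }.

(* [hom_ring] is the candidate for hom(R); it depends only on V and J, and R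
   enters through the two isomorphisms of [is_homogenization]. *)
Section Homogenization.
Variables (R : comPzRingType) (m : ideal R).
Variables (V : comPzRingType) (iota : {rmorphism V -> R}).
Variables (n : nat) (J : ideal (fps (mps V n))).

Definition hom_ring : comPzRingType := quot J.

Definition hom_t : hom_ring := quot_proj J (fpsX (mps V n)).

Definition hom_alg : {rmorphism fps V -> hom_ring} :=
  quot_proj J \o fps_map (mpsC V n).

Definition hom_mps : {rmorphism mps V n -> hom_ring} :=
  quot_proj J \o @fpsC (mps V n).

Definition hom_laurent : comPzRingType :=
  tensor hom_alg (@loc_map (fps V) (fpsX V) : {rmorphism fps V -> laurent V}).

Definition hom_mps_laurent : {rmorphism mps V n -> hom_laurent} :=
  @tensor_inl _ _ _ hom_alg
    (@loc_map (fps V) (fpsX V) : {rmorphism fps V -> laurent V}) \o hom_mps.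

Definition laurentC : {rmorphism V -> laurent V} :=
  @loc_map (fps V) (fpsX V) \o @fpsC V.

Definition base_laurent : comPzRingType := tensor iota laurentC.

Definition base_to_laurent : R -> base_laurent := @tensor_inl _ _ _ iota laurentC.

(* [Q] is the ideal of V[[x_1, ..., x_n]] whose extension is used on the left
   of the last isomorphism. *)
Record is_homogenization (Q : ideal (mps V n)) : Prop := IsHomogenization {
  homog_complete_local : exists mH : ideal hom_ring, complete_local_ring mH;
  homog_nzd : forall h : hom_ring, hom_t * h = 0 -> h = 0;
  homog_special : ring_iso (quot (ideal_gen [set hom_t]%classic))
                           (completion (gr_plus m));
  homog_generic : ring_iso (completion (ideal_ext hom_mps_laurent Q))
                           (completion (ideal_ext base_to_laurent m)) }.

End Homogenization.

Definition ideal_x (V : comPzRingType) (n : nat) : ideal (mps V n) :=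
  ideal_gen (range (@mpsX V n)).

Definition ideal_px (V : comPzRingType) (n p : nat) : ideal (mps V n) :=
  ideal_gen ([set p%:R] `|` range (@mpsX V n))%classic.

(* Main.v *)
Require Import Defs.
From HB Require Import structures.
From mathcomp Require Import all_boot all_algebra generic_quotient.
From mathcomp Require Import boolp classical_sets.
From mathcomp Require Import ring.
Set Implicit Arguments.
Unset Strict Implicit.
Unset Printing Implicit Defensive.
Import GRing.Theory.
Local Open Scope ring_scope.

(** The ring hom(R) is the completed extended Rees algebra of R. Choose
    generators r_1, ..., r_n of m; hom(R) is the image of V[[x_1, ..., x_n]][[t]]
    under x_i |-> r_i / t, t |-> t. To give a meaning to this evaluation, observe
    that r_i / t is nilpotent in (R/m^N)((t)) for each N, so that a ring
    homomorphism phi_N : V[[x]][[t]] -> (R/m^N)((t)) exists; J is the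
    intersection of the kernels of all the phi_N, and hom(R) is the quotient
    by J. As t is invertible in the targets, t is not a zero divisor modulo J.

    The quotient is Noetherian by the Hilbert basis theorem for power series
    ([fps_noetherian]). It is local and complete because V[[x]][[t]] is complete
    for the ideal of the series whose constant term lies in the maximal ideal of
    V, and because J is closed ([homJ_closed]); the latter rests on the bound
    on the poles of the values of phi_N ([phi_pole]).

    The bridge from R to hom(R) is [homJ_lift]. An element y of m^N is a sum of
    values h_d(r), d >= N, of forms h_d of degree d over V, and the series
    h_N(x) t^N + h_(N+1)(x) t^(N+1) + ... is mapped to y by every phi_M. This
    gives a ring homomorphism R -> hom(R) mapping m^N into t^N (x)^N, and r_i to
    t x_i.

    Special fibre ([special_fibre]): let psi_N map V[[x]][[t]] to gr(R) modulo
    the N-th power of gr(R)_+ by t |-> 0 and x_i |-> the class of r_i in degree 1.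
    The common kernel is J + (t). It contains J because the coefficient of t^-d
    in phi_(d+1)(F) depends only on the part of F of degree d in x and 0 in t.
    Conversely, if psi kills a form h of degree d, then h(r) lies in m^(d+1), and
    [homJ_lift] exhibits h as an element of J + t (x)^d; a limit of such
    corrections gives the claim for all series.

    Generic fibre ([generic_fibre]): R -> hom(R) induces a map from
    R (x) V((t)) to hom(R) (x) V((t)) whose image is dense, since x_i is
    t^-1 times the image of r_i. It remains to see that it is strict for the two
    filtrations, and this holds because an element of R (x) V((t)) that vanishes
    in (R/m^N)((t)) belongs to the N-th power of the extension of m
    ([chiB_ker]). Indeed R/m^N is a finitely generated V-module, its module of
    relations is finitely generated because V is Noetherian, and therefore a
    relation with coefficients in V[[t]] is a combination, over V[[t]], of
    finitely many relations over V.

    The two characteristics are treated together: all that matters is the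
    preimage of m in V, which is 0 in equal characteristic and (p) in mixed
    characteristic. *)

(** * Choice and ideals *)

Lemma inj_surj_bij (T U : Type) (f : T -> U) :
  injective f -> (forall y, exists x, f x = y) -> bijective f.
Proof.
move=> fI /choice[g fg]; exists g => // x.
by apply: fI; rewrite fg.
Qed.

Lemma dependent_choice (T : Type) (P : nat -> T -> Prop)
    (E : nat -> T -> T -> Prop) x0 :
  P 0%N x0 -> (forall n x, P n x -> exists2 y, P n.+1 y & E n x y) ->
  exists s : nat -> T,
    [/\ s 0%N = x0, forall n, P n (s n) & forall n, E n (s n) (s n.+1)].
Proof.
move=> P0 PS.
have /choice[next nextP] (u : nat * T) :
    exists y, P u.1 u.2 -> P u.1.+1 y /\ E u.1 u.2 y.
  have [/PS[y Py Ey]|nP] := pselect (P u.1 u.2); first by exists y.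
  by exists u.2.
pose s := fix s n := if n is k.+1 then next (k, s k) else x0.
have sP n : P n (s n) by elim: n => // n IHn; have [] := nextP (n, s n) IHn.
by exists s; split=> // n; have [] := nextP (n, s n) (sP n).
Qed.

(** Packs a map with proofs of its morphism axioms, for maps that are only built
    inside a proof or from section hypotheses. *)
Definition rmorph_of (A B : comPzRingType) (f : A -> B)
    (fB : zmod_morphism f) (fM : monoid_morphism f) : {rmorphism A -> B} :=
  HB.pack f (GRing.isZmodMorphism.Build A B f fB)
            (GRing.isMonoidMorphism.Build A B f fM).

Arguments ideal_mem : simpl never.
Arguments ideal_pow : simpl never.

Section IdealTheory.
Variable A : comPzRingType.
Implicit Types (I J K : ideal A) (X : set A).

Lemma eq_ideal I J : (forall x, I x <-> J x) -> I = J.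
Proof.
case: I J => [I I0 ID IM] [J J0 JD JM] /= IJ.
have {IJ} eIJ : I = J by apply: funext => x; apply: propext.
by subst J; congr Ideal; apply: Prop_irrelevance.
Qed.

Lemma mem_ideal_gen X x : X x -> ideal_gen X x.
Proof.
by move=> Xx; exists [:: (1, x)]; rewrite big_seq1 mul1r; split=> // u; rewrite inE => /eqP->.
Qed.

Lemma ideal_gen_min X I : (forall x, X x -> I x) -> forall x, ideal_gen X x -> I x.
Proof.
move=> XI _ [s [sX ->]]; elim: s sX => [|u s IHs] sX.
  by rewrite big_nil; apply: ideal0.
rewrite big_cons; apply: idealD; first by apply/idealMl/XI/sX/mem_head.
by apply: IHs => v vs; apply: sX; rewrite inE vs orbT.
Qed.

Lemma ideal_big (T : Type) I (s : seq T) (P : pred T) (F : T -> A) :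
  (forall i, P i -> I (F i)) -> I (\sum_(i <- s | P i) F i).
Proof.
by move=> IF; elim/big_ind: _ => //; [apply: ideal0|move=> x y; apply: idealD].
Qed.

Lemma ideal_mulr I a x : I x -> I (x * a).
Proof. by rewrite mulrC; apply: idealMl. Qed.

Lemma ideal_subl I x y : I (x - y) -> I y -> I x.
Proof. by move=> Ixy Iy; rewrite -(subrK y x); apply: idealD. Qed.

Lemma ideal_subC I x y : I (x - y) -> I (y - x).
Proof. by move=> /idealN; rewrite opprB. Qed.

Lemma ideal_sub_trans I y x z : I (x - y) -> I (y - z) -> I (x - z).
Proof. by move=> Ixy Iyz; rewrite -(subrK y x) -addrA; apply: idealD. Qed.

(** Elimination of a power of I: it is additively generated by products of an
    element of I and an element of the previous power, the ring coefficients
    being absorbed in the first factor. *)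
Lemma ideal_pow_ind I n (P : A -> Prop) :
  P 0 -> (forall x y, P x -> P y -> P (x + y)) ->
  (forall x y, I x -> ideal_pow I n y -> P (x * y)) ->
  forall x, ideal_pow I n.+1 x -> P x.
Proof.
move=> P0 PD PM _ [s [sI ->]]; elim: s sI => [|u s IHs] sI.
  by rewrite big_nil.
rewrite big_cons; apply: PD; last first.
  by apply: IHs => v vs; apply: sI; rewrite inE vs orbT.
have [x [y [Ix Iy ->]]] := sI u (mem_head _ _); rewrite mulrA.
by apply: PM => //; apply: idealMl.
Qed.

Lemma ideal_powSM I n x y : I x -> ideal_pow I n y -> ideal_pow I n.+1 (x * y).
Proof. by move=> Ix Iy; apply: mem_ideal_gen; exists x, y. Qed.

Lemma ideal_pow1 I x : ideal_pow I 1 x <-> I x.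
Proof.
split=> [|Ix]; last by rewrite -(mulr1 x); apply: ideal_powSM.
apply: ideal_pow_ind => [|y z|y z Iy _]; [exact: ideal0|exact: idealD|exact: ideal_mulr].
Qed.

Lemma ideal_pow_sub I n x : (0 < n)%N -> ideal_pow I n x -> I x.
Proof. by move=> n_gt0 /(ideal_pow_leq n_gt0)/ideal_pow1. Qed.

Lemma ideal_powX I n x : I x -> ideal_pow I n (x ^+ n).
Proof. by move=> Ix; elim: n => // n IHn; rewrite exprS; apply: ideal_powSM. Qed.

(** The colon ideal (I : x); it turns an inclusion that is bilinear in two
    generating sets into two applications of the minimality of an extension. *)
Definition colon I (x : A) : ideal A.
Proof.
exists (fun w => I (x * w)) => [|u v|u v].
- by rewrite mulr0; apply: ideal0.
- by rewrite mulrDr; apply: idealD.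
- by rewrite mulrCA; apply: idealMl.
Defined.

End IdealTheory.

Section IdealMorphism.
Variables (A B : comPzRingType) (f : {rmorphism A -> B}).
Implicit Types (I J : ideal A) (K : ideal B).

Lemma ideal_pow_morph I K n : (forall x, I x -> K (f x)) ->
  forall x, ideal_pow I n x -> ideal_pow K n (f x).
Proof.
move=> IK; elim: n => // n IHn; apply: ideal_pow_ind => [|x y Kx Ky|x y Ix Iy].
- by rewrite rmorph0; apply: ideal0.
- by rewrite rmorphD; apply: idealD.
- by rewrite rmorphM; apply: ideal_powSM; [apply: IK|apply: IHn].
Qed.

Lemma mem_ideal_ext I x : I x -> ideal_ext f I (f x).
Proof. by move=> Ix; apply: mem_ideal_gen; exists x. Qed.

Lemma ideal_ext_min I K : (forall x, I x -> K (f x)) ->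
  forall y, ideal_ext f I y -> K y.
Proof. by move=> IK; apply: ideal_gen_min => _ [x Ix <-]; apply: IK. Qed.

Lemma ideal_ext_pow I n y : ideal_pow (ideal_ext f I) n y -> ideal_ext f (ideal_pow I n) y.
Proof.
elim: n y => [|n IHn] y.
  by rewrite -(mulr1 y) -(rmorph1 f) => _; apply/idealMl/mem_ideal_ext.
apply: ideal_pow_ind => [|x z|x z Ix /IHn Iz {y}]; first exact: ideal0.
  exact: idealD.
pose K := ideal_ext f (ideal_pow I n.+1).
suff: forall w, ideal_ext f (ideal_pow I n) w -> colon K x w by apply.
apply: ideal_ext_min => b Ib; change (K (x * f b)); rewrite mulrC.
suff: forall w, ideal_ext f I w -> colon K (f b) w by apply.
apply: ideal_ext_min => a Ia; change (K (f b * f a)); rewrite mulrC -rmorphM.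
apply: mem_ideal_ext; exact: ideal_powSM.
Qed.

(** The source of all nilpotency below: if f kills I^n, then products of n
    elements of the extension of I vanish. *)
Lemma ideal_ext_ker_pow I n : (forall x, ideal_pow I n x -> f x = 0) ->
  forall y, ideal_pow (ideal_ext f I) n y -> y = 0.
Proof.
move=> kf y /ideal_ext_pow [s [sI ->]]; apply: big1_seq => u /andP[_ /sI[x Ix <-]].
by rewrite kf // mulr0.
Qed.

Section QuotLift.
Variables (J : ideal A) (fJ : forall x, J x -> f x = 0).

Definition quot_fun (u : quot J) : B := f (repr u).

Lemma quot_funE x : quot_fun (quot_proj J x) = f x.
Proof.
apply/eqP; rewrite -subr_eq0 -rmorphB fJ //.
by apply/quot_projP; rewrite /quot_proj qcls_repr.
Qed.

Lemma quot_fun_zmod : zmod_morphism quot_fun.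
Proof.
move=> u v; have [x ->] := quot_proj_surj u; have [y ->] := quot_proj_surj v.
by rewrite -rmorphB !quot_funE rmorphB.
Qed.

Lemma quot_fun_monoid : monoid_morphism quot_fun.
Proof.
split=> [|u v]; first by rewrite -(rmorph1 (quot_proj J)) quot_funE rmorph1.
have [x ->] := quot_proj_surj u; have [y ->] := quot_proj_surj v.
by rewrite -rmorphM !quot_funE rmorphM.
Qed.

Definition quot_lift : {rmorphism quot J -> B} :=
  rmorph_of quot_fun_zmod quot_fun_monoid.

Lemma quot_liftE x : quot_lift (quot_proj J x) = f x.
Proof. exact: quot_funE. Qed.

End QuotLift.
End IdealMorphism.

Definition preim_ideal (A B : comPzRingType) (f : {rmorphism A -> B}) (K : ideal B) : ideal A.
Proof.
exists (fun x => K (f x)) => [|x y|a x]; first by rewrite rmorph0; apply: ideal0.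
  by rewrite rmorphD; apply: idealD.
by rewrite rmorphM; apply: idealMl.
Defined.

(** The image of I in the quotient by J, described by representatives. *)
Definition im_quot (A : comPzRingType) (J I : ideal A) : ideal (quot J).
Proof.
exists (fun u => exists2 x, I x & u = quot_proj J x) => [|u v|a u].
- by exists 0; rewrite ?rmorph0 //; apply: ideal0.
- by move=> [x Ix ->] [y Iy ->]; exists (x + y); rewrite ?rmorphD //; apply: idealD.
- move=> [x Ix ->]; have [b ->] := quot_proj_surj a.
  by exists (b * x); rewrite ?rmorphM //; apply: idealMl.
Defined.

Lemma im_quot_pow (A : comPzRingType) (J I : ideal A) n u :
  ideal_pow (im_quot J I) n u -> exists2 x, ideal_pow I n x & u = quot_proj J x.
Proof.
elim: n u => [|n IHn] u; first by have [x ->] := quot_proj_surj u; exists x.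
move: u; apply: ideal_pow_ind => [|_ _ [x Ix ->] [y Iy ->]|_ v [x Ix ->] /IHn[y Iy ->]].
- by exists 0; rewrite ?rmorph0 //; apply: ideal0.
- by exists (x + y); rewrite ?rmorphD //; apply: idealD.
- by exists (x * y); rewrite ?rmorphM //; apply: ideal_powSM.
Qed.

(** * Completions *)

(** Completeness without separatedness, phrased with series whose general term
    tends to zero; this form passes to quotients and to power series rings. *)
Definition cauchy_complete (A : comPzRingType) (I : ideal A) : Prop :=
  forall g : nat -> A, (forall d, ideal_pow I d (g d)) ->
  exists f, forall N, ideal_pow I N (f - \sum_(d < N) g d).

Section CompletionTheory.
Variables (A : comPzRingType) (I : ideal A).

Lemma cmp_reducesE (x : completion I) n a :
  x n.+1 = quot_proj _ a -> x n = quot_proj _ a.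
Proof.
have [b [-> ->]] := cmpP x n => /quot_projP /ideal_powS Ib.
exact/quot_projP.
Qed.

Lemma adic_cauchy : adic_complete I -> cauchy_complete I.
Proof.
move=> [inv _ invK] g Ig.
pose x n : quot (ideal_pow I n) := quot_proj _ (\sum_(d < n) g d).
have xP n : reduces (x n) (x n.+1).
  exists (\sum_(d < n.+1) g d); split=> //; apply/quot_projP.
  by rewrite big_ord_recr /= opprD addrA subrr add0r; apply: idealN.
exists (inv (Completion xP)) => N; apply/quot_projP.
by rewrite -[LHS]/(to_completion I (inv (Completion xP)) N) invK.
Qed.

Lemma cauchy_adic : cauchy_complete I ->
  (forall x, (forall n, ideal_pow I n x) -> x = 0) -> adic_complete I.
Proof.
move=> cI sI; apply: inj_surj_bij => [x y xy|u].
  apply/eqP; rewrite -subr_eq0; apply/eqP/sI => n; apply/quot_projP.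
  by rewrite -[LHS]/(to_completion I x n) xy.
have /choice[a aP] n : exists a, u n = quot_proj _ a by apply: quot_proj_surj.
(* the partial sum of the first n+1 terms is a_(n+1) *)
pose g d := if d is 0 then a 1%N else a d.+1 - a d.
have gI d : ideal_pow I d (g d).
  case: d => // d; apply/quot_projP.
  by rewrite -(cmp_reducesE (aP d.+2)) -aP.
have [f fP] := cI g gI; exists f; apply: cmp_inj => -[|n].
  by rewrite aP; apply/quot_projP.
rewrite aP; apply/quot_projP; have := fP n.+1; congr (ideal_pow _ _ (_ - _)).
by elim: n => [|n IHn]; rewrite big_ord_recr /= ?big_ord0 ?add0r // IHn addrC subrK.
Qed.

End CompletionTheory.

Lemma quot_cauchy (A : comPzRingType) (J I : ideal A) :
  cauchy_complete I -> cauchy_complete (im_quot J I).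
Proof.
move=> cI g gI; have /choice[h /all_and2[hI gE]] d :
    exists x, ideal_pow I d x /\ g d = quot_proj J x.
  by have [x Ix ->] := im_quot_pow (gI d); exists x.
have [f fP] := cI h hI; exists (quot_proj J f) => N.
under eq_bigr do rewrite gE.
rewrite -rmorph_sum -rmorphB.
by apply: ideal_pow_morph (fP N) => x Ix; exists x.
Qed.

Section CompletionLift.
Variables (A B : comPzRingType) (I : ideal B).
Variable psi : forall N, {rmorphism A -> quot (ideal_pow I N)}.
Hypothesis psi_reduces : forall N x, reduces (psi N x) (psi N.+1 x).

Definition completion_fun (x : A) : completion I :=
  Completion (fun N => psi_reduces N x).

Lemma completion_fun_zmod : zmod_morphism completion_fun.
Proof. by move=> x y; apply: cmp_inj => N /=; rewrite rmorphB. Qed.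

Lemma completion_fun_monoid : monoid_morphism completion_fun.
Proof. by split=> [|x y]; apply: cmp_inj => N /=; rewrite ?rmorph1 ?rmorphM. Qed.

Definition completion_lift : {rmorphism A -> completion I} :=
  rmorph_of completion_fun_zmod completion_fun_monoid.

Lemma completion_liftE x N : completion_lift x N = psi N x.
Proof. by []. Qed.

End CompletionLift.

(** If f has dense image modulo K and K is generated by the image of I, then
    K^n is K^(n+1) plus the image of I^n, so that density modulo K
    propagates to all powers. *)
Lemma dense_pow (B C : comPzRingType) (f : {rmorphism B -> C}) (I : ideal B) (K : ideal C) :
  (forall c, exists b, K (c - f b)) ->
  (forall c, K c -> ideal_ext f I c) -> (forall b, I b -> K (f b)) ->
  forall N c, exists b, ideal_pow K N (c - f b).
Proof.
move=> dense Kgen IK N.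
have step n c : ideal_pow K n c -> exists2 b, ideal_pow I n b & ideal_pow K n.+1 (c - f b).
  elim: n c => [|n IHn] c.
    by move=> _; have [b Kb] := dense c; exists b => //; apply/ideal_pow1.
  move: c; apply: ideal_pow_ind => [|x y [a Ia Ka] [b Ib Kb]|x y Kx Ky].
  - by exists 0; rewrite ?rmorph0 ?subr0; apply: ideal0.
  - exists (a + b); first exact: idealD.
    by rewrite rmorphD opprD addrACA; apply: idealD.
  have [b Ib Kb] := IHn y Ky.
  have [s [sI ->]] := Kgen x Kx.
  elim: s sI => [|u s IHs] sI.
    by exists 0; rewrite ?big_nil ?mul0r ?rmorph0 ?subr0; apply: ideal0.
  have [|b' Ib' Kb'] := IHs; first by move=> v vs; apply: sI; rewrite inE vs orbT.
  have [a Ia ua] := sI u (mem_head _ _); have [c Kc] := dense u.1.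
  exists (c * a * b + b'); first by apply: idealD => //; apply: ideal_powSM => //; apply: idealMl.
  rewrite big_cons mulrDl rmorphD opprD addrACA; apply: idealD => //.
  rewrite -ua !rmorphM.
  have -> : u.1 * f a * y - f c * f a * f b =
    (f a * f c) * (y - f b) + (u.1 - f c) * (f a * y) by ring.
  by apply: idealD; apply: ideal_powSM => //; [apply/ideal_mulr/IK|apply: ideal_powSM => //; apply: IK].
elim: N => [|N IHN] c; first by exists 0.
have [b /step[b' _ Kb']] := IHN c; exists (b + b').
by rewrite rmorphD opprD addrA.
Qed.

(** A strict map with dense image induces isomorphisms B/I^N -> C/K^N for all
    N, hence an isomorphism of the limits. *)
Lemma completion_iso (B C : comPzRingType) (f : {rmorphism B -> C})
    (I : ideal B) (K : ideal C) :
  (forall N b, ideal_pow I N b <-> ideal_pow K N (f b)) ->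
  (forall N c, exists b, ideal_pow K N (c - f b)) ->
  ring_iso (completion K) (completion I).
Proof.
move=> IK dense.
pose fN N : {rmorphism B -> quot (ideal_pow K N)} := quot_proj (ideal_pow K N) \o f.
have fN0 N b : ideal_pow I N b -> fN N b = 0 by move=> /IK/quot_proj0P.
pose g N := quot_lift (@fN0 N).
have gE N b : g N (quot_proj _ b) = quot_proj _ (f b) by apply: quot_liftE.
have g_inj N : injective (g N).
  move=> u v; have [x ->] := quot_proj_surj u; have [y ->] := quot_proj_surj v.
  by rewrite !gE => /quot_projP; rewrite -rmorphB => /IK/quot_projP.
have g_surj N w : exists u, g N u = w.
  have [c ->] := quot_proj_surj w; have [b Kb] := dense N c.
  by exists (quot_proj _ b); rewrite gE; apply/quot_projP; apply: ideal_subC.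
pose prj N (z : completion I) := z N.
have prjB N : zmod_morphism (prj N) by [].
have prjM N : monoid_morphism (prj N) by [].
pose psi N : {rmorphism completion I -> quot (ideal_pow K N)} :=
  g N \o rmorph_of (prjB N) (prjM N).
have psi_red N z : reduces (psi N z) (psi N.+1 z).
  have [b [e1 e2]] := cmpP z N; exists (f b).
  by split; rewrite ?[LHS](congr1 (g _) e1) ?[LHS](congr1 (g _) e2) gE.
pose h := completion_lift psi_red.
suff [k hk kh] : bijective h.
  have kB : zmod_morphism k by move=> x y; rewrite -{1}(kh x) -{1}(kh y) -rmorphB hk.
  have kM : monoid_morphism k.
    split=> [|x y]; first by rewrite -(rmorph1 h) hk.
    by rewrite -{1}(kh x) -{1}(kh y) -rmorphM hk.
  by exists (rmorph_of kB kM); exists h.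
apply: inj_surj_bij => [x y xy|w].
  apply: cmp_inj => N; apply: (@g_inj N).
  by have := congr1 (fun z : completion K => z N) xy.
pose u N := sval (cid (g_surj N (w N))).
have uP N : g N (u N) = w N by apply: (svalP (cid (g_surj N (w N)))).
have u_red N : reduces (u N) (u N.+1).
  have [b bE] := quot_proj_surj (u N.+1); exists b; split=> //.
  apply: (@g_inj N); rewrite gE uP; apply: cmp_reducesE.
  by rewrite -uP bE gE.
exists (Completion u_red); apply: cmp_inj => N; exact: uP.
Qed.

(** * Power series in one variable *)

Section FpsTheory.
Variable A : comPzRingType.
Implicit Types (f g h : fps A) (I : ideal A).

Lemma fpsDE f g i : (f + g) i = f i + g i. Proof. by []. Qed.
Lemma fpsNE f i : (- f) i = - f i. Proof. by []. Qed.
Lemma fpsBE f g i : (f - g) i = f i - g i. Proof. by []. Qed.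
Lemma fpsME f g i : (f * g) i = \sum_(j < i.+1) f j * g (i - j)%N.
Proof. by []. Qed.

Lemma fps_sumE (T : Type) (s : seq T) (P : pred T) (F : T -> fps A) i :
  (\sum_(t <- s | P t) F t) i = \sum_(t <- s | P t) F t i.
Proof. exact: (big_morph (fun f : fps A => f i) (id1 := 0) (op1 := +%R)). Qed.

Lemma fpsCM a f i : (fpsC a * f) i = a * f i.
Proof.
rewrite fpsME big_ord_recl /= subn0 big1 ?addr0 // => j _.
by rewrite [fpsC a _]/= mul0r.
Qed.

Lemma fpsXM f i : (fpsX A * f) i = if i is k.+1 then f k else 0.
Proof.
rewrite fpsME big_ord_recl /= mul0r add0r; case: i => [|i]; first by rewrite big_ord0.
rewrite big_ord_recl /= mul1r big1 ?addr0 => [|j _]; first by rewrite subSS subn0.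
by rewrite mul0r.
Qed.

Lemma fpsXnM k f i : (fpsX A ^+ k * f) i = if (i < k)%N then 0 else f (i - k)%N.
Proof.
elim: k i => [|k IHk] i; first by rewrite mul1r subn0.
by rewrite exprS -mulrA fpsXM; case: i => [|i] //; rewrite IHk ltnS subSS.
Qed.

Lemma fps_split f : f = fpsC (f 0%N) + fpsX A * (fun i => f i.+1 : A).
Proof.
by apply: funext => -[|i]; rewrite fpsDE fpsXM ?addr0 // add0r.
Qed.

Lemma fps_trunc k f : f = \sum_(i < k) fpsC (f i) * fpsX A ^+ i
  + fpsX A ^+ k * (fun i => f (k + i)%N : A).
Proof.
elim: k => [|k {1}->]; first by rewrite big_ord0 add0r mul1r.
rewrite big_ord_recr /= -addrA; congr (_ + _).
rewrite [X in _ * X]fps_split addn0 mulrDr mulrC; congr (_ + _).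
rewrite mulrA -exprSr; congr (_ * _); apply: funext => i; by rewrite addSnnS.
Qed.

Lemma fpsX_inj f : fpsX A * f = 0 -> f = 0.
Proof. by move=> Xf; apply: funext => i; rewrite -[LHS](fpsXM f i.+1) Xf. Qed.

Lemma fpsXn_inj k f : fpsX A ^+ k * f = 0 -> f = 0.
Proof. by elim: k => [|k IHk]; rewrite ?mul1r // exprS -mulrA => /fpsX_inj. Qed.

Definition fps_const f : A := f 0%N.
Lemma fps_const_zmod : zmod_morphism fps_const. Proof. by []. Qed.
Lemma fps_const_monoid : monoid_morphism fps_const.
Proof. by split=> // f g; apply: big_ord1. Qed.
Definition fps_coef0 : {rmorphism fps A -> A} :=
  rmorph_of fps_const_zmod fps_const_monoid.

Definition fps_ideal I : ideal (fps A) := preim_ideal fps_coef0 I.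

(** The ideal [fps_ideal I] is (I, t); as t is a free variable, its powers are
    computed coefficientwise. This replaces every explicit manipulation
    of generators of (I, t)^N. *)
Lemma fps_idealP I N f :
  ideal_pow (fps_ideal I) N f <-> forall i, ideal_pow I (N - i) (f i).
Proof.
split.
  elim: N f => [//|N IHN]; apply: ideal_pow_ind => [i|x y Px Py i|x y Ix /IHN Iy i].
  - exact: ideal0.
  - by apply: idealD.
  rewrite fpsME; apply: ideal_big => -[[|j] ltji] _ /=.
    rewrite subn0; have := Iy i; case: (leqP i N) => [leiN|ltNi] Iyi.
      by rewrite subSn //; apply: ideal_powSM.
    by rewrite (eqP (_ : N.+1 - i == 0)%N).
  apply: idealMl; apply: ideal_pow_leq (Iy _).
  by rewrite -{1}(subnKC (ltji : j < i)%N) addSn subSS leq_sub2l // leq_addl.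
elim: N f => [//|N IHN] f If; rewrite (fps_split f); apply: idealD.
  exact: (@ideal_pow_morph _ _ (@fpsC A) I (fps_ideal I) N.+1 _ _ (If 0%N)).
apply: ideal_powSM; first exact: (ideal0 I).
by apply/IHN => i; exact: (If i.+1).
Qed.

Lemma fps_cauchy I : cauchy_complete I -> cauchy_complete (fps_ideal I).
Proof.
move=> cI g /(_ _)/fps_idealP gI.
have /choice[f fP] i : exists a, forall N,
    ideal_pow I N (a - \sum_(e < N) g (i + e)%N i).
  by apply: (cI (fun e => g (i + e)%N i)) => e; have := gI (i + e)%N i; rewrite addKn.
exists (fun i => \sum_(d < i) g d i + f i) => N; apply/fps_idealP => i.
rewrite fpsBE fps_sumE; case: (leqP N i) => [leNi|/ltnW leiN].
  by rewrite (eqP leNi).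
have [k {leiN}->] : exists k, N = (i + k)%N by exists (N - i)%N; rewrite subnKC.
rewrite addKn big_split_ord /= opprD addrACA subrr add0r.
exact: fP.
Qed.

Lemma fps_separated I : (forall x, (forall N, ideal_pow I N x) -> x = 0) ->
  forall f, (forall N, ideal_pow (fps_ideal I) N f) -> f = 0.
Proof.
move=> sI f If; apply: funext => i; apply: sI => N.
by have /fps_idealP/(_ i) := If (N + i)%N; rewrite addnK.
Qed.

(** The extension of I to the power series ring when I is finitely generated,
    as opposed to [fps_ideal I], which also contains t. *)
Definition fps_coefs I : ideal (fps A).
Proof.
exists (fun f => forall i, I (f i)) => [i|f g If Ig i|f g Ig i].
- exact: ideal0.
- exact: idealD.
- by rewrite fpsME; apply: ideal_big => j _; apply: idealMl.
Defined.

Lemma fps_coefs_pow I N f : ideal_pow (fps_coefs I) N f -> fps_coefs (ideal_pow I N) f.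
Proof.
elim: N f => [//|N IHN]; apply: ideal_pow_ind => [|x y|x y Ix /IHN Iy i]; [exact: ideal0|exact: idealD|].
by rewrite fpsME; apply: ideal_big => j _; apply: ideal_powSM.
Qed.

End FpsTheory.

(** * Noetherian rings *)

Section Noetherian.
Variable A : comPzRingType.

Lemma ideal_gen_sub (s s' : seq A) : {subset s <= s'} ->
  forall x, ideal_gen [set` s]%classic x -> ideal_gen [set` s']%classic x.
Proof.
move=> ss'; apply: ideal_gen_min => x xs; apply: mem_ideal_gen; exact: ss'.
Qed.

Lemma ideal_gen_seq (s : seq A) x : ideal_gen [set` s]%classic x <->
  exists c : 'I_(size s) -> A, x = \sum_i c i * s`_i.
Proof.
split=> [|[c ->]]; last first.
  by apply: ideal_big => i _; apply/idealMl/mem_ideal_gen/mem_nth.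
pose P y := exists c : 'I_(size s) -> A, y = \sum_i c i * s`_i.
have P0 : P 0 by exists (fun=> 0); rewrite big1 // => i _; rewrite mul0r.
have PD y z : P y -> P z -> P (y + z).
  move=> [c ->] [d ->]; exists (fun i => c i + d i).
  by rewrite -big_split; apply: eq_bigr => i _; rewrite mulrDl.
have PM a y : P y -> P (a * y).
  move=> [c ->]; exists (fun i => a * c i).
  by rewrite big_distrr; apply: eq_bigr => i _ /=; rewrite mulrA.
apply: (@ideal_gen_min _ _ (Ideal P0 PD PM)) => y /= ys.
rewrite /P; have ltis : (index y s < size s)%N by rewrite index_mem.
exists (fun j => (j == Ordinal ltis)%:R).
rewrite (bigD1 (Ordinal ltis)) //= eqxx mul1r nth_index // big1 ?addr0 // => j.
by move=> /negPf ->; rewrite mul0r.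
Qed.

(** The union of the chain is finitely generated, and its generators
    all occur at some stage. *)
Lemma noetherian_stable (L : nat -> ideal A) : is_noetherian A ->
  (forall i x, L i x -> L i.+1 x) ->
  exists d, forall i x, L i x -> L d x.
Proof.
move=> nA LS.
have Lle i j x : (i <= j)%N -> L i x -> L j x.
  by move=> /subnK <-; elim: (j - i)%N => // k IHk /IHk; apply: LS.
pose U x := exists i, L i x.
have U0 : U 0 by exists 0%N; apply: ideal0.
have UD x y : U x -> U y -> U (x + y).
  move=> [i Lx] [j Ly]; exists (maxn i j).
  by apply: idealD; [apply: Lle Lx; apply: leq_maxl|apply: Lle Ly; apply: leq_maxr].
have UM a x : U x -> U (a * x) by move=> [i Lx]; exists i; apply: idealMl.
have [s sU] := nA (Ideal U0 UD UM).
have [d dP] : exists d, forall x, x \in s -> L d x.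
  have: forall x, x \in s -> U x by move=> x xs; apply/sU/mem_ideal_gen.
  elim: s {sU} => [|x s IHs] sU; first by exists 0%N.
  have [|d dP] := IHs; first by move=> y ys; apply: sU; rewrite inE ys orbT.
  have [i Lx] := sU x (mem_head _ _).
  exists (maxn i d) => y; rewrite inE => /predU1P[->|/dP].
    by apply: Lle Lx; apply: leq_maxl.
  by apply: Lle; apply: leq_maxr.
exists d => i x Lx; have /sU : U x by exists i.
by apply: ideal_gen_min.
Qed.

End Noetherian.

Lemma quot_noetherian (A : comPzRingType) (J : ideal A) :
  is_noetherian A -> is_noetherian (quot J).
Proof.
move=> nA K; have [s sK] := nA (preim_ideal (quot_proj J) K).
exists (map (quot_proj J) s) => u; split=> [|]; last first.
  apply: ideal_gen_min => _ /mapP[x xs ->].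
  by have /sK := mem_ideal_gen (xs : [set` s]%classic x).
have [x ->] := quot_proj_surj u => Kx; have /sK/ideal_gen_seq[c ->] : preim_ideal (quot_proj J) K x by [].
rewrite rmorph_sum; apply: ideal_big => i _; rewrite rmorphM.
by apply/idealMl/mem_ideal_gen/map_f/mem_nth.
Qed.

Section FpsNoetherian.
Variables (A : comPzRingType) (J : ideal (fps A)).
Hypothesis nA : is_noetherian A.

Definition fps_ord (i : nat) (f : fps A) := forall j, (j < i)%N -> f j = 0.

(** The coefficients of t^i of the elements of J of order at least i; these
    ideals play the role of the leading coefficient ideals in
    Hilbert's basis theorem. *)
Definition init_coef (i : nat) : ideal A.
Proof.
exists (fun a => exists f, [/\ J f, fps_ord i f & f i = a]) => [|x y|a x].
- by exists 0; split=> //; apply: ideal0.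
- move=> [f [Jf fo <-]] [g [Jg go <-]]; exists (f + g); split=> //.
    exact: idealD.
  by move=> j ji; rewrite fpsDE fo ?go ?addr0.
- move=> [f [Jf fo <-]]; exists (fpsC a * f); split=> [||]; last exact: fpsCM.
    exact: idealMl.
  by move=> j ji; rewrite fpsCM fo ?mulr0.
Defined.

Lemma init_coefS i x : init_coef i x -> init_coef i.+1 x.
Proof.
move=> [f [Jf fo <-]]; exists (fpsX A * f); split; first exact: idealMl.
  by move=> [|j] ji; rewrite fpsXM // fo.
by rewrite fpsXM.
Qed.

Lemma init_coef_gens i : exists2 g : seq (fps A),
  forall f, f \in g -> J f /\ fps_ord i f &
  forall x, init_coef i x -> exists c : 'I_(size g) -> A,
    x = \sum_l c l * (g`_l : fps A) i.
Proof.
have [s sP] := nA (init_coef i).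
have /choice[h hP] x : exists f, x \in s -> [/\ J f, fps_ord i f & f i = x].
  have [xs|] := boolP (x \in s); last by exists 0.
  by have /sP[f fP] := mem_ideal_gen (xs : [set` s]%classic x); exists f.
exists (map h s) => [_ /mapP[x /hP[Jh ho _] ->]//|x /sP/ideal_gen_seq].
rewrite size_map => -[c ->]; exists c; apply: eq_bigr => l _; congr (_ * _).
rewrite (nth_map 0) //; have [|_ _ -> //] := hP s`_l; exact: mem_nth.
Qed.

(** Once the ideals of initial coefficients are stationary at d, finitely many
    elements of J of order d suffice to cancel the coefficients of an element of
    order d one after the other: the factor t^j needed at step d + j is
    moved to the coefficients, which become power series. *)
Lemma fps_tail_gens d : (forall i x, init_coef i x -> init_coef d x) ->
  exists2 g : seq (fps A), forall f, f \in g -> J f &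
  forall f, J f -> fps_ord d f -> ideal_gen [set` g]%classic f.
Proof.
move=> stab; have [g gJ gP] := init_coef_gens d.
exists g => [f /gJ[]//|f Jf fo].
have gm l : (l < size g)%N -> g`_l \in g by apply: mem_nth.
pose step j (c : 'I_(size g) -> A) : fps A :=
  fpsX A ^+ j * \sum_l fpsC (c l) * g`_l.
have [||F [F0 FP FS]] := @dependent_choice _
    (fun j (h : fps A) => J h /\ fps_ord (d + j) h)
    (fun j h h' => exists c, h' = h - step j c) f; first by rewrite addn0.
  move=> j h [Jh ho].
  have [c cP] : exists c : 'I_(size g) -> A, h (d + j)%N = \sum_l c l * (g`_l : fps A) d.
    by apply/gP/(stab (d + j)%N); exists h.
  exists (h - step j c); last by exists c.
  split.
    apply: idealB => //; apply/idealMl/ideal_big => l _; apply: idealMl.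
    by have [] := gJ _ (gm l (ltn_ord l)).
  move=> k; rewrite addnS ltnS fpsBE /step fpsXnM leq_eqVlt => /predU1P[->|kj].
    rewrite ltnNge leq_addl /= addnK fps_sumE cP; apply/eqP; rewrite subr_eq0.
    by apply/eqP/eq_bigr => l _; rewrite fpsCM.
  rewrite ho // sub0r; case: ltnP => jk; first by rewrite oppr0.
  rewrite fps_sumE big1 ?oppr0 // => l _; rewrite fpsCM.
  have [_ ->] := gJ _ (gm l (ltn_ord l)); rewrite ?mulr0 //.
  by rewrite ltn_subLR // addnC.
have /choice[b bP] j := FS j.
pose h l : fps A := fun j => b j l.
apply/ideal_gen_seq; exists h; apply/eqP; rewrite -subr_eq0; apply/eqP.
have FE j : f = \sum_l (\sum_(i < j) fpsC (h l i) * fpsX A ^+ i) * g`_l + F j.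
  elim: j => [|j IHj].
    rewrite big1 ?add0r ?F0 // => l _; by rewrite big_ord0 mul0r.
  rewrite [LHS]IHj bP /step big_distrr addrCA -sumrB addrC.
  congr (_ + _); apply: eq_bigr => l _ /=.
  by rewrite big_ord_recr /=; ring.
apply: funext => k; rewrite (FE k.+1) addrAC -sumrB fpsDE.
have [_ ->] := FP k.+1; last by rewrite addnS ltnS leq_addl.
rewrite fps_sumE addr0 big1 // => l _.
rewrite -mulrBl {2}(fps_trunc k.+1 (h l)) opprD addrA subrr sub0r mulNr -mulrA.
by rewrite fpsNE fpsXnM ltnSn oppr0.
Qed.

Lemma fps_ideal_fg : exists s : seq (fps A),
  forall f, J f <-> ideal_gen [set` s]%classic f.
Proof.
have [d stab] := noetherian_stable nA init_coefS.
have gens i : exists2 g : seq (fps A), forall f, f \in g -> J f &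
    forall f, J f -> fps_ord (d - i) f -> ideal_gen [set` g]%classic f.
  elim: i => [|i [g gJ gP]]; first by rewrite subn0; apply: fps_tail_gens.
  have [leid|ltdi] := leqP d i.
    exists g => // f Jf; have -> : (d - i.+1 = d - i)%N; last exact: gP.
    by rewrite (eqP leid) (eqP (leqW leid)).
  have [h hJ hP] := init_coef_gens (d - i.+1).
  exists (h ++ g) => [f|f Jf fo].
    by rewrite mem_cat => /orP[/hJ[]//|/gJ].
  have [|c cP] := hP (f (d - i.+1)%N); first by exists f.
  pose f' := \sum_l fpsC (c l) * h`_l.
  have hgen : ideal_gen [set` h ++ g]%classic f'.
    apply: ideal_big => l _; apply/idealMl/mem_ideal_gen => /=.
    by rewrite mem_cat mem_nth.
  rewrite -(subrK f' f); apply: idealD => //.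
  have hm l : (l < size h)%N -> h`_l \in h by apply: mem_nth.
  apply: (@ideal_gen_sub _ g); first by move=> x xg; rewrite mem_cat xg orbT.
  apply: gP.
    apply: idealB => //; apply: ideal_big => l _; apply: idealMl.
    by have [] := hJ _ (hm l (ltn_ord l)).
  move=> j; rewrite -subSS subSn // ltnS leq_eqVlt fpsBE /f' fps_sumE.
  move=> /predU1P[->|jd].
    by rewrite cP; apply/eqP; rewrite subr_eq0; apply/eqP/eq_bigr => l _; rewrite fpsCM.
  rewrite fo // sub0r big1 ?oppr0 // => l _; rewrite fpsCM.
  by have [_ ->] := hJ _ (hm l (ltn_ord l)); rewrite ?mulr0.
have [g gJ gP] := gens d; exists g => f; split=> [Jf|].
  by apply: gP => // j; rewrite subnn.
exact: ideal_gen_min.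
Qed.

End FpsNoetherian.

Lemma fps_noetherian (A : comPzRingType) : is_noetherian A -> is_noetherian (fps A).
Proof. by move=> nA J; apply: fps_ideal_fg. Qed.

(** Submodules of a free module of rank q are finitely generated. Vectors are
    represented by sequences of which only the first q entries matter, and
    the induction is on q: the last coordinates form an ideal, and the vectors
    whose last coordinate is zero form a submodule of rank q - 1. *)
Lemma free_noetherian (V : comPzRingType) q (P : fps V -> Prop) :
  is_noetherian V -> P 0 -> (forall u v, P u -> P v -> P (u + v)) ->
  (forall a u, P u -> P (fpsC a * u)) ->
  exists2 s : seq (fps V), forall u, u \in s -> P u &
    forall u, P u -> exists c : nat -> V,
      forall i, (i < q)%N -> u i = \sum_(l < size s) c l * (s`_l : fps V) i.
Proof.
move=> nV; elim: q P => [|q IHq] P P0 PD PZ; first by exists [::] => // u _; exists u.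
have PS (I : Type) (r : seq I) (F : I -> fps V) :
  (forall l, P (F l)) -> P (\sum_(l <- r) F l) by move=> PF; elim/big_ind: _.
have PB u v : P u -> P v -> P (u - v).
  by move=> Pu Pv; apply: PD => //; rewrite -mulN1r -(rmorph1 (@fpsC V)) -rmorphN; apply: PZ.
pose L a := exists2 u, P u & u q = a.
have L0 : L 0 by exists 0.
have LD a b : L a -> L b -> L (a + b).
  by move=> [u Pu <-] [v Pv <-]; exists (u + v) => //; apply: PD.
have LM a b : L b -> L (a * b).
  by move=> [u Pu <-]; exists (fpsC a * u); [apply: PZ|rewrite fpsCM].
have [s sP] := nV (Ideal L0 LD LM).
have /choice[h hP] x : exists u, x \in s -> P u /\ u q = x.
  have [xs|] := boolP (x \in s); last by exists 0.
  by have /sP[u Pu <-] := mem_ideal_gen (xs : [set` s]%classic x); exists u.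
have [|u v [Pu u0] [Pv v0]|a u [Pu u0]|t tP tspan] := IHq (fun u => P u /\ u q = 0).
- by [].
- by split; [apply: PD|rewrite fpsDE u0 v0 addr0].
- by split; [apply: PZ|rewrite fpsCM u0 mulr0].
exists (map h s ++ t) => [u|u Pu].
  by rewrite mem_cat => /orP[/mapP[x /hP[Ph _] ->]|/tP[]].
have hm l : (l < size s)%N -> P (h s`_l) /\ h s`_l q = s`_l.
  by move=> ltl; apply/hP/mem_nth.
have /sP/ideal_gen_seq[c cP] : L (u q) by exists u.
have [|d dP] := tspan (u - \sum_l fpsC (c l) * h s`_l).
  split; first by apply: PB => //; apply: PS => l; apply: PZ; have [] := hm l (ltn_ord l).
  rewrite fpsBE fps_sumE cP; apply/eqP; rewrite subr_eq0; apply/eqP/eq_bigr => l _.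
  by rewrite fpsCM; have [_ ->] := hm l (ltn_ord l).
exists (fun l => if insub l is Some k then c k else d (l - size s)%N) => i leiq.
rewrite size_cat size_map big_split_ord /=.
have -> : \sum_(l < size s) (if insub (l : nat) is Some k then c k else d (l - size s)%N)
    * ((map h s ++ t)`_l : fps V) i = (\sum_l fpsC (c l) * h s`_l : fps V) i.
  rewrite fps_sumE; apply: eq_bigr => l _; rewrite valK nth_cat size_map ltn_ord.
  by rewrite fpsCM (nth_map 0).
have -> : \sum_(l < size t) (if insub (size s + l)%N is Some k then c k
      else d (size s + l - size s)%N) * ((map h s ++ t)`_(size s + l) : fps V) i =
    \sum_(l < size t) d l * (t`_l : fps V) i.
  apply: eq_bigr => l _; rewrite insubF; last by rewrite ltnNge leq_addr.
  by rewrite nth_cat size_map ltnNge leq_addr /= addKn.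
move: leiq; rewrite ltnS leq_eqVlt => /predU1P[->|ltiq]; last by rewrite -dP // fpsBE addrCA subrr addr0.
rewrite (big1 _ _ (fun l : 'I_(size t) => d l * _)) => [|l _]; last first.
  by have [_ ->] := tP t`_l (mem_nth _ (ltn_ord l)); rewrite mulr0.
rewrite addr0 fps_sumE cP; apply: eq_bigr => l _; rewrite fpsCM.
by have [_ ->] := hm l (ltn_ord l).
Qed.

(** * Power series in several variables *)

Definition zero_ideal (A : comPzRingType) : ideal A.
Proof.
exists (fun x => x = 0) => [//|x y -> ->|a x ->]; [exact: addr0|exact: mulr0].
Defined.

Lemma mps_noetherian (V : comPzRingType) n : is_noetherian V -> is_noetherian (mps V n).
Proof. by move=> nV; elim: n => //= n; apply: fps_noetherian. Qed.

(** The ideal (I, x_1, ..., x_n) of V[[x_1, ..., x_n]]. It is defined by recursion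
    so that the results on one variable iterate; [mps_idealP] is the usual
    description by the constant term. *)
Fixpoint mps_ideal (V : comPzRingType) (I : ideal V) n : ideal (mps V n) :=
  if n is n'.+1 then fps_ideal (mps_ideal I n') else I.

Fixpoint mps_const (V : comPzRingType) n : {rmorphism mps V n -> V} :=
  match n return {rmorphism mps V n -> V} with
  | 0 => idfun
  | n'.+1 => mps_const V n' \o fps_coef0 (mps V n')
  end.

Section Mps.
Variable V : comPzRingType.

Lemma mps_idealP (I : ideal V) n f : mps_ideal I n f <-> I (mps_const V n f).
Proof. by elim: n f => //= n IHn f; apply: IHn. Qed.

Lemma mps_cauchy (I : ideal V) n : cauchy_complete I -> cauchy_complete (mps_ideal I n).
Proof. by move=> cI; elim: n => //= n; apply: fps_cauchy. Qed.

Lemma mps_separated (I : ideal V) n : (forall x, (forall N, ideal_pow I N x) -> x = 0) ->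
  forall f, (forall N, ideal_pow (mps_ideal I n) N f) -> f = 0.
Proof. by move=> sI; elim: n => //= n; apply: fps_separated. Qed.

Lemma mps_constC n v : mps_const V n (mpsC V n v) = v.
Proof. by elim: n => //= n ->. Qed.

Lemma mpsX_lift n (i : 'I_n) : @mpsX V n.+1 (lift ord_max i) = fpsC (mpsX V i).
Proof. by rewrite /= liftK. Qed.

Lemma widen_lift n (i : 'I_n) : widen_ord (leqnSn n) i = lift ord_max i.
Proof. by apply: val_inj; rewrite /= /bump leqNgt ltn_ord. Qed.

Lemma mpsX_max n : @mpsX V n.+1 ord_max = fpsX (mps V n).
Proof. by rewrite /= unlift_none. Qed.

Lemma mps_constX n (i : 'I_n) : mps_const V n (mpsX V i) = 0.
Proof.
elim: n i => [[]//|n IHn] i; rewrite /=; case: unliftP => [j _|_] /=.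
  exact: IHn.
by rewrite -[fps_const _]/(0 : mps V n) rmorph0.
Qed.

Lemma mps_split n (f : mps V n) : exists g : 'I_n -> mps V n,
  f = mpsC V n (mps_const V n f) + \sum_i mpsX V i * g i.
Proof.
elim: n f => [|n IHn] f; first by exists (fun=> 0); rewrite big_ord0 addr0.
have [g gE] := IHn (f 0%N).
exists (fun i => if unlift ord_max i is Some j then fpsC (g j)
                 else (fun i => f i.+1 : mps V n)).
rewrite big_ord_recr mpsX_max unlift_none addrA {1}(fps_split f); congr (_ + _).
rewrite {1}gE rmorphD rmorph_sum; congr (_ + _); apply: eq_bigr => i _.
by rewrite widen_lift mpsX_lift liftK rmorphM.
Qed.

Definition mps_x n : ideal (mps V n) := mps_ideal (zero_ideal V) n.

Lemma mps_xP n f : mps_x n f <-> mps_const V n f = 0.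
Proof. exact: mps_idealP. Qed.

Lemma mps_x_X n i : mps_x n (mpsX V i).
Proof. by apply/mps_xP/mps_constX. Qed.

Lemma zero_ideal_cauchy : cauchy_complete (zero_ideal V).
Proof.
move=> g gI; exists (g 0%N) => -[//|N].
rewrite big_ord_recl opprD addrA subrr sub0r big1 ?oppr0 => [|i _]; first exact: ideal0.
exact: ideal_pow_sub (gI _).
Qed.

Lemma mps_x_cauchy n : cauchy_complete (mps_x n).
Proof. exact/mps_cauchy/zero_ideal_cauchy. Qed.

(** A power of (x) is linear over the previous one in the variables, because (x)
    is generated by them. *)
Lemma mps_x_split n N f : ideal_pow (mps_x n) N.+1 f ->
  exists g : 'I_n -> mps V n, f = \sum_i mpsX V i * g i /\
    forall i, ideal_pow (mps_x n) N (g i).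
Proof.
move: f; apply: ideal_pow_ind => [|f f' [g [-> gI]] [g' [-> gI']]|f f' If If'].
- exists (fun=> 0); split=> [|i]; last exact: ideal0.
  by rewrite big1 // => i _; rewrite mulr0.
- exists (fun i => g i + g' i); split=> [|i]; last exact: idealD.
  by rewrite -big_split; apply: eq_bigr => i _; rewrite mulrDr.
have [g fE] := mps_split f; exists (fun i => g i * f'); split=> [|i]; last exact: idealMl.
rewrite {1}fE (mps_xP f).1 // rmorph0 add0r big_distrl.
by apply: eq_bigr => i _; rewrite mulrA.
Qed.

(** The ideal (x) of V[[x]][[t]]. *)
Definition xt_x n : ideal (fps (mps V n)) := fps_coefs (mps_x n).
Definition xt_X n (i : 'I_n) : fps (mps V n) := fpsC (mpsX V i).
Definition xt_C n : {rmorphism fps V -> fps (mps V n)} := fps_map (mpsC V n).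

Lemma xt_x_X n i : xt_x n (xt_X i).
Proof. by case=> [|j]; [apply: mps_x_X|apply: ideal0]. Qed.

(** As (x) is generated by the finitely many x_i, its powers in V[[x]][[t]] are
    computed coefficientwise in t. *)
Lemma xt_x_pow n N F : (forall j, ideal_pow (mps_x n) N (F j)) <-> ideal_pow (xt_x n) N F.
Proof.
split; last exact: fps_coefs_pow.
elim: N F => [//|N IHN] F FI.
have /choice[g /all_and2[gE gI]] j : exists g : 'I_n -> mps V n,
    F j = \sum_i mpsX V i * g i /\ forall i, ideal_pow (mps_x n) N (g i).
  exact: mps_x_split.
have -> : F = \sum_i xt_X i * (fun j => g j i).
  apply: funext => j; rewrite gE fps_sumE; apply: eq_bigr => i _.
  by rewrite fpsCM.
apply: ideal_big => i _; apply: ideal_powSM; first exact: xt_x_X.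
by apply: IHN => j; apply: gI.
Qed.

Lemma xt_split n (F : fps (mps V n)) : exists (f : fps V) (G : 'I_n -> fps (mps V n)),
  F = xt_C n f + \sum_i xt_X i * G i.
Proof.
have /choice[g gE] j := mps_split (F j).
exists (fun j => mps_const V n (F j)), (fun i j => g j i).
apply: funext => j; rewrite gE fpsDE fps_sumE; congr (_ + _).
by apply: eq_bigr => i _; rewrite fpsCM.
Qed.

Lemma xt_x_split n F : xt_x n F -> exists G : 'I_n -> fps (mps V n),
  F = \sum_i xt_X i * G i.
Proof.
move=> FI; have /choice[g gE] j : exists g : 'I_n -> mps V n, F j = \sum_i mpsX V i * g i.
  by have [g [gE _]] := mps_x_split (N := 0) ((ideal_pow1 _ _).2 (FI j)); exists g.
exists (fun i j => g j i); apply: funext => j; rewrite gE fps_sumE.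
by apply: eq_bigr => i _; rewrite fpsCM.
Qed.

Lemma xt_cauchy n : cauchy_complete (xt_x n).
Proof.
move=> g gI.
have /choice[f fP] j : exists a, forall N,
    ideal_pow (mps_x n) N (a - \sum_(d < N) g d j).
  by apply: (mps_x_cauchy (g := fun d => g d j)) => d; move/xt_x_pow: (gI d).
by exists f => N; apply/xt_x_pow => j; rewrite fpsBE fps_sumE.
Qed.

End Mps.

(** * Evaluation of power series at nilpotent elements *)

Section Swap.
Variable A : comPzRingType.

(** Exchanging the variables of A[[x]][[t]] lets t be treated before x, so that
    only nilpotent elements remain to be substituted. *)
Definition fps_swap (F : fps (fps A)) : fps (fps A) := fun i j => F j i.

Lemma fps_swap_zmod : zmod_morphism fps_swap. Proof. by []. Qed.

Lemma fps_swap_monoid : monoid_morphism fps_swap.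
Proof.
split=> [|F G]; first by apply: funext => i; apply: funext => j; case: i j => [|i] [|j].
apply: funext => i; apply: funext => j.
rewrite -[LHS]/((F * G) j i) !fpsME !fps_sumE.
under eq_bigr do rewrite fpsME.
under [RHS]eq_bigr do rewrite fpsME.
by rewrite exchange_big.
Qed.

Definition fps_swapM : {rmorphism fps (fps A) -> fps (fps A)} :=
  rmorph_of fps_swap_zmod fps_swap_monoid.

End Swap.

Section NilEval.
Variables (A D : comPzRingType) (phi : {rmorphism A -> D}) (y : D) (N : nat).
Hypothesis yN : y ^+ N = 0.

Definition nileval (f : fps A) : D := \sum_(i < N) phi (f i) * y ^+ i.

Lemma nileval_zmod : zmod_morphism nileval.
Proof.
by move=> f g; rewrite /nileval -sumrB; apply: eq_bigr => i _; rewrite rmorphB mulrBl.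
Qed.

Lemma nilevalC a f : nileval (fpsC a * f) = phi a * nileval f.
Proof.
by rewrite /nileval big_distrr; apply: eq_bigr => i _; rewrite fpsCM rmorphM -mulrA.
Qed.

Lemma nilevalX f : nileval (fpsX A * f) = y * nileval f.
Proof.
rewrite /nileval; case: N yN => [|k] yk; first by rewrite !big_ord0 mulr0.
rewrite big_ord_recl fpsXM rmorph0 mul0r add0r.
(* the last term of the shifted sum carries y^N *)
rewrite big_ord_recr mulrDr /= [y * (_ * _)]mulrCA -exprS yk mulr0 addr0.
by rewrite big_distrr; apply: eq_bigr => i _; rewrite fpsXM /= mulrCA -exprS.
Qed.

Lemma nilevalXn k f : nileval (fpsX A ^+ k * f) = y ^+ k * nileval f.
Proof. by elim: k => [|k IHk]; rewrite ?mul1r // !exprS -!mulrA nilevalX IHk. Qed.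

Lemma nileval1 : nileval 1 = 1.
Proof.
rewrite /nileval; case: N yN => [|k] yk; first by rewrite big_ord0 -yk.
rewrite big_ord_recl rmorph1 mulr1 big1 ?addr0 // => i _.
by rewrite -[X in phi X]/(0 : A) rmorph0 mul0r.
Qed.

(** Modulo y^N = 0 the series f may be replaced by its truncation, for which
    multiplicativity follows from the cases of a constant and of
    the variable. *)
Lemma nileval_monoid : monoid_morphism nileval.
Proof.
split=> [|f g]; first exact: nileval1.
have evD : {morph nileval : u v / u + v}.
  move=> u v; rewrite -[v in LHS]opprK nileval_zmod -[- v]sub0r nileval_zmod.
  by rewrite -(subrr v) nileval_zmod subrr sub0r opprK.
have evS := big_morph nileval evD (_ : nileval 0 = 0).
rewrite {1}(fps_trunc N f) mulrDl evD -mulrA nilevalXn yN mul0r addr0.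
rewrite big_distrl evS; last by rewrite -(subrr 0) nileval_zmod subrr.
rewrite {2}/nileval big_distrl; apply: eq_bigr => i _ /=.
by rewrite -mulrA nilevalC nilevalXn mulrA.
Qed.

Definition nilevalM : {rmorphism fps A -> D} := rmorph_of nileval_zmod nileval_monoid.

End NilEval.

(** Induction on n: the outermost variable x_n is exchanged with t, which then
    belongs to the coefficients, and is evaluated by [nilevalM]. *)
Lemma xt_eval_exists (V D : comPzRingType) (th : {rmorphism fps V -> D}) n
    (y : 'I_n -> D) N : (forall i, y i ^+ N = 0) ->
  exists E : {rmorphism fps (mps V n) -> D},
    (forall f, E (xt_C V n f) = th f) /\ forall i, E (xt_X V i) = y i.
Proof.
elim: n y => [|n IHn] y yN; first by exists th; split=> // -[].
have [E [EC EX]] := IHn (fun i => y (lift ord_max i)) (fun i => yN _).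
pose ev := nilevalM E (yN ord_max).
have evC a : ev (fpsC a) = E a.
  by rewrite -[LHS]/(nileval _ _ _ _) -(mulr1 (fpsC a)) nilevalC nileval1 ?mulr1.
exists (ev \o @fps_swapM (mps V n)); split=> [f|i].
  rewrite -EC -evC; congr (ev _); apply: funext => i; apply: funext => j.
  by case: i.
case: (unliftP ord_max i) => [j ->|->].
  rewrite -EX -evC; congr (ev _); apply: funext => k; apply: funext => l.
  rewrite -[LHS]/(xt_X V (lift ord_max j) l k) /xt_X mpsX_lift.
  by case: k l => [|k] [|l].
have -> : y ord_max = ev (fpsX _).
  by rewrite -[RHS]/(nileval _ _ _ _) -(mulr1 (fpsX _)) nilevalX // nileval1 ?mulr1.
congr (ev _); apply: funext => k; apply: funext => l.
rewrite -[LHS]/(xt_X V ord_max l k) /xt_X mpsX_max.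
by case: l k => [|l] [|[|k]].
Qed.

(** * Forms *)

Section Form.
Variables (V : comPzRingType) (n : nat) (T : comPzRingType).
Variables (kap : {rmorphism fps V -> T}) (r : 'I_n -> T).

(** The forms of degree d in x with coefficients in V[[t]], each with its value
    at r in T. The two are defined
    simultaneously, which avoids coefficients indexed by monomials. *)
Inductive xform : nat -> fps (mps V n) -> T -> Prop :=
| xform_C f : xform 0 (xt_C V n f) (kap f)
| xform_X d i F rho : xform d F rho -> xform d.+1 (xt_X V i * F) (r i * rho)
| xform_0 d : xform d 0 0
| xform_D d F G rho sig : xform d F rho -> xform d G sig -> xform d (F + G) (rho + sig).

Lemma xform_sum d (F : 'I_n -> fps (mps V n)) (rho : 'I_n -> T) :
  (forall i, xform d (F i) (rho i)) -> xform d (\sum_i F i) (\sum_i rho i).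
Proof.
by move=> FF; elim/big_ind2: _ => // *; [apply: xform_0|apply: xform_D].
Qed.

Lemma xform_Z d e F rho f : e = d -> xform d F rho -> xform e (xt_C V n f * F) (kap f * rho).
Proof.
move=> -> {e}; elim=> {d F rho} [g|d i F rho _ IH|d|d F G rho sig _ IHF _ IHG].
- by rewrite -!rmorphM; apply: xform_C.
- by rewrite mulrCA [kap f * _]mulrCA; apply: xform_X.
- by rewrite !mulr0; apply: xform_0.
- by rewrite !mulrDr; apply: xform_D.
Qed.

Lemma xform_M d e F G rho sig : xform d F rho -> xform e G sig ->
  xform (d + e) (F * G) (rho * sig).
Proof.
move=> FF FG; elim: FF => {d F rho} [f|d i F rho _ IH|d|d F F' rho rho' _ IHF _ IHG].
- exact: xform_Z.
- by rewrite -!mulrA; apply: xform_X.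
- by rewrite !mul0r; apply: xform_0.
- by rewrite !mulrDl; apply: xform_D.
Qed.

Lemma xform_xt_x d F rho : xform d F rho -> ideal_pow (xt_x V n) d F.
Proof.
elim=> {d F rho} [f|d i F rho _ IH|d|d F F' rho rho' _ IHF _ IHG].
- by [].
- by apply: ideal_powSM => //; apply: xt_x_X.
- exact: ideal0.
- exact: idealD.
Qed.

Lemma xform_approx d F : ideal_pow (xt_x V n) d F ->
  exists F' rho, xform d F' rho /\ ideal_pow (xt_x V n) d.+1 (F - F').
Proof.
have approx0 G : exists G' rho, xform 0 G' rho /\ xt_x V n (G - G').
  have [f [H GE]] := xt_split G; exists (xt_C V n f), (kap f).
  split; first exact: xform_C.
  rewrite GE addrC addrA addNr add0r; apply: ideal_big => i _.
  exact (@ideal_mulr _ (xt_x V n) (H i) (xt_X V i) (xt_x_X V i)).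
have approx1 G : xt_x V n G ->
    exists G' rho, xform 1 G' rho /\ ideal_pow (xt_x V n) 2 (G - G').
  move=> /xt_x_split[H ->].
  have /choice[H' /choice[rho HP]] i := approx0 (H i).
  exists (\sum_i xt_X V i * H' i), (\sum_i r i * rho i); split.
    by apply: xform_sum => i; apply: xform_X; have [] := HP i.
  rewrite -sumrB; apply: ideal_big => i _; rewrite -mulrBr.
  apply: ideal_powSM; first exact: xt_x_X.
  by apply/ideal_pow1; have [] := HP i.
elim: d F => [|d IHd] F.
  by move=> _; have [F' [rho [FF FI]]] := approx0 F; exists F', rho; split=> //; apply/ideal_pow1.
move: F; apply: ideal_pow_ind => [|F G [F' [rho [FF FI]]] [G' [sig [FG GI]]]|F G].
- by exists 0, 0; rewrite subrr; split; [apply: xform_0|apply: ideal0].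
- exists (F' + G'), (rho + sig); split; first exact: xform_D.
  by rewrite opprD addrACA; apply: idealD.
move=> IF IG; have [F' [rho [FF FI]]] := approx1 F IF; have [G' [sig [FG GI]]] := IHd G IG.
exists (F' * G'), (rho * sig); split; first exact: (xform_M FF).
have -> : F * G - F' * G' = (F - F') * G + F' * (G - G') by ring.
apply: idealD; first exact: (@ideal_powM _ _ 2 d).
by apply: ideal_powSM => //; apply/ideal_pow1; apply: xform_xt_x FF.
Qed.

(** Modulo (x)^N every series is a finite sum of forms. *)
Lemma xform_ind_mod (P : fps (mps V n) -> Prop) N :
  (forall F, ideal_pow (xt_x V n) N F -> P F) ->
  (forall d F rho G, xform d F rho -> P G -> P (F + G)) ->
  forall F, P F.
Proof.
move=> PN PF.
have H k : (k <= N)%N -> forall F, ideal_pow (xt_x V n) (N - k) F -> P F.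
  elim: k => [|k IHk] lek F; first by rewrite subn0; apply: PN.
  move=> /xform_approx[F' [rho [FF FI]]]; rewrite -(subrK F' F) addrC.
  apply: PF FF _; apply: IHk; first exact: ltnW.
  by rewrite subnSK in FI.
by move=> F; apply: (H N) => //; rewrite subnn.
Qed.

Lemma xform_morph (E : {rmorphism fps (mps V n) -> T}) :
  (forall f, E (xt_C V n f) = kap f) -> (forall i, E (xt_X V i) = r i) ->
  forall d F rho, xform d F rho -> E F = rho.
Proof.
move=> EC EX d F rho; elim=> {d F rho} [f|d i F rho _ IH|d|d F F' rho rho' _ IHF _ IHG].
- exact: EC.
- by rewrite rmorphM EX IH.
- exact: rmorph0.
- by rewrite rmorphD IHF IHG.
Qed.

End Form.

(** Both maps factor through the quotient by (x)^N, where polynomials in x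
    over V[[t]] exhaust everything. *)
Lemma xt_eval_unique (V D : comPzRingType) n N (E E' : {rmorphism fps (mps V n) -> D}) :
  (forall F, ideal_pow (xt_x V n) N F -> E F = 0) ->
  (forall F, ideal_pow (xt_x V n) N F -> E' F = 0) ->
  (forall f, E (xt_C V n f) = E' (xt_C V n f)) ->
  (forall i, E (xt_X V i) = E' (xt_X V i)) -> E =1 E'.
Proof.
move=> EN EN' EC EX.
pose kap : {rmorphism fps V -> D} := E' \o xt_C V n.
apply: (@xform_ind_mod _ _ _ kap (fun i => E' (xt_X V i)) _ N) => [F IF|d F rho G FF EG].
  by rewrite EN ?EN'.
rewrite !rmorphD EG; congr (_ + _).
by rewrite (xform_morph _ _ FF) ?(xform_morph _ _ FF).
Qed.

(** * Localization and tensor products *)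

Section LocLift.
Variables (A D : comPzRingType) (s : A) (f : {rmorphism A -> D}) (si : D).
Hypothesis fs : f s * si = 1.

Definition loc_fun (u : localization s) : D := f (repr u).1 * si ^+ (repr u).2.

Let fsX k : f s ^+ k * si ^+ k = 1. Proof. by rewrite -exprMn fs expr1n. Qed.

(** Independence of the representative: the denominators are cleared by powers of
    f(s), which are invertible. *)
Lemma loc_funE (a : A) k : loc_fun (@qcls (loc_pres s) (a, k)) = f a * si ^+ k.
Proof.
rewrite /loc_fun; set u := repr _.
have /qclsP[j /=] : @qcls (loc_pres s) u = qcls ((a, k) : loc_pres s) by apply: qcls_repr.
move=> /(congr1 f); rewrite !rmorphM !rmorphXn => e.
transitivity (si ^+ j * si ^+ k * si ^+ u.2 * (f s ^+ j * (f s ^+ k * f u.1))).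
  transitivity ((f s ^+ j * si ^+ j) * (f s ^+ k * si ^+ k) * (f u.1 * si ^+ u.2)).
    by rewrite !fsX !mul1r.
  by ring.
rewrite e.
transitivity ((f s ^+ j * si ^+ j) * (f s ^+ u.2 * si ^+ u.2) * (f a * si ^+ k)).
  by ring.
by rewrite !fsX !mul1r.
Qed.

Lemma loc_ind (P : localization s -> Prop) :
  (forall a k, P (@qcls (loc_pres s) (a, k))) -> forall u, P u.
Proof. by move=> Pq; apply: qcls_ind => -[a k]. Qed.

Lemma loc_fun_zmod : zmod_morphism loc_fun.
Proof.
elim/loc_ind=> a j; elim/loc_ind=> b k.
transitivity (loc_fun (@qcls (loc_pres s) (s ^+ k * a + s ^+ j * (- b), (j + k)%N))).
  apply: (congr1 loc_fun); rewrite -[- _](qclsN (P := loc_pres s)).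
  by rewrite -[LHS](qclsD (P := loc_pres s)).
rewrite !loc_funE rmorphD !rmorphM !rmorphXn rmorphN exprD.
transitivity ((f s ^+ k * si ^+ k) * (f a * si ^+ j) - (f s ^+ j * si ^+ j) * (f b * si ^+ k)).
  by ring.
by rewrite !fsX !mul1r.
Qed.

Lemma loc_fun_monoid : monoid_morphism loc_fun.
Proof.
split; first by rewrite -[1]/(@qcls (loc_pres s) (1, 0%N)) loc_funE rmorph1 mulr1.
elim/loc_ind=> a j; elim/loc_ind=> b k.
transitivity (loc_fun (@qcls (loc_pres s) (a * b, (j + k)%N))).
  by apply: (congr1 loc_fun); rewrite -[LHS](qclsM (P := loc_pres s)).
by rewrite !loc_funE rmorphM exprD; ring.
Qed.

Definition loc_lift : {rmorphism localization s -> D} :=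
  rmorph_of loc_fun_zmod loc_fun_monoid.

Lemma loc_lift_map a : loc_lift (loc_map s a) = f a.
Proof. by rewrite -[LHS]/(loc_fun _) loc_funE mulr1. Qed.

End LocLift.

Section LocTheory.
Variables (A : comPzRingType) (s : A).

Definition loc_inv : localization s := @qcls (loc_pres s) (1, 1%N).

Lemma loc_map_inv : loc_map s s * loc_inv = 1.
Proof.
rewrite -[_ * _](qclsM (P := loc_pres s)); apply/qclsP; exists 0%N => /=; ring.
Qed.

Lemma loc_repr u : exists a k, u = loc_map s a * loc_inv ^+ k.
Proof.
elim/loc_ind: u => a k; exists a, k.
have -> : loc_inv ^+ k = @qcls (loc_pres s) (1, k).
  elim: k => [//|k IHk]; rewrite exprS IHk -[_ * _](qclsM (P := loc_pres s)) /=.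
  by rewrite mulr1.
rewrite -[_ * _](qclsM (P := loc_pres s)); apply/qclsP; exists 0%N => /=; ring.
Qed.

End LocTheory.

(** Because t is not a zero divisor in A[[t]]. *)
Lemma laurent_map_inj (A : comPzRingType) (f g : fps A) :
  loc_map (fpsX A) f = loc_map (fpsX A) g -> f = g.
Proof.
move=> /qclsP[k /=]; rewrite !mul1r => /eqP; rewrite -subr_eq0 -mulrBr => /eqP.
by move=> /fpsXn_inj/eqP; rewrite subr_eq0 => /eqP.
Qed.

Section TensorLift.
Variables (A B C D : comPzRingType).
Variables (f : {rmorphism A -> B}) (g : {rmorphism A -> C}).
Variables (bet : {rmorphism B -> D}) (gam : {rmorphism C -> D}).
Hypothesis fg : forall a, bet (f a) = gam (g a).

Definition tensor_val (s : seq (B * C)) : D := \sum_(p <- s) bet p.1 * gam p.2.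

Lemma tensor_val_eq s s' : tensor_eq f g s s' -> tensor_val s = tensor_val s'.
Proof.
rewrite /tensor_val; elim=> {s s'} [s s' ss|//|? ? ? _ -> _ ->|s s' u _ e|c|b b' c|b c c'|a b c] //.
- exact: perm_big.
- by rewrite !big_cat e.
- by rewrite big_seq1 big_nil rmorph0 mul0r.
- by rewrite !big_cons !big_nil /= rmorphD; ring.
- by rewrite !big_cons !big_nil /= rmorphD; ring.
- by rewrite !big_seq1 /= !rmorphM fg; ring.
Qed.

Definition tensor_fun (u : tensor f g) : D := tensor_val (repr u).

Lemma tensor_funE s : tensor_fun (@qcls (tensor_pres f g) s) = tensor_val s.
Proof. by apply: tensor_val_eq; apply/(qclsP (P := tensor_pres f g)); apply: qcls_repr. Qed.

Lemma tensor_fun_zmod : zmod_morphism tensor_fun.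
Proof.
elim/qcls_ind=> s; elim/qcls_ind=> s'.
rewrite -[- _](qclsN (P := tensor_pres f g)) -[_ + _](qclsD (P := tensor_pres f g)).
rewrite !tensor_funE /tensor_val big_cat big_map /= -sumrN; congr (_ + _).
by apply: eq_bigr => p _; rewrite rmorphN mulNr.
Qed.

Lemma tensor_fun_monoid : monoid_morphism tensor_fun.
Proof.
split.
  rewrite -[1]/(@qcls (tensor_pres f g) [:: (1, 1)]) tensor_funE /tensor_val big_seq1.
  by rewrite !rmorph1 mulr1.
elim/qcls_ind=> s; elim/qcls_ind=> s'.
rewrite -[_ * _](qclsM (P := tensor_pres f g)) !tensor_funE /tensor_val.
rewrite big_allpairs_dep big_distrl; apply: eq_bigr => p _.
by rewrite big_distrr; apply: eq_bigr => q _ /=; rewrite !rmorphM; ring.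
Qed.

Definition tensor_lift : {rmorphism tensor f g -> D} :=
  rmorph_of tensor_fun_zmod tensor_fun_monoid.

Lemma tensor_lift_inl b : tensor_lift (tensor_inl f g b) = bet b.
Proof.
by rewrite -[LHS]/(tensor_fun _) tensor_funE /tensor_val big_seq1 rmorph1 mulr1.
Qed.

Lemma tensor_lift_inr c : tensor_lift (tensor_inr f g c) = gam c.
Proof.
by rewrite -[LHS]/(tensor_fun _) tensor_funE /tensor_val big_seq1 rmorph1 mul1r.
Qed.

End TensorLift.

Section TensorTheory.
Variables (A B C : comPzRingType).
Variables (f : {rmorphism A -> B}) (g : {rmorphism A -> C}).

Lemma tensor_bal_eq a : tensor_inl f g (f a) = tensor_inr f g (g a).
Proof.
apply/(qclsP (P := tensor_pres f g)); have := tensor_bal f g a 1 1.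
by rewrite !mulr1.
Qed.

Lemma tensor_inr_zmod : zmod_morphism (tensor_inr f g).
Proof.
have inrD x y : tensor_inr f g (x + y) = tensor_inr f g x + tensor_inr f g y.
  rewrite -[RHS](qclsD (P := tensor_pres f g)); apply/(qclsP (P := tensor_pres f g)).
  exact: tensor_Dr.
by move=> x y; apply/eqP; rewrite -(inj_eq (addIr (tensor_inr f g y))) -inrD !subrK.
Qed.

Lemma tensor_inr_monoid : monoid_morphism (tensor_inr f g).
Proof.
split=> // x y; rewrite -[RHS](qclsM (P := tensor_pres f g)).
by rewrite /= /tensor_mul /= mulr1.
Qed.

Definition tensor_inrM : {rmorphism C -> tensor f g} :=
  rmorph_of tensor_inr_zmod tensor_inr_monoid.

Lemma tensor_repr u : exists s : seq (B * C),
  u = \sum_(p <- s) tensor_inl f g p.1 * tensor_inr f g p.2.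
Proof.
elim/qcls_ind: u => s; exists s; elim: s => [|[b c] s IHs]; first by rewrite big_nil.
rewrite big_cons -IHs -[_ * _](qclsM (P := tensor_pres f g)).
rewrite -[RHS](qclsD (P := tensor_pres f g)) /= /tensor_mul /=.
by rewrite mulr1 mul1r.
Qed.

End TensorTheory.

(** * The evaluation x_i |-> r_i / t *)

Section Evaluation.
Variables (R : comPzRingType) (m : ideal R) (V : comPzRingType).
Variables (iota : {rmorphism V -> R}) (n : nat) (r : 'I_n -> R).
Hypothesis r_gen : forall x, m x <-> exists c : 'I_n -> R, x = \sum_i c i * r i.
Hypothesis iota_surj : forall x, exists v, m (x - iota v).

Local Notation A := (fps (mps V n)).
Local Notation T := (fpsX (mps V n)).

Lemma mem_r i : m (r i).
Proof.
apply/r_gen; exists (fun j => (j == i)%:R).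
by rewrite (bigD1 i) //= eqxx mul1r big1 ?addr0 // => j /negPf ->; rewrite mul0r.
Qed.

Lemma fps_mapX (B C : comPzRingType) (f : {rmorphism B -> C}) : fps_map f (fpsX B) = fpsX C.
Proof. by apply: funext => i; apply: rmorph_nat. Qed.

Lemma fps_mapC (B C : comPzRingType) (f : {rmorphism B -> C}) b :
  fps_map f (fpsC b) = fpsC (f b).
Proof. by apply: funext => -[|i]; rewrite //; apply: rmorph0. Qed.

Lemma xt_C_X : xt_C V n (fpsX V) = T. Proof. exact: fps_mapX. Qed.
Lemma xt_C_C v : xt_C V n (fpsC v) = fpsC (mpsC V n v). Proof. exact: fps_mapC. Qed.

(** The ring (R/m^N)((t)); [tL] and [tinvL] are t and its inverse, [serL] and
    [constL] the maps from R[[t]] and from R, and [mL] the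
    extension of m. *)
Definition resL N : comPzRingType := laurent (quot (ideal_pow m N)).
Definition tL N : resL N := loc_map (fpsX _) (fpsX _).
Definition tinvL N : resL N := loc_inv (fpsX _).

Definition serL N : {rmorphism fps R -> resL N} :=
  @loc_map _ (fpsX (quot (ideal_pow m N))) \o fps_map (quot_proj (ideal_pow m N)).

Lemma tL_inv N : tL N * tinvL N = 1. Proof. exact: loc_map_inv. Qed.

Lemma tLXK N d x : tL N ^+ d * (tinvL N ^+ d * x) = x.
Proof. by rewrite mulrA -exprMn tL_inv expr1n mul1r. Qed.

Lemma serLX N : serL N (fpsX R) = tL N.
Proof. by rewrite /serL /= fps_mapX. Qed.

Lemma serL0P N f : serL N f = 0 <-> forall j, ideal_pow m N (f j).
Proof.
split=> [|fm].
  rewrite -(rmorph0 (serL N)) => /laurent_map_inj e j.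
  by apply/quot_proj0P; rewrite -[LHS]/(fps_map (quot_proj _) f j) e; apply: rmorph0.
rewrite /serL /= (_ : fps_map _ f = 0) ?rmorph0 //.
by apply: funext => j; apply/quot_proj0P.
Qed.

Definition constL N : {rmorphism R -> resL N} := serL N \o @fpsC R.

Lemma constL0P N x : constL N x = 0 <-> ideal_pow m N x.
Proof.
split=> [/serL0P/(_ 0%N)//|mx]; apply/serL0P => -[|j] //; exact: ideal0.
Qed.

Definition mL N : ideal (resL N) := ideal_ext (constL N) m.

Lemma mL_pow N u : ideal_pow (mL N) N u -> u = 0.
Proof. by apply: ideal_ext_ker_pow => x /constL0P. Qed.

(** The element r_i / t, nilpotent because r_i lies in m. *)
Definition evalL N (i : 'I_n) : resL N := constL N (r i) * tinvL N.

Lemma evalL_m N i : mL N (evalL N i).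
Proof. by apply: ideal_mulr; apply/mem_ideal_ext/mem_r. Qed.

Lemma evalL_nil N i : evalL N i ^+ N = 0.
Proof. by apply: mL_pow; apply: ideal_powX; apply: evalL_m. Qed.

Lemma phi_exists N : exists E : {rmorphism A -> resL N},
  (forall f, E (xt_C V n f) = serL N (fps_map iota f)) /\
  forall i, E (xt_X V i) = evalL N i.
Proof. exact: (xt_eval_exists (serL N \o fps_map iota) (evalL_nil N)). Qed.

(** The homomorphism V[[x]][[t]] -> (R/m^N)((t)) with x_i |-> r_i / t, t |-> t. *)
Definition phi N : {rmorphism A -> resL N} := sval (cid (phi_exists N)).

Lemma phiC N f : phi N (xt_C V n f) = serL N (fps_map iota f).
Proof. by rewrite /phi; case: cid => E []. Qed.

Lemma phiX N i : phi N (xt_X V i) = evalL N i.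
Proof. by rewrite /phi; case: cid => E []. Qed.

Lemma phiT N : phi N T = tL N.
Proof. by rewrite -xt_C_X phiC fps_mapX serLX. Qed.

Lemma phi_x N F : xt_x V n F -> mL N (phi N F).
Proof.
move=> /xt_x_split[G ->]; rewrite rmorph_sum; apply: ideal_big => i _.
by rewrite rmorphM phiX; apply/ideal_mulr/evalL_m.
Qed.

Lemma phi_x_pow N F : ideal_pow (xt_x V n) N F -> phi N F = 0.
Proof. by move=> IF; apply/mL_pow/(ideal_pow_morph _ IF)/phi_x. Qed.

(** The kernel of the evaluation into completed Laurent series over R,
    as the intersection of the kernels modulo the powers of m. *)
Definition homJ : ideal A.
Proof.
exists (fun F => forall N, phi N F = 0) => [N|F G F0 G0 N|F G G0 N].
- exact: rmorph0.
- by rewrite rmorphD F0 G0 addr0.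
- by rewrite rmorphM G0 mulr0.
Defined.

Lemma homJ_T F : homJ (T * F) -> homJ F.
Proof.
move=> JF N; rewrite -[LHS](tLXK 1) !expr1 mulrCA -phiT -rmorphM JF mulr0 //.
Qed.

Local Notation xform := (xform (fps_map iota : {rmorphism fps V -> fps R}) (fun i => fpsC (r i))).

(** A form of degree d takes at r / t the value t^-d times its value at r. *)
Lemma xform_phi N d F rho : xform d F rho -> tL N ^+ d * phi N F = serL N rho.
Proof.
elim=> {d F rho} [f|d i F rho _ IH|d|d F F' rho rho' _ IHF _ IHG].
- by rewrite mul1r phiC.
- rewrite !rmorphM phiX -IH -[serL N (fpsC _)]/(constL N (r i)) exprS /evalL.
  transitivity ((tL N * tinvL N) * (constL N (r i) * (tL N ^+ d * phi N F))); first by ring.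
  by rewrite tL_inv mul1r.
- by rewrite !rmorph0 mulr0.
- by rewrite !rmorphD mulrDr IHF IHG.
Qed.

Lemma xform_m d F rho : xform d F rho -> forall j, ideal_pow m d (rho j).
Proof.
elim=> {d F rho} [f|d i F rho _ IH|d|d F F' rho rho' _ IHF _ IHG] j.
- by [].
- by rewrite fpsCM; apply: ideal_powSM => //; apply: mem_r.
- exact: ideal0.
- exact: idealD.
Qed.

(** Separation of the part of a form that is constant in t. *)
Lemma xform_split d F rho : xform d F rho -> exists h G,
  [/\ xform d (fpsC h) (fpsC (rho 0%N)), F = fpsC h + T * G
    & ideal_pow (xt_x V n) d G].
Proof.
elim=> {d F rho} [f|d i F rho _ [h [G [Fh -> IG]]]|d|
    d F F' rho rho' _ [h [G [Fh -> IG]]] _ [h' [G' [Fh' -> IG']]]].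
- exists (mpsC V n (f 0%N)), (xt_C V n (fun j => f j.+1)).
  split=> //; first by rewrite -xt_C_C -fps_mapC; apply: xform_C.
  by rewrite -xt_C_C -xt_C_X -rmorphM -rmorphD -fps_split.
- exists (mpsX V i * h), (xt_X V i * G).
  split; first by rewrite fpsCM !rmorphM; apply: xform_X.
  + by rewrite mulrDr mulrCA rmorphM.
  + by apply: ideal_powSM => //; apply: xt_x_X.
- exists 0, 0; split=> //; last exact: ideal0.
    by rewrite !rmorph0; apply: xform_0.
  by rewrite rmorph0 mulr0 addr0.
- exists (h + h'), (G + G'); split=> //.
  + by rewrite fpsDE !rmorphD; apply: xform_D.
  + by rewrite mulrDr rmorphD addrACA.
  + exact: idealD.
Qed.

(** The products of d generators r_i span m^d over V modulo m^(d+1), because V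
    maps onto the residue field. *)
Lemma xform_const d x : ideal_pow m d x -> exists h y,
  xform d (fpsC h) (fpsC y) /\ ideal_pow m d.+1 (x - y).
Proof.
elim: d x => [|d IHd] x.
  move=> _; have [v mv] := iota_surj x; exists (mpsC V n v), (iota v).
  by split; [rewrite -xt_C_C -fps_mapC; apply: xform_C|apply/ideal_pow1].
move: x; apply: ideal_pow_ind => [|x x' [h [y [Fh my]]] [h' [y' [Fh' my']]]|a b].
- exists 0, 0; rewrite subrr !rmorph0; split; [exact: xform_0|exact: ideal0].
- exists (h + h'), (y + y'); rewrite !rmorphD opprD addrACA.
  by split; [apply: xform_D|apply: idealD].
move=> /r_gen[c ->] mb.
have /choice[h /choice[y hy]] i := IHd (c i * b) (idealMl _ mb).
exists (\sum_i mpsX V i * h i), (\sum_i r i * y i); split.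
  rewrite !rmorph_sum; apply: xform_sum => i; rewrite !rmorphM; apply: xform_X.
  by have [] := hy i.
rewrite mulr_suml -sumrB; apply: ideal_big => i _.
have -> : c i * r i * b - r i * y i = r i * (c i * b - y i) by ring.
apply: ideal_powSM; first exact: mem_r.
by have [] := hy i.
Qed.

Lemma fpsC_x_pow N h : ideal_pow (xt_x V n) N (fpsC h) <-> ideal_pow (mps_x V n) N h.
Proof.
rewrite -xt_x_pow; split=> [/(_ 0%N)//|Ih [|j]] //; exact: ideal0.
Qed.

(** Expand x as a sum of h_d(r), d >= N, by repeated use of [xform_const], and take
    the series with coefficients h_d in t: each phi_M sends h_d t^d to h_d(r), and
    kills the terms with d >= M. *)
Lemma homJ_lift N x : ideal_pow m N x ->
  exists2 G, ideal_pow (xt_x V n) N G &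
    forall M, phi M (T ^+ N * G) = constL M x.
Proof.
move=> mx.
have [||z [z0 zm zS]] := @dependent_choice _ (fun d y => ideal_pow m (N + d) y)
    (fun d y y' => exists h, xform (N + d) (fpsC h) (fpsC (y - y'))) x.
- by rewrite addn0.
- move=> d y my; have [h [y' [Fh my']]] := xform_const my.
  by exists (y - y'); [rewrite addnS|exists h; rewrite opprB addrC subrK].
have /choice[h hz] d := zS d.
have hI d : ideal_pow (mps_x V n) (N + d) (h d).
  by apply/fpsC_x_pow; apply: xform_xt_x (hz d).
exists (h : A); first by apply/xt_x_pow => d; apply: ideal_pow_leq (hI d); apply: leq_addr.
move=> M.
have hM : phi M (T ^+ M * (fun i => h (M + i)%N : mps V n)) = 0.
  rewrite rmorphM [X in _ * X]phi_x_pow ?mulr0 // -xt_x_pow => d.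
  by apply: ideal_pow_leq (hI _); rewrite addnCA leq_addr.
have -> : T ^+ N * h = \sum_(d < M) T ^+ (N + d) * fpsC (h d)
    + T ^+ N * (T ^+ M * (fun i => h (M + i)%N : mps V n)).
  rewrite {1}(fps_trunc M (h : A)) mulrDr big_distrr; congr (_ + _).
  by apply: eq_bigr => d _; rewrite exprD /=; ring.
rewrite rmorphD [X in _ + X]rmorphM hM mulr0 addr0 rmorph_sum.
transitivity (\sum_(d < M) constL M (z d - z d.+1)).
  apply: eq_bigr => d _; rewrite rmorphM rmorphXn phiT.
  exact: xform_phi (hz d).
rewrite -rmorph_sum -[RHS]subr0 -[X in _ - X](_ : constL M (z M) = 0); last first.
  by apply/constL0P; apply: ideal_pow_leq (zm M); apply: leq_addl.
rewrite -rmorphB; congr (constL M _); rewrite -z0.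
rewrite -(big_mkord xpredT (fun d => z d - z d.+1)) -[z 0%N - _]opprB.
by rewrite -(telescope_sumr z) // -sumrN; apply: eq_bigr => d _; rewrite opprB.
Qed.
(** Only the forms of degree at most M survive modulo m^(M+1), and a
    form of degree d contributes a pole of order at most d. *)
Lemma phi_pole M F : exists s, tL M.+1 ^+ M * phi M.+1 F = serL M.+1 s.
Proof.
pose P F := exists s, tL M.+1 ^+ M * phi M.+1 F = serL M.+1 s.
have Px G : ideal_pow (xt_x V n) M.+1 G -> P G.
  by move=> /phi_x_pow PG; exists 0; rewrite PG mulr0 rmorph0.
apply: (@xform_ind_mod _ _ _ (fps_map iota : {rmorphism fps V -> fps R})
  (fun i => fpsC (r i)) P M.+1 Px) => d G rho H FG [s sE].
suff [s' sE'] : P G by exists (s' + s); rewrite !rmorphD mulrDr sE sE'.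
have [led|ltd] := leqP d M; last by apply: Px; apply: ideal_pow_leq (xform_xt_x FG).
exists (fpsX R ^+ (M - d) * rho); rewrite rmorphM rmorphXn serLX -(xform_phi _ FG).
by rewrite mulrA -exprD subnK.
Qed.

(** The lifts of [homJ_lift] are unique modulo J, hence define a ring
    homomorphism. *)
Lemma homJ_lift_ring : exists2 sig : {rmorphism R -> quot homJ},
  forall x F, (forall M, phi M F = constL M x) -> sig x = quot_proj homJ F &
  forall N x, ideal_pow m N x -> exists2 G, ideal_pow (xt_x V n) N G &
    sig x = quot_proj homJ (T ^+ N * G).
Proof.
have /choice[F FP] x : exists F, forall M, phi M F = constL M x.
  by have [G _ GP] := @homJ_lift 0 x Logic.I; exists (T ^+ 0 * G).
pose s x := quot_proj homJ (F x).
have sE x G : (forall M, phi M G = constL M x) -> s x = quot_proj homJ G.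
  by move=> GP; apply/quot_projP => M; rewrite rmorphB FP GP subrr.
have sB : zmod_morphism s.
  move=> x y; rewrite /s -rmorphB; apply: sE => M.
  by rewrite !rmorphB !FP.
have sM : monoid_morphism s.
  split=> [|x y].
    by rewrite -(rmorph1 (quot_proj homJ)); apply: sE => M; rewrite !rmorph1.
  by rewrite /s -rmorphM; apply: sE => M; rewrite !rmorphM !FP.
exists (rmorph_of sB sM) => [|N x mx]; first exact: sE.
by have [G IG GP] := homJ_lift mx; exists G => //; apply: sE.
Qed.

End Evaluation.

(** * The quotient is a complete local ring *)

(** The sum of the geometric series. *)
Lemma one_sub_unit (A : comPzRingType) (I : ideal A) x :
  cauchy_complete I -> (forall y, (forall N, ideal_pow I N y) -> y = 0) ->
  I x -> exists y, (1 - x) * y = 1.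
Proof.
move=> cI sI Ix; have [y yP] := cI (fun d => x ^+ d) (fun d => ideal_powX d Ix).
exists y; apply/eqP; rewrite -subr_eq0; apply/eqP/sI => N.
apply: (@ideal_sub_trans _ _ ((1 - x) * \sum_(d < N) x ^+ d)).
  by rewrite -mulrBr; apply/idealMl/yP.
have -> : (1 - x) * (\sum_(d < N) x ^+ d) - 1 = - x ^+ N.
  elim: N => [|N IHN]; first by rewrite big_ord0 mulr0 sub0r.
  rewrite big_ord_recr /= mulrDr addrAC IHN exprS; ring.
exact/idealN/ideal_powX.
Qed.

Lemma is_local_units (A : comPzRingType) (I : ideal A) : ~ I 1 ->
  (forall x, ~ I x -> exists y, x * y = 1) -> is_local I.
Proof.
move=> I1 Iu.
have sub (J : ideal A) : ~ J 1 -> forall x, J x -> I x.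
  move=> J1 x Jx; apply: contrapT => /Iu[y xy]; apply: J1.
  by rewrite -xy; apply: ideal_mulr.
split=> [|J [J1 Jmax] x]; first by split=> // J _; apply: sub.
by split=> [|Ix]; [apply: sub|apply: Jmax Ix => //; apply: sub].
Qed.

(** By maximality 1 lies in the ideal generated by I and x. *)
Lemma maximal_inv (A : comPzRingType) (I : ideal A) x :
  is_maximal I -> ~ I x -> exists y, I (1 - y * x).
Proof.
move=> [I1 Imax] nIx.
pose P z := exists y, I (z - y * x).
have P0 : P 0 by exists 0; rewrite mul0r subrr; apply: ideal0.
have PD y z : P y -> P z -> P (y + z).
  move=> [a Ia] [b Ib]; exists (a + b); rewrite mulrDl opprD addrACA; exact: idealD.
have PM a z : P z -> P (a * z).
  by move=> [b Ib]; exists (a * b); rewrite -mulrA -mulrBr; apply: idealMl.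
apply: contrapT => nP1; apply/nIx/(Imax (Ideal P0 PD PM)) => //=.
  by move=> y Iy; exists 0; rewrite mul0r subr0.
by exists 1; rewrite mul1r subrr; apply: ideal0.
Qed.

Section HomLocal.
Variables (R : comPzRingType) (m : ideal R) (V : comPzRingType).
Variables (iota : {rmorphism V -> R}) (n : nat) (r : 'I_n -> R).
Hypothesis r_gen : forall x, m x <-> exists c : 'I_n -> R, x = \sum_i c i * r i.
Hypothesis iota_surj : forall x, exists v, m (x - iota v).

Definition coef_ideal : ideal V := preim_ideal iota m.

Hypothesis V_noetherian : is_noetherian V.
Hypothesis V_cauchy : cauchy_complete coef_ideal.
Hypothesis V_separated : forall v, (forall N, ideal_pow coef_ideal N v) -> v = 0.
Hypothesis m_maximal : is_maximal m.

Local Notation A := (fps (mps V n)).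
Local Notation T := (fpsX (mps V n)).
Local Notation Q := (mps_ideal coef_ideal n).
Local Notation J := (homJ iota r_gen).
Local Notation phi := (phi iota r_gen).

Definition xt_max : ideal A := fps_ideal Q.

Lemma phi_Q N h : Q h -> mL m N (phi N (fpsC h)).
Proof.
move=> /mps_idealP Qh; have [g hE] := mps_split h.
pose E : {rmorphism mps V n -> resL m N} := phi N \o @fpsC (mps V n).
have EC v : E (mpsC V n v) = constL m N (iota v).
  by rewrite -[LHS]/(phi N (fpsC _)) -xt_C_C phiC fps_mapC.
rewrite -[phi N _]/(E h) hE rmorphD EC rmorph_sum; apply: idealD.
  exact: (mem_ideal_ext (constL m N)).
apply: ideal_big => i _; rewrite rmorphM; apply: ideal_mulr.
by apply: phi_x; apply: xt_x_X.
Qed.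

Lemma phi_Q_pow N h : ideal_pow Q N h -> phi N (fpsC h) = 0.
Proof.
move=> Qh; apply: mL_pow.
exact: (@ideal_pow_morph _ _ (phi N \o @fpsC (mps V n)) Q (mL m N) N (@phi_Q N)).
Qed.

(** Modulo t^N, a series in (mV, x, t)^(N+K) has coefficients in (mV, x)^K, which
    phi_K kills. *)
Lemma phi_max_pow N K F : ideal_pow xt_max (N + K) F ->
  exists G, phi K F = tL m K ^+ N * phi K G.
Proof.
move=> /fps_idealP FI; exists (fun i => F (N + i)%N).
rewrite {1}(fps_trunc N F) rmorphD rmorphM rmorphXn phiT rmorph_sum big1 ?add0r // => i _.
rewrite rmorphM phi_Q_pow ?mul0r //; apply: ideal_pow_leq (FI i).
by rewrite -addnBAC ?leq_addl // ltnW.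
Qed.

(** If F is approximated modulo (mV, x, t)^(N+K+1) by elements of J, then t^K
    phi_(K+1)(F) is a power series divisible by t^N; as N is arbitrary, it is zero. *)
Lemma homJ_closed F : (forall N, exists2 G, ideal_pow xt_max N G & J (F - G)) -> J F.
Proof.
move=> FG [|K].
  (* R/m^0 is the zero ring *)
  rewrite -[phi 0 F]mulr1 [1](_ : _ = 0) ?mulr0 // -(rmorph1 (constL m 0)).
  exact/constL0P.
have [s sE] := phi_pole iota r_gen K F.
suff s0 : serL m K.+1 s = 0.
  by rewrite -[LHS](tLXK K) mulrCA sE s0 mulr0.
apply/serL0P => j; have [G IG JG] := FG (j.+1 + K.+1)%N.
have [G' GE] := phi_max_pow IG; have [s' sE'] := phi_pole iota r_gen K G'.
have : serL m K.+1 (s - fpsX R ^+ j.+1 * s') = 0.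
  rewrite rmorphB rmorphM rmorphXn serLX -sE -sE' mulrCA -mulrBr -GE -rmorphB JG.
  exact: mulr0.
by move=> /serL0P/(_ j); rewrite fpsBE fpsXnM ltnSn subr0.
Qed.

Lemma xt_max_unit F : ~ xt_max F -> exists G, F * G = 1.
Proof.
move=> nF; set v := mps_const V n (F 0%N).
have nv : ~ m (iota v) by move=> mv; apply: nF; apply/mps_idealP.
have [y my] := maximal_inv m_maximal nv; have [w mw] := iota_surj y.
have IF : xt_max (1 - F * fpsC (mpsC V n w)).
  pose E : {rmorphism A -> V} := mps_const V n \o fps_coef0 (mps V n).
  have EC : E (fpsC (mpsC V n w)) = w by apply: mps_constC.
  apply/mps_idealP; change (m (iota (E (1 - F * fpsC (mpsC V n w))))).
  rewrite !rmorphB !rmorphM !rmorph1 EC -[E F]/v.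
  apply: (ideal_sub_trans my).
  have -> : y * iota v - iota v * iota w = iota v * (y - iota w) by ring.
  exact: idealMl.
have [||G GE] := one_sub_unit _ _ IF.
- exact/fps_cauchy/mps_cauchy.
- exact/fps_separated/mps_separated.
by exists (fpsC (mpsC V n w) * G); rewrite -GE; ring.
Qed.

Definition hom_max : ideal (quot J) := im_quot J xt_max.

Lemma homJ_proper : ~ J 1.
Proof.
move=> /(_ 1%N); rewrite rmorph1 -(rmorph1 (constL m 1)) => /constL0P/ideal_pow1.
by case: m_maximal.
Qed.

Lemma hom_complete_local : complete_local_ring hom_max.
Proof.
split; first exact/quot_noetherian/fps_noetherian/mps_noetherian.
- apply: is_local_units => [[F IF /quot_projP JF]|u nu].
    have [||G GE] := one_sub_unit _ _ IF.
    - exact/fps_cauchy/mps_cauchy.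
    - exact/fps_separated/mps_separated.
    by apply: homJ_proper; rewrite -GE; apply: ideal_mulr.
  have [F uE] := quot_proj_surj u; have [|G FG] := @xt_max_unit F.
    by move=> IF; apply: nu; exists F.
  by exists (quot_proj J G); rewrite uE -rmorphM FG rmorph1.
apply: cauchy_adic => [|u uI].
  by apply: quot_cauchy; apply: fps_cauchy; apply: mps_cauchy.
have [F uE] := quot_proj_surj u; rewrite uE; apply/quot_proj0P/homJ_closed => N.
have [G IG] := im_quot_pow (uI N); rewrite uE => /quot_projP JG.
by exists G.
Qed.

End HomLocal.

(** * The associated graded ring *)

Section Graded.
Variables (R : comPzRingType) (m : ideal R).
Local Notation G := (gr m).
Local Notation G' := (gr_plus m).

(** F lists representatives of the homogeneous components of u; computing with F
    avoids the chosen representatives in the definition of the product. *)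
Definition gr_represents (F : fps R) (u : G) :=
  fps_homog m F /\ forall i, u i = quot_proj _ (F i).

Lemma gr_rep_represents u : gr_represents (gr_rep u) u.
Proof. by split=> i; [apply: gr_repP|rewrite gr_repK]. Qed.

Lemma gr_represents_eq F H u v : gr_represents F u -> gr_represents H v ->
  fps_eqgr m F H -> u = v.
Proof.
by move=> [_ uF] [_ vH] FH; apply: gr_inj => i; rewrite uF vH; apply/quot_projP.
Qed.

Lemma gr_representsD F H u v : gr_represents F u -> gr_represents H v ->
  gr_represents (F + H) (u + v).
Proof.
move=> [hF uF] [hH vH]; split=> i; first exact: idealD.
by rewrite -[LHS]/(u i + v i) uF vH -rmorphD.
Qed.

Lemma gr_representsM F H u v : gr_represents F u -> gr_represents H v ->
  gr_represents (F * H) (u * v).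
Proof.
move=> [hF uF] [hH vH]; split; first exact: fps_mul_homog.
move=> i; rewrite -[LHS]/(gr_mul u v i) gr_mulE.
transitivity (quot_proj (ideal_pow m i.+1) ((F * gr_rep v) i)).
  apply/quot_projP; apply: fps_mul_eqgr; last exact: gr_repP.
  by move=> j; apply/quot_projP; rewrite gr_repK.
rewrite ![F * _]mulrC; apply/quot_projP; apply: fps_mul_eqgr => //.
by move=> j; apply/quot_projP; rewrite gr_repK.
Qed.

Definition fps_mono (d : nat) (x : R) : fps R := fpsX R ^+ d * fpsC x.

Lemma fps_monoE d x i : fps_mono d x i = if i == d then x else 0.
Proof.
rewrite /fps_mono fpsXnM; case: (ltngtP i d) => [//|ltdi|->]; last by rewrite subnn.
by move: (subn_gt0 d i); rewrite ltdi; case: (i - d)%N.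
Qed.

Lemma fps_mono_homog d x : ideal_pow m d x -> fps_homog m (fps_mono d x).
Proof. by move=> mx i; rewrite fps_monoE; case: eqP => [->//|_]; apply: ideal0. Qed.

(** The class of x in degree d. It is defined as zero when x is not in m^d, which
    makes it a function of x alone. *)
Definition gr_mono (d : nat) (x : R) : G.
Proof.
pose y := if `[< ideal_pow m d x >] then x else 0.
exists (fun i => quot_proj _ (fps_mono d y i)).
  move=> i; exists (fps_mono d y i) => //; apply: fps_mono_homog.
  by rewrite /y; case: asboolP => // _; apply: ideal0.
exists d.+1 => i ltdi; rewrite fps_monoE gtn_eqF //; exact: rmorph0.
Defined.

Lemma gr_mono_represents d x : ideal_pow m d x -> gr_represents (fps_mono d x) (gr_mono d x).
Proof. by move=> mx; split=> [|i] /=; [apply: fps_mono_homog|rewrite asboolT]. Qed.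

Lemma gr_monoE d x i : ideal_pow m d x ->
  gr_mono d x i = quot_proj _ (if i == d then x else 0).
Proof. by move=> /gr_mono_represents[_ ->]; rewrite fps_monoE. Qed.

Lemma gr_represents_uniq F u v : gr_represents F u -> gr_represents F v -> u = v.
Proof.
by move=> Fu Fv; apply: gr_represents_eq Fu Fv _ => i; rewrite subrr; apply: ideal0.
Qed.

Lemma gr_monoD d x y : ideal_pow m d x -> ideal_pow m d y ->
  gr_mono d (x + y) = gr_mono d x + gr_mono d y.
Proof.
move=> mx my; apply: (gr_represents_uniq (F := fps_mono d (x + y))).
  exact/gr_mono_represents/idealD.
rewrite /fps_mono rmorphD mulrDr; exact/gr_representsD/gr_mono_represents/my/gr_mono_represents.
Qed.

Lemma gr_monoM d e x y : ideal_pow m d x -> ideal_pow m e y ->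
  gr_mono (d + e) (x * y) = gr_mono d x * gr_mono e y.
Proof.
move=> mx my; apply: (gr_represents_uniq (F := fps_mono (d + e) (x * y))).
  exact/gr_mono_represents/ideal_powM.
have -> : fps_mono (d + e) (x * y) = fps_mono d x * fps_mono e y.
  by rewrite /fps_mono rmorphM exprD; ring.
by apply: gr_representsM; apply: gr_mono_represents.
Qed.

Lemma gr_mono0P d x : ideal_pow m d x -> (gr_mono d x = 0 <-> ideal_pow m d.+1 x).
Proof.
move=> mx; split=> [e|mx'].
  by apply/quot_proj0P; have := gr_monoE d mx; rewrite eqxx e.
apply: gr_inj => i; rewrite gr_monoE //; apply/quot_proj0P.
by case: eqP => [->//|_]; apply: ideal0.
Qed.

Lemma gr_monoB d x y : ideal_pow m d x -> ideal_pow m d y ->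
  gr_mono d (x - y) = gr_mono d x - gr_mono d y.
Proof.
move=> mx my; apply/eqP; rewrite eq_sym subr_eq -gr_monoD ?subrK //; exact: idealB.
Qed.

Lemma gr_mono0_zmod : zmod_morphism (gr_mono 0).
Proof. by move=> x y; apply: gr_monoB. Qed.

Lemma gr_mono0_monoid : monoid_morphism (gr_mono 0).
Proof.
split=> [|x y]; last exact: (@gr_monoM 0 0).
apply: gr_inj => i; rewrite gr_monoE // -[RHS]/((i == 0%N)%:R : quot _).
by case: i => [|i]; rewrite ?rmorph1 ?rmorph0.
Qed.

Definition gr_C : {rmorphism R -> G} := rmorph_of gr_mono0_zmod gr_mono0_monoid.

Lemma gr_mono_plus d x : (0 < d)%N -> ideal_pow m d x -> G' (gr_mono d x).
Proof.
move=> d_gt0 mx; rewrite -[G' _]/(gr_mono d x 0%N = 0) gr_monoE //.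
by case: d d_gt0 mx => // d _ _; apply: rmorph0.
Qed.

(** The N-th power of gr_+ lives in degrees at least N. *)
Lemma gr_plus_pow N u : ideal_pow G' N u -> forall i, (i < N)%N -> u i = 0.
Proof.
elim: N u => // N IHN; apply: ideal_pow_ind => [//|u v u0 v0 i ltiN|u v u0 /IHN v0 i ltiN].
  by rewrite -[LHS]/(u i + v i) u0 ?v0 ?addr0.
have [_ ->] := gr_representsM (gr_rep_represents u) (gr_rep_represents v).
suff H j : (j <= i)%N -> ideal_pow m i.+1 (gr_rep u j * gr_rep v (i - j)%N).
  apply/quot_proj0P; rewrite fpsME; apply: ideal_big => j _.
  exact/H/leq_ord.
case: j => [|j] leji.
  rewrite subn0 -add1n; apply: ideal_powM (gr_repP _ _).
  by apply/quot_proj0P; rewrite gr_repK.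
have -> : i.+1 = (j.+1 + (i - j.+1).+1)%N by rewrite addnS subnKC.
apply: ideal_powM; first exact: gr_repP.
apply/quot_proj0P; rewrite gr_repK v0 //.
by rewrite ltn_subLR // addSn ltnS (leq_trans _ (leq_addl _ _)).
Qed.

Lemma gr_sum u : exists N, forall M, (N <= M)%N ->
  u = \sum_(i < M) gr_mono i (gr_rep u i).
Proof.
have [N0 uN0] := gr_fin u; exists N0 => N leN; apply: gr_inj => i.
have uN : (N <= i)%N -> u i = 0 by move=> leNi; apply/uN0/(leq_trans leN).
have sumE (F : 'I_N -> G) : (\sum_k F k) i = \sum_k F k i.
  exact: (big_morph (fun v : G => v i) (id1 := 0) (op1 := +%R)).
rewrite sumE; case: (ltnP i N) => [ltiN|leNi]; last first.
  rewrite uN // big1 // => k _; rewrite gr_monoE; last exact: gr_repP.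
  by rewrite gtn_eqF ?rmorph0 //; apply: leq_trans leNi.
rewrite (bigD1 (Ordinal ltiN)) // gr_monoE; last exact: gr_repP.
rewrite (_ : (i == _) = true) ?eqxx // gr_repK big1 => [|k /negPf ki]; first exact/esym/addr0.
rewrite gr_monoE; last exact: gr_repP.
by rewrite eq_sym (_ : (_ == _) = false) ?rmorph0.
Qed.

Lemma gr_mono_plus2 d x : ideal_pow m d.+2 x -> ideal_pow G' 2 (gr_mono d.+2 x).
Proof.
move=> mx; suff [] : ideal_pow m d.+2 x /\ ideal_pow G' 2 (gr_mono d.+2 x) by [].
move: x mx; apply: ideal_pow_ind => [|x y [mx Ix] [my Iy]|x y mx my].
- split; first exact: ideal0.
  rewrite (_ : gr_mono _ _ = 0); first exact: ideal0.
  by apply/gr_mono0P; apply: ideal0.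
- by split; [apply: idealD|rewrite gr_monoD //; apply: idealD].
split; first exact: ideal_powSM.
move/ideal_pow1 in mx; rewrite -[d.+2]add1n gr_monoM //.
apply: ideal_powSM; first exact: gr_mono_plus.
by apply/ideal_pow1; apply: gr_mono_plus.
Qed.

Lemma gr_mod_plus u : exists x, G' (u - gr_C x).
Proof.
exists (gr_rep u 0%N); rewrite -[G' _]/(u 0%N - gr_mono 0 _ 0%N = 0).
by rewrite gr_monoE // gr_repK subrr.
Qed.

(** The graded ring is generated in degree 1. *)
Lemma gr_plus_mod u : G' u -> exists2 x, m x & ideal_pow G' 2 (u - gr_mono 1 x).
Proof.
move=> u0; have [N uE] := gr_sum u.
exists (gr_rep u 1%N); first exact/ideal_pow1/gr_repP.
rewrite {1}(uE N.+2); last by rewrite ltnW.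
rewrite !big_ord_recl (_ : gr_mono _ (gr_rep u ord0) = 0); last first.
  by apply/gr_mono0P => //; apply/quot_proj0P; rewrite gr_repK.
rewrite add0r addrC addKr; apply: ideal_big => i _.
exact/gr_mono_plus2/gr_repP.
Qed.

End Graded.

(** * The special fibre *)

Section SpecialFibre.
Variables (R : comPzRingType) (m : ideal R) (V : comPzRingType).
Variables (iota : {rmorphism V -> R}) (n : nat) (r : 'I_n -> R).
Hypothesis r_gen : forall x, m x <-> exists c : 'I_n -> R, x = \sum_i c i * r i.
Hypothesis iota_surj : forall x, exists v, m (x - iota v).

Local Notation A := (fps (mps V n)).
Local Notation T := (fpsX (mps V n)).
Local Notation J := (homJ iota r_gen).
Local Notation phi := (phi iota r_gen).
Local Notation G := (gr m).
Local Notation G' := (gr_plus m).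
Local Notation X := (xt_x V n).
Local Notation xform := (xform (fps_map iota : {rmorphism fps V -> fps R})
  (fun i => fpsC (r i))).

Definition grq N := quot (ideal_pow G' N).
Definition grpr N : {rmorphism G -> grq N} := quot_proj (ideal_pow G' N).

Let mr i : ideal_pow m 1 (r i).
Proof. exact/ideal_pow1/mem_r. Qed.

Definition grpr_plus N : ideal (grq N) := ideal_ext (grpr N) G'.

Lemma grpr_plus_pow N u : ideal_pow (grpr_plus N) N u -> u = 0.
Proof. by apply: ideal_ext_ker_pow => x Ix; apply/quot_proj0P. Qed.

Definition geval N (i : 'I_n) : grq N := grpr N (gr_mono m 1 (r i)).

Lemma geval_plus N i : grpr_plus N (geval N i).
Proof. exact/mem_ideal_ext/gr_mono_plus. Qed.

Lemma psi_exists N : exists E : {rmorphism A -> grq N},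
  (forall f, E (xt_C V n f) = grpr N (gr_C m (iota (f 0%N)))) /\
  forall i, E (xt_X V i) = geval N i.
Proof.
apply: (xt_eval_exists (grpr N \o (gr_C m \o (iota \o fps_coef0 V)))) => i.
by apply/grpr_plus_pow/ideal_powX/geval_plus.
Qed.

(** The map with t |-> 0 and x_i |-> the class of r_i in degree 1. *)
Definition psi N : {rmorphism A -> grq N} := sval (cid (psi_exists N)).

Lemma psiC N f : psi N (xt_C V n f) = grpr N (gr_C m (iota (f 0%N))).
Proof. by rewrite /psi; case: cid => E []. Qed.

Lemma psiX N i : psi N (xt_X V i) = geval N i.
Proof. by rewrite /psi; case: cid => E []. Qed.

Lemma psiT N : psi N T = 0.
Proof. by rewrite -xt_C_X psiC !rmorph0. Qed.

Lemma psi_x_pow N F : ideal_pow X N F -> psi N F = 0.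
Proof.
move=> IF; apply/grpr_plus_pow/(ideal_pow_morph _ IF) => {IF} F /xt_x_split[H ->].
rewrite rmorph_sum; apply: ideal_big => i _.
by rewrite rmorphM psiX; apply/ideal_mulr/geval_plus.
Qed.

Lemma psi_reduces N F : reduces (psi N F) (psi N.+1 F).
Proof.
have pr0 u : ideal_pow G' N.+1 u -> grpr N u = 0.
  by move=> Iu; apply/quot_proj0P/ideal_powS.
have [a aE] := quot_proj_surj (psi N.+1 F); exists a; split=> //.
rewrite -[RHS](quot_liftE pr0) -[quot_proj _ a]aE.
apply: (@xt_eval_unique _ _ _ N.+1 (psi N) (quot_lift pr0 \o psi N.+1)).
- by move=> H IH; apply/psi_x_pow/ideal_powS.
- by move=> H IH; rewrite -[LHS]/(quot_lift pr0 (psi N.+1 H)) psi_x_pow // rmorph0.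
- by move=> f; rewrite -[RHS]/(quot_lift pr0 (psi N.+1 _)) !psiC quot_liftE.
- by move=> i; rewrite -[RHS]/(quot_lift pr0 (psi N.+1 _)) !psiX quot_liftE.
Qed.

Lemma psi_leq N k F a : psi (k + N) F = grpr (k + N) a -> psi N F = grpr N a.
Proof.
elim: k => // k IHk e; apply: IHk.
have [b [-> eb]] := psi_reduces (k + N) F.
apply/quot_projP/ideal_powS/quot_projP; rewrite -eb; exact: e.
Qed.

Lemma xform_psi N d F rho : xform d F rho ->
  psi N F = grpr N (gr_mono m d (rho 0%N)).
Proof.
elim=> {d F rho} [f|d i F rho FF IH|d|d F F' rho rho' FF IHF FF' IHG].
- exact: psiC.
- rewrite rmorphM psiX IH -rmorphM fpsCM -[d.+1]add1n gr_monoM //.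
  exact: (xform_m r_gen FF).
- rewrite !rmorph0 (_ : gr_mono m d _ = 0) ?rmorph0 //.
  by apply/gr_mono0P; apply: ideal0.
- rewrite !rmorphD IHF IHG -rmorphD fpsDE gr_monoD //.
    exact: (xform_m r_gen FF).
  exact: (xform_m r_gen FF').
Qed.

(** Let Z_d say that t^d phi_(d+1)(F) is a power series without constant term.
    An element of J satisfies every Z_d. If F is in (x)^k and satisfies Z_d for
    all d >= k, then Z_k shows that the value at r of its form of degree k
    lies in m^(k+1) up to multiples of t, so that psi kills this form; subtracting it
    preserves Z_d for d > k, and the argument is repeated until (x)^N. *)
Lemma homJ_psi N F : J F -> psi N F = 0.
Proof.
move=> JF.
pose Z d H := exists s, tL m d.+1 ^+ d * phi d.+1 H = serL m d.+1 (fpsX R * s).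
have main k : (k <= N)%N -> forall H, ideal_pow X (N - k) H ->
    (forall d, (N - k <= d)%N -> Z d H) -> psi N H = 0.
  elim: k => [|k IHk] lek H; first by rewrite subn0 => XH _; apply: psi_x_pow.
  set e := (N - k.+1)%N => XH ZH.
  have eS : (N - k = e.+1)%N by rewrite /e subnSK.
  have [H' [rho [FH XH']]] :=
    xform_approx (fps_map iota : {rmorphism fps V -> fps R}) (fun i => fpsC (r i)) XH.
  have rho0 : ideal_pow m e.+1 (rho 0%N).
    have [s sE] := ZH e (leqnn e).
    have : serL m e.+1 (rho - fpsX R * s) = 0.
      rewrite rmorphB -sE -(xform_phi r_gen _ FH) -mulrBr -rmorphB phi_x_pow ?mulr0 //.
      by rewrite -opprB; apply: idealN.
    by move=> /serL0P/(_ 0%N); rewrite fpsBE fpsXM subr0.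
  have -> : psi N H = psi N (H - H').
    rewrite rmorphB (xform_psi _ FH) (_ : gr_mono m e _ = 0) ?rmorph0 ?subr0 //.
    by apply/gr_mono0P => //; apply: ideal_powS.
  apply: IHk; rewrite ?eS //; first exact: ltnW.
  move=> d ltd; have [s sE] := ZH d (ltnW ltd).
  exists (s - fpsX R ^+ (d - e.+1) * rho).
  rewrite mulrBr mulrA -exprS subnSK // !rmorphB !rmorphM !rmorphXn serLX.
  rewrite -(xform_phi r_gen _ FH) mulrA -exprD subnK ?(ltnW ltd) //.
  by rewrite mulrBr sE rmorphM serLX.
apply: (main N) => //; first by rewrite subnn.
by move=> d _; exists 0; rewrite JF !mulr0 rmorph0.
Qed.

(** Successive approximation. If F in (x)^d is killed by psi, then the value of its
    form of degree d lies in m^(d+1) and hence lifts to t^(d+1) (x)^(d+1) by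
    [homJ_lift]; dividing by t^d shows that the form lies in J + t (x)^d. Summing the
    multiples of t yields H, and F - tH is in J because phi_N sees only finitely many
    steps. *)
Lemma psi_ker F : (forall N, psi N F = 0) -> exists H, J (F - T * H).
Proof.
move=> F0.
have [||S [S0 SP SS]] := @dependent_choice _
    (fun d H => ideal_pow X d H /\ forall N, psi N H = 0)
    (fun d H H' => exists2 K, ideal_pow X d K & J (H - H' - T * K)) F.
- by [].
- move=> d H [XH H0].
  have [H1 [rho [FH XH1]]] :=
    xform_approx (fps_map iota : {rmorphism fps V -> fps R}) (fun i => fpsC (r i)) XH.
  have [h [K1 [Fh H1E XK1]]] := xform_split FH.
  have mrho : ideal_pow m d (rho 0%N) by apply: (xform_m r_gen FH).
  have mrho' : ideal_pow m d.+1 (rho 0%N).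
    have : grpr d.+1 (gr_mono m d (rho 0%N)) = 0.
      rewrite -(xform_psi _ FH) -[H1](subKr H) rmorphB H0 psi_x_pow ?subr0 //.
    move=> /quot_proj0P/gr_plus_pow/(_ d (ltnSn d)).
    by rewrite gr_monoE // eqxx => /quot_proj0P.
  have [K2 XK2 K2E] := homJ_lift r_gen iota_surj mrho'.
  (* t^d times either series takes the value rho_0 *)
have JK : J (fpsC h - T * K2).
    move=> N; rewrite -[LHS](tLXK d) mulrCA rmorphB mulrBr (xform_phi r_gen _ Fh).
    rewrite -[tL m N](phiT iota r_gen) -rmorphXn -rmorphM mulrA -exprSr K2E.
    by rewrite subrr mulr0.
  have JE : J (H1 - T * (K1 + K2)).
    by rewrite (_ : _ - _ = fpsC h - T * K2) // H1E; ring.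
  exists (H - H1).
    split=> // N; rewrite rmorphB H0 sub0r -[H1](subrK (T * (K1 + K2))).
    by rewrite rmorphD homJ_psi // rmorphM psiT mul0r addr0 oppr0.
  exists (K1 + K2); first by apply: idealD => //; apply: ideal_powS.
  by rewrite subKr.
have /choice[K KP] d : exists K, ideal_pow X d K /\ J (S d - S d.+1 - T * K).
  by have [K XK JK] := SS d; exists K.
have [K' K'P] := xt_cauchy (fun d => (KP d).1).
exists K' => N.
have e1 : phi N (S N) = 0 by apply: phi_x_pow; have [] := SP N.
have e2 := phi_x_pow iota r_gen (K'P N).
have e3 : phi N (\sum_(d < N) (S d - S d.+1 - T * K d)) = 0.
  by rewrite rmorph_sum big1 // => d _; have [_] := KP d; apply.
have -> : F - T * K' = S N + \sum_(d < N) (S d - S d.+1 - T * K d)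
    - T * (K' - \sum_(d < N) K d).
  have sE : F = S N + \sum_(d < N) (S d - S d.+1).
    rewrite -S0; elim: (N) => [|k IHk]; first by rewrite big_ord0 addr0.
    by rewrite big_ord_recr /= {1}IHk; ring.
  by rewrite sumrB -mulr_sumr {1}sE; ring.
by rewrite !rmorphD rmorphN rmorphM e1 e2 e3 mulr0 subr0 addr0.
Qed.

(** Modulo the power N+1, the factors of a product of N elements of gr_+ only
    matter modulo the square of gr_+, that is, in degree 1, where the r_i span over V. *)
Lemma psi_onto N a : ideal_pow G' N a ->
  exists2 F, ideal_pow X N F & psi N.+1 F = grpr N.+1 a.
Proof.
have onto1 b : G' b -> exists2 F, X F & psi 2 F = grpr 2 b.
  move=> /gr_plus_mod[x mx Ib]; have [h [y [Fh my]]] := xform_const r_gen iota_surj ((ideal_pow1 _ _).2 mx).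
  exists (fpsC h); first exact/ideal_pow1/(xform_xt_x Fh).
  rewrite (xform_psi _ Fh); apply/esym/quot_projP; apply: ideal_sub_trans Ib _.
  have my1 : ideal_pow m 1 y by exact: (xform_m r_gen Fh 0%N).
  rewrite -gr_monoB //; last exact/ideal_pow1.
  rewrite (_ : gr_mono _ _ _ = 0); first exact: ideal0.
  by apply/gr_mono0P => //; apply: ideal_powS.
elim: N a => [|N IHN] a.
  move=> _; have [x Ix] := gr_mod_plus a; have [v mv] := iota_surj x.
  exists (xt_C V n (fpsC v)) => //; rewrite psiC; apply/esym/quot_projP.
  apply/ideal_pow1/(ideal_sub_trans Ix); rewrite -rmorphB.
  rewrite (_ : gr_C m _ = 0); first exact: ideal0.
  by apply/gr_mono0P => //; apply/ideal_pow1.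
move: a; apply: ideal_pow_ind => [|a b [F XF Fa] [H XH Hb]|a b Ga Gb].
- by exists 0; [apply: ideal0|rewrite !rmorph0].
- by exists (F + H); [apply: idealD|rewrite !rmorphD Fa Hb].
have [F XF Fa] := onto1 a Ga; have [H XH Hb] := IHN b Gb.
exists (F * H); first exact: ideal_powSM.
have [al alE] := quot_proj_surj (psi N.+2 F); have [be beE] := quot_proj_surj (psi N.+2 H).
have Ial : ideal_pow G' 2 (al - a).
  have alE' : psi (N + 2) F = grpr (N + 2) al by rewrite addnC.
  by apply/quot_projP; rewrite -[LHS](psi_leq alE') Fa.
have Ibe : ideal_pow G' N.+1 (be - b).
  have beE' : psi (1 + N.+1) H = grpr (1 + N.+1) be by [].
  by apply/quot_projP; rewrite -[LHS](psi_leq beE') Hb.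
rewrite rmorphM alE beE -[quot_proj _ al]/(grpr N.+2 al) -[quot_proj _ be]/(grpr N.+2 be).
rewrite -rmorphM; apply/quot_projP.
have -> : al * be - a * b = (al - a) * b + al * (be - b) by ring.
apply: idealD; first exact: (@ideal_powM _ _ 2 N).
apply: ideal_powSM => //; apply: ideal_subl Ga.
by apply: ideal_pow_sub Ial.
Qed.

(** Surjectivity: lift a coherent sequence step by step, the error at step N being
    in the image of (x)^N by [psi_onto]. *)
Lemma special_fibre : ring_iso (quot (ideal_gen [set quot_proj J T]%classic)) (completion G').
Proof.
pose Psi := completion_lift psi_reduces.
have PsiJ F : J F -> Psi F = 0 by move=> JF; apply: cmp_inj => N; apply: homJ_psi.
pose PsiH := quot_lift PsiJ.
have PsiT u : ideal_gen [set quot_proj J T]%classic u -> PsiH u = 0.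
  move=> [s [sT ->]]; rewrite rmorph_sum big1_seq // => p /andP[_ /sT ->].
  rewrite rmorphM [X in _ * X](_ : _ = 0) ?mulr0 // [LHS]quot_liftE.
  by apply: cmp_inj => N; apply: psiT.
set I := ideal_gen _ in PsiT *.
pose f : {rmorphism quot I -> completion G'} := quot_lift PsiT.
have fE F : f (quot_proj I (quot_proj J F)) = Psi F by rewrite /f !quot_liftE.
exists f; apply: inj_surj_bij => [u v uv|w].
  apply/eqP; rewrite -subr_eq0; apply/eqP.
  have [x xE] := quot_proj_surj (u - v); have [F FE] := quot_proj_surj x.
  have F0 : Psi F = 0 by rewrite -fE -FE -xE rmorphB uv subrr.
  have [H JH] : exists H, J (F - T * H).
    by apply: psi_ker => N; rewrite -[LHS](completion_liftE psi_reduces F N) -/Psi F0.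
  rewrite xE FE; apply/quot_proj0P; move/quot_projP: JH => ->.
  by rewrite rmorphM; apply/ideal_mulr/mem_ideal_gen.
have [||S [_ SP SS]] := @dependent_choice _ (fun N F => psi N F = w N)
    (fun N F F' => ideal_pow X N (F' - F)) 0.
- by have [a ->] := quot_proj_surj (w 0%N); rewrite rmorph0; apply/esym/quot_proj0P.
- move=> N F Fw; have [a aE] := quot_proj_surj (w N.+1).
  have [b bE] := quot_proj_surj (psi N.+1 F).
  have Iab : ideal_pow G' N (a - b).
    apply/quot_projP; rewrite -(cmp_reducesE aE) -Fw.
    exact: (@psi_leq N 1).
  have [H XH HE] := psi_onto Iab.
  exists (F + H); last by rewrite addrC addrA addNr add0r.
  by rewrite rmorphD HE bE aE -rmorphD addrC subrK.
have [K KP] := xt_cauchy SS.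
have KS N : ideal_pow X N (S 0%N + K - S N).
  have -> : S 0%N + K - S N = K - \sum_(d < N) (S d.+1 - S d); last exact: KP.
  elim: (N) => [|k IHk]; first by rewrite big_ord0; ring.
  have -> : S 0%N + K - S k.+1 = S 0%N + K - S k - (S k.+1 - S k) by ring.
  by rewrite IHk big_ord_recr /=; ring.
exists (quot_proj I (quot_proj J (S 0%N + K))); rewrite fE.
apply: cmp_inj => N; rewrite completion_liftE -SP.
by apply/eqP; rewrite -subr_eq0 -rmorphB psi_x_pow.
Qed.

End SpecialFibre.

(** * The generic fibre *)

Section GenericFibre.
Variables (R : comPzRingType) (m : ideal R) (V : comPzRingType).
Variables (iota : {rmorphism V -> R}) (n : nat) (r : 'I_n -> R).
Hypothesis r_gen : forall x, m x <-> exists c : 'I_n -> R, x = \sum_i c i * r i.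
Hypothesis iota_surj : forall x, exists v, m (x - iota v).
Hypothesis V_noetherian : is_noetherian V.

Local Notation A := (fps (mps V n)).
Local Notation T := (fpsX (mps V n)).
Local Notation J := (homJ iota r_gen).
Local Notation phi := (phi iota r_gen).
Local Notation X := (xt_x V n).
Local Notation Q := (mps_ideal (coef_ideal m iota) n).

Local Notation B := (base_laurent iota).
Local Notation C := (hom_laurent J).

Definition b_inl : {rmorphism R -> B} := @tensor_inl _ _ _ iota (laurentC V).
Definition b_inr : {rmorphism laurent V -> B} := tensor_inrM iota (laurentC V).
Definition locX : {rmorphism fps V -> laurent V} := @loc_map (fps V) (fpsX V).
Definition c_inl : {rmorphism quot J -> C} := @tensor_inl _ _ _ (hom_alg J) locX.
Definition c_inr : {rmorphism laurent V -> C} := tensor_inrM (hom_alg J) locX.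

Lemma b_bal v : b_inl (iota v) = b_inr (locX (fpsC v)).
Proof. exact: tensor_bal_eq. Qed.

Lemma c_bal f : c_inl (quot_proj J (xt_C V n f)) = c_inr (locX f).
Proof. exact: tensor_bal_eq. Qed.

Lemma b_repr u : exists s : seq (R * laurent V), u = \sum_(p <- s) b_inl p.1 * b_inr p.2.
Proof. exact: tensor_repr. Qed.

Lemma c_repr u : exists s : seq (quot J * laurent V),
  u = \sum_(p <- s) c_inl p.1 * c_inr p.2.
Proof. exact: tensor_repr. Qed.

Local Notation base_I := (ideal_ext (base_to_laurent iota) m).
Local Notation hom_I := (ideal_ext (hom_mps_laurent J) Q).

Lemma locX_unit : locX (fpsX V) * loc_inv (fpsX V) = 1.
Proof. exact: loc_map_inv. Qed.

(** R/m^N is a finitely generated V-module: write x as v + a_1 r_1 + ... and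
    expand the a_j modulo m^(N-1). *)
Lemma residue_span N : exists (I : finType) (e : I -> R),
  forall x, exists c : I -> V, ideal_pow m N (x - \sum_i iota (c i) * e i).
Proof.
elim: N => [|N [I [e eP]]]; first by exists 'I_0, (fun=> 0) => x; exists (fun=> 0).
(* the generators 1 and e_i r_j *)
exists (unit + I * 'I_n)%type, (fun k => if k is inr ij then e ij.1 * r ij.2 else 1) => x.
have [v /r_gen[a aE]] := iota_surj x.
have /choice[c cP] j := eP (a j).
exists (fun k => if k is inr ij then c ij.2 ij.1 else v).
rewrite big_sumType /= (big_pred1 tt) => [|[]//]; rewrite mulr1.
rewrite -(pair_bigA _ (fun i j => iota (c j i) * (e i * r j))) exchange_big /=.
rewrite opprD addrA aE -sumrB; apply: ideal_big => j _.
rewrite (_ : _ - _ = r j * (a j - \sum_i iota (c j i) * e i)).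
  by apply: ideal_powSM; [apply: mem_r|apply: cP].
by rewrite mulrBr mulrC mulr_sumr; congr (_ - _); apply: eq_bigr => i _; ring.
Qed.

Section Chi.
Variable N : nat.

Definition serV : {rmorphism fps V -> resL m N} :=
  serL m N \o (fps_map iota : {rmorphism fps V -> fps R}).

Lemma serV_unit : serV (fpsX V) * tinvL m N = 1.
Proof.
rewrite -(tL_inv m N); congr (_ * _); rewrite -serLX -(fps_mapX iota) //.
Qed.

Definition chiV : {rmorphism laurent V -> resL m N} := loc_lift serV_unit.

Lemma chiV_loc f : chiV (locX f) = serL m N (fps_map iota f).
Proof. exact: loc_lift_map. Qed.

Lemma chiB_bal v : constL m N (iota v) = chiV (laurentC V v).
Proof. by rewrite [RHS]chiV_loc fps_mapC. Qed.

(** [chiB] and [chiC] are the maps of R (x) V((t)) and of hom(R) (x) V((t)) to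
    (R/m^N)((t)). *)
Definition chiB : {rmorphism B -> resL m N} := tensor_lift chiB_bal.

Lemma phiJ F : J F -> phi N F = 0. Proof. by apply. Qed.

Lemma chiC_bal f : quot_lift phiJ (hom_alg J f) = chiV (locX f).
Proof. by rewrite [LHS]quot_liftE chiV_loc -(phiC iota r_gen). Qed.

Definition chiC : {rmorphism C -> resL m N} := tensor_lift chiC_bal.

Lemma chiB_inl x : chiB (b_inl x) = constL m N x. Proof. exact: tensor_lift_inl. Qed.
Lemma chiB_inr x : chiB (b_inr x) = chiV x. Proof. exact: tensor_lift_inr. Qed.
Lemma chiC_inl F : chiC (c_inl (quot_proj J F)) = phi N F.
Proof. by rewrite [LHS]tensor_lift_inl quot_liftE. Qed.
Lemma chiC_inr x : chiC (c_inr x) = chiV x. Proof. exact: tensor_lift_inr. Qed.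

Lemma chiC_pow u : ideal_pow hom_I N u -> chiC u = 0.
Proof.
move=> Iu; apply: (@mL_pow R m N); apply: ideal_pow_morph Iu.
suff: forall x, hom_I x -> preim_ideal chiC (mL m N) x by [].
apply: ideal_ext_min => q Qq.
change (mL m N (chiC (c_inl (quot_proj J (fpsC q))))).
by rewrite chiC_inl; apply: phi_Q.
Qed.

(** Finitely many Laurent series have a common denominator. *)
Lemma base_repr (u : B) : exists k (I : finType) (b : I -> R) (f : I -> fps V),
  b_inr (locX (fpsX V)) ^+ k * u = \sum_i b_inl (b i) * b_inr (locX (f i)).
Proof.
have [s ->] := b_repr u; elim: s => [|[x l] s [k [I [b [f E]]]]].
  by exists 0%N, 'I_0, (fun=> 0), (fun=> 0); rewrite big_nil mulr0 big_ord0.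
have [g [j ->]] := loc_repr l.
exists (k + j)%N, (unit + I)%type, (fun i => if i is inr i then b i else x),
  (fun i => if i is inr i then fpsX V ^+ j * f i else fpsX V ^+ k * g).
rewrite big_cons mulrDr big_sumType (big_pred1 tt) => [|[]//]; congr (_ + _).
  change (b_inr (locX (fpsX V)) ^+ (k + j) *
    (b_inl x * b_inr (locX g * loc_inv (fpsX V) ^+ j)) =
    b_inl x * b_inr (locX (fpsX V ^+ k * g))).
  rewrite !rmorphM !rmorphXn exprD.
  transitivity ((b_inr (locX (fpsX V)) * b_inr (loc_inv (fpsX V))) ^+ j *
    (b_inl x * (b_inr (locX (fpsX V)) ^+ k * b_inr (locX g)))); first by rewrite exprMn; ring.
  by rewrite -rmorphM locX_unit rmorph1 expr1n mul1r.
rewrite addnC exprD -mulrA E mulr_sumr; apply: eq_bigr => i _.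
by rewrite !rmorphM !rmorphXn; ring.
Qed.

Lemma base_I_pow x : ideal_pow m N x -> ideal_pow base_I N (b_inl x).
Proof. by apply: ideal_pow_morph => y my; apply: (mem_ideal_ext b_inl). Qed.

(** Clear the denominators and express the left factors by generators e_i of
    R/m^N over V, so that the element becomes the sum of the e_i (x) g_i. For each j the
    coefficients of t^j in the g_i form a linear relation over V between the e_i.
    The module of relations is generated by finitely many of them;
    collecting the multipliers of each generator into a power series
    writes the element as a combination of tensors whose left factors are in m^N. *)
Lemma chiB_ker u : chiB u = 0 -> ideal_pow base_I N u.
Proof.
move=> u0; have [k [K [b [f uE]]]] := base_repr u.
have [I [e eP]] := residue_span N.
have /choice[c cP] i := eP (b i).
pose g i := \sum_k fpsC (c k i) * f k.
(* modulo the N-th power, the left factors become combinations of the e_i, and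
   their coefficients in V pass to the right factor *)
pose v := \sum_i b_inl (e i) * b_inr (locX (g i)).
have uv : ideal_pow base_I N (b_inr (locX (fpsX V)) ^+ k * u - v).
  have -> : v = \sum_k b_inl (\sum_i iota (c k i) * e i) * b_inr (locX (f k)).
    rewrite /v; under eq_bigr do rewrite /g !rmorph_sum mulr_sumr.
    rewrite exchange_big; apply: eq_bigr => j _.
    rewrite rmorph_sum mulr_suml; apply: eq_bigr => i _.
    by rewrite !rmorphM b_bal; ring.
  rewrite uE -sumrB; apply: ideal_big => j _; rewrite -mulrBl -rmorphB.
  exact/ideal_mulr/base_I_pow.
suff Iv : ideal_pow base_I N v.
  have -> : u = b_inr (loc_inv (fpsX V)) ^+ k * (b_inr (locX (fpsX V)) ^+ k * u).
    by rewrite mulrA -exprMn -rmorphM mulrC [_ * locX _]mulrC locX_unit rmorph1 expr1n mulr1.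
  exact/idealMl/(ideal_subl uv).
have rel j : ideal_pow m N (\sum_i e i * iota (g i j)).
  have chi0 : chiB v = 0.
    rewrite -(subKr (b_inr (locX (fpsX V)) ^+ k * u) v) rmorphB rmorphM u0 mulr0 sub0r.
    apply/eqP; rewrite oppr_eq0; apply/eqP/(@mL_pow R m N).
    apply: ideal_pow_morph uv => {uE} x.
    suff: forall x, base_I x -> preim_ideal chiB (mL m N) x by apply.
    apply: ideal_ext_min => y my; change (mL m N (chiB (b_inl y))).
    by rewrite chiB_inl; apply: (mem_ideal_ext (constL m N)).
  have /serL0P/(_ j) : serL m N (\sum_i fpsC (e i) * fps_map iota (g i)) = 0.
    rewrite -chi0 /v !rmorph_sum; apply: eq_bigr => i _.
    by rewrite !rmorphM chiB_inl chiB_inr chiV_loc.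
  by rewrite fps_sumE; under eq_bigr do rewrite fpsCM.
pose P (w : fps V) := ideal_pow m N (\sum_i e i * iota (w (enum_rank i))).
have [||a w Pw|s sP sspan] := @free_noetherian V #|I| P V_noetherian.
- by rewrite /P big1 ?ideal0 // => [|i _]; [apply: ideal0|rewrite [X in iota X]/(0 : V) rmorph0 mulr0].
- move=> w w' Pw Pw'; rewrite /P.
  rewrite (_ : \sum_i _ = \sum_i e i * iota (w (enum_rank i)) + \sum_i e i * iota (w' (enum_rank i))).
    exact: idealD.
  by rewrite -big_split; apply: eq_bigr => i _; rewrite fpsDE rmorphD mulrDr.
- rewrite /P (_ : \sum_i _ = iota a * \sum_i e i * iota (w (enum_rank i))); first exact: idealMl.
  by rewrite mulr_sumr; apply: eq_bigr => i _; rewrite fpsCM rmorphM mulrCA.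
(* the coefficients of t^j in the g_i, extended by zero to a sequence *)
pose w j : fps V := fun k => if insub k is Some o then g (enum_val (o : 'I_#|I|)) j else 0.
have wE j i : w j (enum_rank i) = g i j by rewrite /w valK enum_rankK.
have /choice[d dP] j : exists d : nat -> V, forall i, g i j = \sum_(l < size s) d l * (s`_l : fps V) (enum_rank i).
  have [|d dP] := sspan (w j); first by rewrite /P; under eq_bigr do rewrite wE.
  by exists d => i; rewrite -wE dP.
have -> : v = \sum_(l < size s) b_inl (\sum_i e i * iota ((s`_l : fps V) (enum_rank i)))
    * b_inr (locX (fun j => d j l)).
  have gE i : g i = \sum_(l < size s) fpsC ((s`_l : fps V) (enum_rank i)) * (fun j => d j l).
    apply: funext => j; rewrite dP fps_sumE; apply: eq_bigr => l _.
    by rewrite fpsCM mulrC.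
  rewrite /v; under eq_bigr do rewrite gE !rmorph_sum mulr_sumr.
  rewrite exchange_big; apply: eq_bigr => l _.
  rewrite rmorph_sum mulr_suml; apply: eq_bigr => i _.
  by rewrite !rmorphM b_bal; ring.
apply: ideal_big => l _; apply/ideal_mulr/base_I_pow.
by apply: sP; apply: mem_nth.
Qed.

End Chi.

(** The map from R (x) V((t)) to hom(R) (x) V((t)) is strict since both sides map
    compatibly to (R/m^N)((t)), where [chiB_ker] and [chiC_pow] apply, and dense since
    hom(R) is generated by V[[t]] modulo (x). *)
Lemma generic_fibre : ring_iso (completion hom_I) (completion base_I).
Proof.
have [sig sigE sigL] := homJ_lift_ring r_gen iota_surj.
have sig_iota v : sig (iota v) = quot_proj J (xt_C V n (fpsC v)).
  by apply: sigE => M; rewrite phiC fps_mapC.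
have bal v : (c_inl \o sig) (iota v) = c_inr (laurentC V v).
  by rewrite /= sig_iota c_bal.
pose Th : {rmorphism B -> C} := tensor_lift bal.
have Th_inl x : Th (b_inl x) = c_inl (sig x) by apply: tensor_lift_inl.
have Th_inr x : Th (b_inr x) = c_inr x by apply: tensor_lift_inr.
have chiTh N u : chiC N (Th u) = chiB N u.
  have [s ->] := b_repr u; rewrite (rmorph_sum Th) !rmorph_sum; apply: eq_bigr => -[x l] _.
  rewrite !rmorphM Th_inl Th_inr chiC_inr chiB_inl chiB_inr; congr (_ * _).
  have [G _ GE] := @homJ_lift _ _ _ iota n r r_gen iota_surj 0 x Logic.I.
  by rewrite (sigE _ _ GE) chiC_inl GE.
have hom_I_X i : hom_I (c_inl (quot_proj J (xt_X V i))).
  apply: (@mem_ideal_ext _ _ (hom_mps_laurent J) Q (mpsX V i)).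
  by apply/mps_idealP; rewrite mps_constX; apply: ideal0.
have hom_I_x F : X F -> hom_I (c_inl (quot_proj J F)).
  move=> /xt_x_split[G ->]; rewrite !rmorph_sum; apply: ideal_big => i _.
  by rewrite !rmorphM; apply: ideal_mulr; apply: hom_I_X.
have base_hom b : base_I b -> hom_I (Th b).
  suff: forall x, base_I x -> preim_ideal Th hom_I x by apply.
  apply: ideal_ext_min => x mx; change (hom_I (Th (b_inl x))); rewrite Th_inl.
  have [G XG ->] := sigL 1%N x ((ideal_pow1 _ _).2 mx).
  by rewrite !rmorphM; apply/idealMl/hom_I_x/ideal_pow1.
apply: (@completion_iso B C Th) => [N b|N].
  split; first exact: ideal_pow_morph.
  by move=> /chiC_pow; rewrite chiTh => /chiB_ker.
apply: (@dense_pow B C Th base_I hom_I) => // c.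
  have [s ->] := c_repr c; elim: s => [|[h l] s [b Ib]].
    by exists 0; rewrite rmorph0 subr0 big_nil; apply: ideal0.
  have [F ->] := quot_proj_surj h; have [f [G FE]] := xt_split F.
  exists (b_inr (locX f * l) + b); rewrite big_cons rmorphD opprD addrACA.
  apply: idealD => //.
  change (hom_I (c_inl (quot_proj J F) * c_inr l - Th (b_inr (locX f * l)))).
  rewrite Th_inr rmorphM -c_bal -mulrBl -!rmorphB; apply/ideal_mulr/hom_I_x.
  rewrite FE (_ : _ - _ = \sum_i xt_X V i * G i); last by rewrite addrC addKr.
  by apply: ideal_big => i _; apply/ideal_mulr/xt_x_X.
suff: forall x, hom_I x -> ideal_ext Th base_I x by apply.
apply: ideal_ext_min => q Qq; change (ideal_ext Th base_I (c_inl (quot_proj J (fpsC q)))).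
have [g qE] := mps_split q.
pose E : {rmorphism mps V n -> C} := c_inl \o (quot_proj J \o @fpsC (mps V n)).
have mem x y : m x -> Th (b_inl x) = y -> ideal_ext Th base_I y.
  by move=> mx <-; apply/mem_ideal_ext/(mem_ideal_ext b_inl).
rewrite -[c_inl _]/(E q) qE rmorphD rmorph_sum; apply: idealD.
  apply: (mem (iota (mps_const V n q))); first by move/mps_idealP: Qq.
  by rewrite Th_inl sig_iota xt_C_C.
apply: ideal_big => i _; rewrite rmorphM; apply: ideal_mulr.
have -> : E (mpsX V i) = c_inr (loc_inv (fpsX V)) * Th (b_inl (r i)).
  have -> : Th (b_inl (r i)) = c_inr (locX (fpsX V)) * E (mpsX V i).
    rewrite Th_inl -c_bal -!rmorphM; congr (c_inl _).
    rewrite (sigE _ (T * xt_X V i)) ?xt_C_X ?rmorphM // => M.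
    rewrite rmorphM phiT phiX /evalL mulrCA tL_inv mulr1 //.
  by rewrite mulrA -rmorphM mulrC [_ * locX _]mulrC locX_unit rmorph1 mulr1.
by apply/idealMl/(mem (r i)) => //; apply: mem_r.
Qed.

End GenericFibre.

(** * The homogenization *)

Lemma ideal_xP (V : comPzRingType) n q : ideal_x V n q <-> mps_const V n q = 0.
Proof.
split=> [|q0].
  move=> xq; apply/(mps_xP q); move: q xq; apply: ideal_gen_min => _ [i _ <-].
  exact: mps_x_X.
have [g ->] := mps_split q; rewrite q0 rmorph0 add0r; apply: ideal_big => i _.
by apply/ideal_mulr/mem_ideal_gen; exists i.
Qed.

Lemma ideal_pxP (V : comPzRingType) n p q :
  ideal_px V n p q <-> ideal_gen [set p%:R]%classic (mps_const V n q).
Proof.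
split=> [|pq].
  move=> xq; apply/mps_idealP; move: q xq.
  apply: ideal_gen_min => _ [->|[i _ <-]]; apply/mps_idealP.
    by rewrite rmorph_nat; apply: mem_ideal_gen.
  by rewrite mps_constX; apply: ideal0.
have [g ->] := mps_split q; apply: idealD; last first.
  by apply: ideal_big => i _; apply/ideal_mulr/mem_ideal_gen; right; exists i.
suff: forall v, ideal_gen [set p%:R]%classic v ->
    preim_ideal (mpsC V n) (ideal_px V n p) v by apply.
apply: ideal_gen_min => _ ->; change (ideal_px V n p (mpsC V n p%:R)).
by rewrite rmorph_nat; apply: mem_ideal_gen; left.
Qed.

(** The common form of both cases: the ideal of the statement is described by the
    condition that its elements have constant term in the preimage of m in V. *)
Lemma homogenization_exists (R : comPzRingType) (m : ideal R)
    (V : comPzRingType) (iota : {rmorphism V -> R}) (Q : forall n, ideal (mps V n)) :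
  complete_local_ring m ->
  (forall x, exists v, m (x - iota v)) ->
  is_noetherian V -> cauchy_complete (coef_ideal m iota) ->
  (forall v, (forall N, ideal_pow (coef_ideal m iota) N v) -> v = 0) ->
  (forall n q, Q n q <-> m (iota (mps_const V n q))) ->
  exists (n : nat) (J : ideal (fps (mps V n))), is_homogenization m iota J (Q n).
Proof.
move=> [nR [mmax _] _] surj nV cV sV QE; have [s sm] := nR m.
pose r (i : 'I_(size s)) := s`_i.
have r_gen x : m x <-> exists c : 'I_(size s) -> R, x = \sum_i c i * r i.
  by rewrite sm ideal_gen_seq.
exists (size s), (homJ iota r_gen).
have -> : Q (size s) = mps_ideal (coef_ideal m iota) (size s).
  by apply: eq_ideal => q; rewrite QE mps_idealP.
split.
- by exists (hom_max iota r_gen); apply: hom_complete_local.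
- move=> h; have [F ->] := quot_proj_surj h.
  rewrite /hom_t -rmorphM => /quot_proj0P JF; apply/quot_proj0P.
  exact: homJ_T JF.
- exact: special_fibre.
- exact: generic_fibre.
Qed.

Lemma field_noetherian (V : comPzRingType) :
  (forall x : V, x <> 0 -> exists y, x * y = 1) -> is_noetherian V.
Proof.
move=> Vf J; have [[x [Jx /eqP x0]]|J0] := pselect (exists x, J x /\ x != 0).
  exists [:: 1] => y; split=> _; last first.
    have [z xz] := Vf x x0; rewrite -(mul1r y) -xz; exact/ideal_mulr/ideal_mulr.
  by rewrite -(mulr1 y); apply/idealMl/mem_ideal_gen => /=; rewrite inE.
exists [::] => y; split=> [Jy|].
  suff -> : y = 0 by apply: ideal0.
  by apply: contrapT => /eqP y0; apply: J0; exists y.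
by apply: ideal_gen_min.
Qed.

Theorem theorem1 (R : comPzRingType) (m : ideal R)
    (R_complete_local : complete_local_ring m)
    (V : comPzRingType) (iota : {rmorphism V -> R}) :
  (equal_characteristic R ->
   injective iota ->
   is_coefficient_field m (range iota) ->
   exists (n : nat) (J : ideal (fps (mps V n))),
     is_homogenization m iota J (ideal_x V n))
  /\
  (mixed_characteristic R ->
   forall (p : nat) (mV : ideal V) (e : {rmorphism quot mV -> quot m}),
   has_char (quot m) p ->
   is_complete_unramified_dvr mV p ->
   bijective e ->
   (forall v : V, e (quot_proj mV v) = quot_proj m (iota v)) ->
   exists (n : nat) (J : ideal (fps (mps V n))),
     is_homogenization m iota J (ideal_px V n p)).
Proof.
split=> [_ iota_inj [subK injK surjK]|_ p mV e _ [dvrV cV _ _ mVp] e_bij eE].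
  have m0 v : m (iota v) <-> v = 0.
    split=> [mv|->]; last by rewrite rmorph0; apply: ideal0.
    apply: iota_inj; apply: injK; [by exists v|by exists 0|].
    by apply/quot_projP; rewrite rmorph0 subr0.
  have mV0 : coef_ideal m iota = zero_ideal V by apply: eq_ideal => v; apply: m0.
  apply: (@homogenization_exists R m V iota (ideal_x V)) => //.
  - move=> x; have [_ [v _ <-] vx] := surjK (quot_proj m x).
    by exists v; apply/quot_projP.
  - apply: field_noetherian => v v0.
    have [||_ [w _ <-] vw] := subfieldV subK (x := iota v); first by exists v.
      by apply/eqP => v0'; apply: v0; apply: iota_inj; rewrite v0' rmorph0.
    by exists w; apply: iota_inj; rewrite rmorphM rmorph1.
  - by rewrite mV0; apply: zero_ideal_cauchy.
  - by move=> v /(_ 1%N)/ideal_pow1/m0.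
  - by move=> n q; rewrite ideal_xP m0.
have e_inj := bij_inj e_bij.
have mVE : coef_ideal m iota = mV.
  apply: eq_ideal => v; split=> [mv|mv].
    apply/quot_proj0P/e_inj; rewrite eE rmorph0; exact/quot_proj0P.
  by change (m (iota v)); apply/quot_proj0P; rewrite -eE (quot_proj0P mV v).2 ?rmorph0.
apply: (@homogenization_exists R m V iota (ideal_px V ^~ p)) => //.
- move=> x; have [f _ fK] := e_bij; have [v vE] := quot_proj_surj (f (quot_proj m x)).
  by exists v; apply/quot_projP; rewrite -eE -vE fK.
- move=> J; have [a aJ] := dvr_principal dvrV J; exists [:: a] => x.
  rewrite aJ; split; apply: ideal_gen_min => y.
    by move=> ->; apply: mem_ideal_gen => /=; rewrite inE.
  by rewrite /= inE => /eqP ->; apply: mem_ideal_gen.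
- by rewrite mVE; apply: adic_cauchy.
- rewrite mVE => v vN; apply: (bij_inj cV); apply: cmp_inj => N.
  by rewrite rmorph0; apply/quot_proj0P.
- by move=> n q; rewrite ideal_pxP -mVp -mVE.
Qed.
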